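(* Let $\Omega\subset\mathbb{R}^d$ be a bounded, connected, open set with Lipschitz boundary, let $p\in[1,+\infty)$, and let $|\cdot|_*$ be a norm on $\mathbb{R}^d$. Let $K$ be a kernel on $\mathbb{R}^d$ such that: (i) $K\notin L^1(\mathbb{R}^d)$; (ii) there is $c_0\in(0,1]$ such that $|x|_*\le|y|_*$ implies $K(x)\ge c_0K(y)$; (iii) there are positive constants $D$ and $C_D$ such that $|y|_*=2|x|_*$ and $|x|_*\le D$ imply $K(x)\le C_DK(y)$; (iv) $\int_{\mathbb{R}^d}K(z)\min\{1,|z|_2^p\}\,dz<+\infty$. Then there exists a positive constant $C$ such that $$\Bigl(\int_\Omega|u-u_\Omega|^p\,dx\Bigr)^{1/p}\le C\,[u]_{W^{K,p}(\Omega)}\qquad\text{for every }u\in W^{K,p}(\Omega).$$ Moreover, if for some $q\in[1,+\infty)$ there is a positive constant $C_1$ such that $\mathcal{P}_{K^*}(B^m)\ge m^{1/q}/C_1$ for every $m>0$, then there exists a positive constant $C$ such that $$\Bigl(\int_\Omega|u-u_\Omega|^q\,dx\Bigr)^{1/q}\le C\,[u]_{W^{K,1}(\Omega)}\qquad\text{for every }u\in W^{K,1}(\Omega).$$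
   Context: Here $d\ge1$ and $|\cdot|_2$ is the Euclidean norm. A kernel is a measurable function $K:\mathbb{R}^d\to[0,+\infty]$ that is not a.e. equal to $0$. For an open set $\Omega\subset\mathbb{R}^d$ and $p\in[1,+\infty)$, $[u]_{W^{K,p}(\Omega)}:=\left(\int_{\Omega}\int_\Omega|u(x)-u(y)|^pK(x-y)\,dx\,dy\right)^{1/p}\in[0,+\infty]$ and $W^{K,p}(\Omega):=\{u\in L^p(\Omega):[u]_{W^{K,p}(\Omega)}<+\infty\}$. For $u\in L^1(\Omega)$, $u_\Omega:=\frac1{|\Omega|}\int_\Omega u\,dx$. For $m>0$, $B^m$ is the open Euclidean ball centred at the origin with Lebesgue measure $m$. For a measurable set $A$ with finite measure $|A|$, $A^*:=B^{|A|}$ (with $A^*=\emptyset$ if $|A|=0$). The symmetric-decreasing rearrangement of $K$ is $K^*(x):=\int_0^{+\infty}\mathbf{1}_{\{K>t\}^*}(x)\,dt$. For a kernel $J$ and a measurable set $E\subset\mathbb{R}^d$, $\mathcal{P}_J(E):=\frac12\int_{\mathbb{R}^d}\int_{\mathbb{R}^d}|\mathbf{1}_E(x)-\mathbf{1}_E(y)|J(x-y)\,dx\,dy$. *)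

(* Defs.v *)
(* Real analysis over an abstract [R : realType], with MathComp-Analysis.
   Points of R^n are row vectors ['rV[R]_n]. *)
From HB Require Import structures.
From mathcomp Require Import all_boot all_order all_algebra.
From mathcomp Require Import all_classical all_reals all_analysis measurable_realfun.

Set Implicit Arguments.
Unset Strict Implicit.
Unset Printing Implicit Defensive.

Import Order.TTheory GRing.Theory Num.Theory.
Import numFieldNormedType.Exports.

Local Open Scope classical_set_scope.
Local Open Scope ring_scope.

(* ['rV[R]_n] carries the sigma-algebra generated by the coordinates, that is
   the Borel sigma-algebra of R^n. *)
Section measurable_rV.
Variables (R : realType) (n : nat).

Let coord (i : 'I_n) (x : 'rV[R]_n) : measurableTypeR R := x ord0 i.

Let rV_set0 : g_sigma_preimage coord set0.
Proof. exact: sigma_algebra0. Qed.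

Let rV_setC A : g_sigma_preimage coord A -> g_sigma_preimage coord (~` A).
Proof. exact: sigma_algebraC. Qed.

Let rV_bigcup (F : (set 'rV[R]_n)^nat) :
  (forall i, g_sigma_preimage coord (F i)) ->
  g_sigma_preimage coord (\bigcup_i F i).
Proof. exact: sigma_algebra_bigcup. Qed.

HB.instance Definition _ := @isMeasurable.Build
  (measure_tuple_display (sigma_display (@ocitv R)))
  'rV[R]_n (g_sigma_preimage coord) rV_set0 rV_setC rV_bigcup.

End measurable_rV.

Section lebesgue_rV.
Variable R : realType.
Implicit Type n : nat.

Lemma measurable_coord n (i : 'I_n) :
  measurable_fun [set: 'rV[R]_n] (fun x => x ord0 i : measurableTypeR R).
Proof.
move=> _ Y mY; rewrite setTI; apply: sub_sigma_algebra => /=.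
rewrite -bigcup_seq/=; exists i => /=; first by rewrite mem_index_enum.
by exists Y => //; rewrite setTI.
Qed.

Lemma measurable_fun_rV d (T : measurableType d) n (f : T -> 'rV[R]_n) :
  (forall i, measurable_fun setT (fun t => f t ord0 i : measurableTypeR R)) ->
  measurable_fun setT f.
Proof.
move=> mf; apply: (measurability (\big[setU/set0]_(i < n)
  preimage_set_system setT
    (fun x : 'rV[R]_n => x ord0 i : measurableTypeR R) measurable)) => //.
move=> _ [C + <-]; rewrite -bigcup_seq => -[i _ [B mB <-]].
by have := mf i measurableT B mB; rewrite !setTI.
Qed.

Definition rV_cons n (xv : measurableTypeR R * 'rV[R]_n) : 'rV[R]_n.+1 :=
  \row_i oapp (xv.2 ord0) xv.1 (unlift ord0 i).

Let rV_uncons n (w : 'rV[R]_n.+1) : measurableTypeR R * 'rV[R]_n :=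
  (w ord0 ord0, \row_j w ord0 (lift ord0 j)).

Lemma measurable_rV_cons n : measurable_fun setT (@rV_cons n).
Proof.
apply: measurable_fun_rV => i.
under eq_fun do rewrite mxE.
case: (unliftP ord0 i) => [j _|_] /=; last exact: measurable_fst.
exact: (measurableT_comp (measurable_coord j) measurable_snd).
Qed.

Let measurable_rV_uncons n : measurable_fun setT (@rV_uncons n).
Proof.
apply: measurable_fun_pair; first exact: measurable_coord.
apply: measurable_fun_rV => i; under eq_fun do rewrite mxE.
exact: measurable_coord.
Qed.

Let rV_consK n : cancel (@rV_cons n) (@rV_uncons n).
Proof.
move=> [x v]; congr pair => /=; first by rewrite mxE unlift_none.
by apply/rowP => j; rewrite !mxE liftK.
Qed.

Definition lebesgue_rVS n (mu : {sigma_finite_measure set 'rV[R]_n -> \bar R})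
    : set 'rV[R]_n.+1 -> \bar R :=
  pushforward (@lebesgue_measure R \x mu)%E (@rV_cons n).

HB.instance Definition _ n (mu : {sigma_finite_measure set 'rV[R]_n -> \bar R}) :=
  Measure.copy (lebesgue_rVS mu)
    (measure_function_pushforward__canonical__measure_function_Measure
      (@lebesgue_measure R \x mu)%E (@measurable_rV_cons n)).

Let sigma_finite_lebesgue_rVS n
    (mu : {sigma_finite_measure set 'rV[R]_n -> \bar R}) :
  sigma_finite setT (lebesgue_rVS mu).
Proof.
have /sigma_finiteP[F [FT ndF Foo]] := sigma_finiteT (@lebesgue_measure R).
have /sigma_finiteP[G [GT ndG Goo]] := sigma_finiteT mu.
exists (fun k => @rV_uncons n @^-1` (F k `*` G k)).
  rewrite -preimage_bigcup (_ : \bigcup_k _ = setT) ?preimage_setT//.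
  rewrite -setXTT FT GT predeqE => -[x y]; split.
    by move=> [k _ []/= ? ?]; split; exists k.
  move=> [/= [k _ Fkx] [l _ Gly]]; exists (maxn k l) => //; split.
    by move: x Fkx; exact/subsetPset/ndF/leq_maxl.
  by move: y Gly; exact/subsetPset/ndG/leq_maxr.
move=> k; have [mFk Fkoo] := Foo k; have [mGk Gkoo] := Goo k; split.
  by rewrite -[X in measurable X]setTI; apply: measurable_rV_uncons => //;
    exact: measurableX.
rewrite /lebesgue_rVS /pushforward -comp_preimage (_ : _ \o _ = id) ?preimage_id.
  by rewrite product_measure1E// lte_mul_pinfty// ge0_fin_numE.
by apply/funext => x; exact: rV_consK.
Qed.

HB.instance Definition _ n (mu : {sigma_finite_measure set 'rV[R]_n -> \bar R}) :=
  Measure_isSigmaFinite.Build _ _ _ (lebesgue_rVS mu)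
    (@sigma_finite_lebesgue_rVS n mu).

Fixpoint lebesgue_rV n : {sigma_finite_measure set 'rV[R]_n -> \bar R} :=
  match n with
  | 0 => dirac (0 : 'rV[R]_0)
  | n'.+1 => lebesgue_rVS (lebesgue_rV n')
  end.

End lebesgue_rV.

Section definitions.
Variable R : realType.
Implicit Types (n : nat) (p : R).

Local Notation mu := (lebesgue_rV R _).

(* [f] is measurable on [D] for the completion of the Lebesgue measure: equal
   almost everywhere to a Borel function. The integral of a nonnegative
   function being the supremum of the integrals of the Borel simple functions
   below it, such an [f] has the same integral as its Borel versions. *)
Definition lebesgue_measurable_fun n d (T : sigmaRingType d) (D : set 'rV[R]_n)
    (f : 'rV[R]_n -> T) : Prop :=
  exists g : 'rV[R]_n -> T, measurable_fun D g /\ f = g %[ae mu in D].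

Definition enorm n (x : 'rV[R]_n) : R := Num.sqrt (\sum_(i < n) x ord0 i ^+ 2).

Definition eball n (r : R) : set 'rV[R]_n := [set x | enorm x < r].

Definition is_norm n (N : 'rV[R]_n -> R) : Prop :=
  [/\ forall x y, N (x + y) <= N x + N y,
      forall a x, N (a *: x) = `|a| * N x &
      forall x, N x = 0 -> x = 0].

(* Near each boundary point, after an orthogonal change of coordinates [Q], the
   set is the strict epigraph of a Lipschitz function of the first [d]
   coordinates. *)
Definition lipschitz_boundary d (Omega : set 'rV[R]_d.+1) : Prop :=
  forall x0, (closure Omega `\` Omega°) x0 ->
  exists (Q : 'M[R]_d.+1) (g : 'rV[R]_d -> R) (L r : R),
  [/\ Q *m Q^T = 1%:M,
      forall a b, `|g a - g b| <= L * enorm (a - b),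
      0 < r &
      forall x, enorm (x - x0) < r ->
        Omega x <-> g (col' ord_max (x *m Q)) < (x *m Q) ord0 ord_max].

Local Open Scope ereal_scope.

Definition is_kernel n (K : 'rV[R]_n -> \bar R) : Prop :=
  [/\ forall x, 0 <= K x,
      lebesgue_measurable_fun setT K &
      ~ {ae mu, forall x, K x = 0}].

Definition Lp_norm n p (Omega : set 'rV[R]_n) (u : 'rV[R]_n -> R) : \bar R :=
  (\int[mu]_(x in Omega) ((`|u x| `^ p)%R)%:E) `^ p^-1.

(* Only the values on [Omega] of a function ['rV[R]_n -> R] matter. *)
Definition Lp_space n p (Omega : set 'rV[R]_n) : set ('rV[R]_n -> R) :=
  [set u | lebesgue_measurable_fun Omega u /\ Lp_norm p Omega u < +oo].

Definition W_seminorm n (K : 'rV[R]_n -> \bar R) p (Omega : set 'rV[R]_n)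
    (u : 'rV[R]_n -> R) : \bar R :=
  (\int[mu]_(y in Omega) \int[mu]_(x in Omega)
     (((`|u x - u y| `^ p)%R)%:E * K (x - y)%R)) `^ p^-1.

Definition W_space n (K : 'rV[R]_n -> \bar R) p (Omega : set 'rV[R]_n) :
    set ('rV[R]_n -> R) :=
  [set u | Lp_space p Omega u /\ W_seminorm K p Omega u < +oo].

Definition average n (Omega : set 'rV[R]_n) (u : 'rV[R]_n -> R) : R :=
  ((fine (mu Omega))^-1 * \int[mu]_(x in Omega) u x)%R.

(* For [0 < n] and [0 <= m], exactly one radius is admissible; it is [0], and
   the ball is empty, when [m = 0]. *)
Definition ball_of_measure n (m : R) : set 'rV[R]_n :=
  eball (xget 0%R [set r | (0 <= r)%R /\ mu (@eball n r) = m%:E]).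

(* Meaningful for sets [A] of finite measure only. *)
Definition set_rearrangement n (A : set 'rV[R]_n) : set 'rV[R]_n :=
  ball_of_measure (fine (mu A)).

Definition rearrangement n (K : 'rV[R]_n -> \bar R) (x : 'rV[R]_n) : \bar R :=
  \int[lebesgue_measure]_(t in `]0%R, +oo[)
    (\1_(set_rearrangement [set y | (t%:E < K y)%E]) x)%:E.

Definition perimeter n (J : 'rV[R]_n -> \bar R) (E : set 'rV[R]_n) : \bar R :=
  2^-1%:E * \int[mu]_y \int[mu]_x
    ((`|\1_E x - \1_E y|%R)%:E * J (x - y)%R).

End definitions.

(* Main.v *)
Require Import Defs.
From mathcomp Require Import all_boot all_order all_algebra.
From mathcomp Require Import all_classical all_reals all_analysis measurable_realfun.
From mathcomp Require finmap.
From mathcomp Require Import lra ring.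

(* The kernel [K] is compared with [J z = sup {K y | N z <= N y}], which is Borel,
   even and nonincreasing in [N], and satisfies [c0 J <= K <= J].

   First inequality. [J] is bounded below near the origin and [Omega] is connected,
   so that, along chains of small balls, the integral of [|u x - u y|^p] over
   [Omega x Omega] is controlled by its part near the diagonal.

   Second inequality. By the coarea formula and the bound of the norm of [v >= 0] in
   [L^q] by twice the integral over [t > 0] of the measure of [{v > t}] to the power
   [1/q], it suffices that [m^(1/q) <= C (crossing Omega E J + m)] for [E] in [Omega]
   of measure [m]. A superlevel set of [J] lies between two balls with comparable
   radii, so the layer cake formula reduces this to ball kernels: for [E] in [Omega]
   of small measure [r^n], the pairs [x] in [E], [y] in [Omega \ E] at distance less
   than [s] have measure at least [c s^n r^(n-1) min r s], the order of magnitude of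
   the same quantity for a ball of measure [r^n] in the whole space. On a convex set
   this follows by cutting segments into pieces of length less than [s]; charts
   straightening the boundary transfer it to [Omega]. The low levels of [J] contribute
   at most [C m], by integrability of [K] away from the origin. *)

Set Implicit Arguments.
Unset Strict Implicit.
Unset Printing Implicit Defensive.

Import Order.TTheory GRing.Theory Num.Theory.
Import numFieldNormedType.Exports.

Local Open Scope classical_set_scope.
Local Open Scope ring_scope.

(** * Integrals of nonnegative functions *)

(** The term [m] in the isoperimetric inequality is what makes a local argument enough. Charts and
    cut segments only handle sets of small measure and balls of small radius; a set of measure above
    the threshold has [m^(1/q)] at most a constant times [m], and the levels of [J] whose superlevel
    sets are too wide also cost a constant times [m]. Integrated over the superlevel sets of
    [|u - u_Omega|], this term becomes the integral of [|u - u_Omega|], which the first inequality,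
    with exponent 1, bounds by the same seminorm.

    The rearrangement is only ever bounded from above, by a dilation [J (k *: z)]. The dilation is
    harmless, because [s^n r^(n-1) min r s] changes by a bounded factor when [r] and [s] do.

    Neither [K] nor [u] need be Borel. Tonelli is therefore applied only to [J] and to a Borel
    version of [u], and integrals involving [K] are compared by monotonicity alone. *)

Section nonmeasurable_integral.
Local Open Scope ereal_scope.
Context d (T : measurableType d) (R : realType).
Variable mu : {measure set T -> \bar R}.
Implicit Types (D : set T) (f g : T -> \bar R).

(* The integral of a nonnegative function is a supremum over the simple
   functions below it, so it is monotone even on nonmeasurable functions. *)
Lemma le_integral_ge0 D f g : (forall x, D x -> 0 <= f x) ->
  (forall x, D x -> f x <= g x) -> \int[mu]_(x in D) f x <= \int[mu]_(x in D) g x.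
Proof.
move=> f0 fg; have g0 x : D x -> 0 <= g x by move=> Dx; exact: le_trans (f0 _ Dx) (fg _ Dx).
rewrite [leLHS]integral_mkcond [leRHS]integral_mkcond !ge0_integralTE; last 2 first.
- by move=> x; rewrite patchE; case: ifPn => [/set_mem|_]//; exact: g0.
- by move=> x; rewrite patchE; case: ifPn => [/set_mem|_]//; exact: f0.
apply: ge_ereal_sup => _ [h /= hf <-]; apply: ereal_sup_ubound; exists h => //= x.
apply: le_trans (hf x) _; rewrite !patchE; case: ifPn => [/set_mem|_]//; exact: fg.
Qed.

Lemma le_integral_subset A B f : A `<=` B -> (forall x, B x -> 0 <= f x) ->
  \int[mu]_(x in A) f x <= \int[mu]_(x in B) f x.
Proof.
move=> AB f0; rewrite [leLHS]integral_mkcond [leRHS]integral_mkcond.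
apply: le_integral_ge0 => x _; rewrite !patchE; case: ifPn => [/set_mem Ax|_]//.
- exact/f0/AB.
- by rewrite mem_set//; exact: AB.
- by case: ifPn => [/set_mem|_]//; exact: f0.
Qed.

(** Only [g] is measurable. The integral of [f] is squeezed between that of [g] off a measurable
    null set [Z] and that of [g] plus [+oo] on [Z], and these two agree. *)
Lemma ge0_ae_eq_integral_left D f g : measurable D -> measurable_fun D g ->
  (forall x, D x -> 0 <= f x) -> (forall x, D x -> 0 <= g x) ->
  {ae mu, forall x, D x -> f x = g x} ->
  \int[mu]_(x in D) f x = \int[mu]_(x in D) g x.
Proof.
move=> mD mg f0 g0 [Z [mZ Z0 fgZ]].
have DZ x : D x -> ~ Z x -> f x = g x.
  by move=> Dx nZx; apply/not_notP => fg; apply/nZx/fgZ => /(_ Dx).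
have mDZ : measurable (D `\` Z) by exact: measurableD.
have intgDZ : \int[mu]_(x in D) g x = \int[mu]_(x in D `\` Z) g x.
  exact: ge0_negligible_integral.
apply/eqP; rewrite eq_le; apply/andP; split.
  pose i : T -> \bar R := cst +oo \_ Z.
  have i0 x : 0 <= i x by rewrite /i patchE; case: ifP => _; rewrite ?leey//.
  have mi : measurable_fun D i by apply: (iffLR (measurable_restrict _ mZ mD)); exact: measurable_cst.
  apply: (@le_trans _ _ (\int[mu]_(x in D) (g x + i x))).
    apply: le_integral_ge0 => // x Dx; rewrite /i patchE.
    case: ifPn => [/set_mem Zx|].
      by rewrite addey ?leey// gt_eqF// (lt_le_trans _ (g0 _ Dx)).
    by move=> /negP nZ; rewrite adde0 (DZ _ Dx)// => Zx; apply: nZ; exact: mem_set.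
  rewrite ge0_integralD// (ge0_negligible_integral mZ mD mi)//.
  have -> : \int[mu]_(x in D `\` Z) i x = 0.
    apply: integral0_eq => x [_ nZ].
    by rewrite /i patchE ifF//; apply/negP => /set_mem.
  by rewrite adde0.
rewrite intgDZ; apply: (@le_trans _ _ (\int[mu]_(x in D `\` Z) f x)); last first.
  by apply: le_integral_subset => // x [].
by apply: le_integral_ge0 => [x [Dx _]|x [Dx nZx]]; [exact: g0|rewrite (DZ _ Dx nZx)].
Qed.

End nonmeasurable_integral.

Section tonelli.
Local Open Scope ereal_scope.
Context d1 d2 (T1 : measurableType d1) (T2 : measurableType d2) (R : realType).
Variables (m1 : {sigma_finite_measure set T1 -> \bar R})
          (m2 : {sigma_finite_measure set T2 -> \bar R}).

(** The product measure is, for every set, the integral of the measures of its sections, so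
    monotonicity on arbitrary sets passes from [m2] to the product. *)
Lemma le_product_measure1 (A B : set (T1 * T2)) :
    (forall C D : set T2, C `<=` D -> m2 C <= m2 D) -> A `<=` B ->
  (m1 \x m2) A <= (m1 \x m2) B.
Proof.
move=> le2 AB; rewrite /product_measure1; apply: le_integral_ge0 => x _ /=.
  exact: measure_ge0.
by apply: le2 => y; rewrite /xsection/= !inE; exact: AB.
Qed.

End tonelli.

(** * Lebesgue measure on row vectors *)

Section rV_norm.
Variable R : realType.

(** On row vectors [|x|] is the maximum norm, so its balls are cubes. The hypothesis [0 < r] takes
    care of [n = 0]. *)
Lemma rV_norm_ltP n (x : 'rV[R]_n) (r : R) : 0 < r ->
  (`|x| < r) <-> (forall i, `|x ord0 i| < r).
Proof.
move=> r0; rewrite -[`|x|]/(mx_norm x) mx_normrE; split.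
  by move=> /bigmax_ltP[_ h] i; exact: (h (ord0, i)).
by move=> h; apply/bigmax_ltP; split => // -[i j] _ /=; rewrite (ord1 i).
Qed.

Lemma rV_coord_le n (x : 'rV[R]_n) i : `|x ord0 i| <= `|x|.
Proof.
rewrite leNgt; apply/negP => h.
have r0 : 0 < `|x ord0 i| := le_lt_trans (normr_ge0 _) h.
by have /(rV_norm_ltP _ r0)/(_ i) := h; rewrite ltxx.
Qed.

Lemma rV_norm_leP n (x : 'rV[R]_n) (r : R) : 0 <= r ->
  (`|x| <= r) <-> (forall i, `|x ord0 i| <= r).
Proof.
move=> r0; split=> [h i|h]; first exact: le_trans (rV_coord_le _ _) h.
apply/ler_addgt0Pr => e e0; apply/ltW/rV_norm_ltP; first by rewrite ltr_wpDl.
by move=> i; rewrite (le_lt_trans (h i))// ltrDl.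
Qed.

Lemma rV_cons0 n (xv : measurableTypeR R * 'rV[R]_n) : rV_cons xv ord0 ord0 = xv.1.
Proof. by rewrite mxE unlift_none. Qed.

Lemma rV_consS n (xv : measurableTypeR R * 'rV[R]_n) j :
  rV_cons xv ord0 (lift ord0 j) = xv.2 ord0 j.
Proof. by rewrite mxE liftK. Qed.

Lemma rV_consP n (w : 'rV[R]_n.+1) :
  w = rV_cons (w ord0 ord0 : measurableTypeR R, \row_j w ord0 (lift ord0 j)).
Proof.
apply/rowP => i; case: (unliftP ord0 i) => [j|] ->.
  by rewrite rV_consS mxE.
by rewrite rV_cons0.
Qed.

(** An open set is the union of the boxes with rational centre and radius that it contains; these
    are countably many, and each is a finite intersection of preimages of intervals under the
    coordinates. *)
Lemma measurable_open_rV n (U : set 'rV[R]_n) : open U -> measurable U.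
Proof.
move=> oU.
pose B (q : 'rV[rat]_n * rat) : set 'rV[R]_n :=
  [set x | forall i, `|x ord0 i - ratr (q.1 ord0 i)| < ratr q.2].
have mB q : measurable (B q).
  rewrite (_ : B q = \bigcap_(i in [set: 'I_n])
      [set x : 'rV[R]_n | `|x ord0 i - ratr (q.1 ord0 i)| < ratr q.2]); last first.
    by apply/seteqP; split => x /= h i; [move=> _; exact: h|exact: h].
  apply: fin_bigcap_measurable => // i _.
  rewrite (_ : mkset _ = setT `&` (fun x : 'rV[R]_n => x ord0 i : measurableTypeR R)
      @^-1` (ball (ratr (q.1 ord0 i) : R) (ratr q.2))); last first.
    by rewrite setTI; apply/seteqP; split => x; rewrite /ball/= distrC.
  by apply: measurable_coord => //; exact: measurable_ball.
rewrite (_ : U = \bigcup_q (if `[< B q `<=` U >] then B q else set0)); last first.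
  apply/seteqP; split=> [x Ux|x [q _]]; last by case: asboolP => // h /h.
  have /nbhs_ballP[/= e e0 xeU] : nbhs x U by exact: open_nbhs_nbhs.
  have [r /andP[r0 re]] : exists r : rat, 0 < (ratr r : R) < e / 2.
    have [|y [+ [r _ ry]]] := @dense_rat R `]0, (e / 2)%R[%classic _ (itv_open _ _).
      by exists (e / 4) => /=; rewrite in_itv/=; apply/andP; split; lra.
    by rewrite -ry /= in_itv/= => h; exists r.
  have /choice[q qP] : forall i : 'I_n, exists q : rat, `|x ord0 i - ratr q| < ratr r.
    move=> i; have [|y [+ [q _ qy]]] := @dense_rat R
        (ball (x ord0 i) (ratr r)) _ (ball_open _ _).
      by exists (x ord0 i); exact: ballxx.
    by rewrite -qy /ball/= => h; exists q.
  exists (\row_i q i, r) => //.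
  rewrite ifT; first by move=> i /=; rewrite mxE.
  apply/asboolP => y yB; apply: xeU; rewrite -ball_normE /=.
  apply/rV_norm_ltP => // i; rewrite !mxE.
  have := qP i; have := yB i; rewrite /= mxE => h1 h2.
  rewrite (_ : _ - _ = (x ord0 i - ratr (q i)) - (y ord0 i - ratr (q i))); last by ring.
  rewrite (le_lt_trans (ler_normB _ _))//; lra.
apply: countable_bigcupT_measurable => // q; case: asboolP => // _; exact: mB.
Qed.

Lemma measurable_continuous_rV n (f : 'rV[R]_n -> R) : continuous f ->
  measurable_fun setT (f : 'rV[R]_n -> measurableTypeR R).
Proof.
move=> cf; apply: (measurability _ (RGenOpens.measurableE R)) => //=.
move=> _ [_ [a [b ->]] <-]; rewrite setTI; apply: measurable_open_rV.
by apply: open_comp => // x _; exact: cf.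
Qed.

End rV_norm.

Section lebesgue_rV_basic.
Variable R : realType.
Local Notation mu := (lebesgue_rV R _).
Local Open Scope ereal_scope.

(** Valid for arbitrary sets, by induction on the dimension from a Dirac mass; this spares
    measurability side conditions in all later inclusions. *)
Lemma le_lebesgue_rV n (A B : set 'rV[R]_n) : A `<=` B -> mu A <= mu B.
Proof.
elim: n A B => [|n IH] A B AB /=.
  rewrite /dirac lee_fin !indicE ler_nat.
  by case: (boolP (0%R \in A)) => // /set_mem /AB /mem_set ->.
by apply: le_product_measure1 => // x; exact: AB.
Qed.

Lemma lebesgue_measure_translate (a : R) (A : set (measurableTypeR R)) : measurable A ->
  lebesgue_measure ((fun x => x + a)%R @^-1` A) = lebesgue_measure A.
Proof.
move=> mA.
have mph : measurable_fun setT (fun x : measurableTypeR R => (x + a)%R : measurableTypeR R).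
  exact: measurable_funD.
apply/esym; apply: (@lebesgue_measure_unique R
  (measure_function_pushforward__canonical__measure_function_Measure
      (@lebesgue_measure R) mph)) => //= _ [[x y]] _ <-.
rewrite /pushforward (_ : _ @^-1` _ = `](x - a)%R, (y - a)%R]%classic); last first.
  by apply/seteqP; split => t /=; rewrite !in_itv/= => /andP[? ?]; apply/andP; split; lra.
by rewrite !lebesgue_measure_itv/= !lte_fin ltrD2r -!EFinB; case: ifP => // _; congr EFin; ring.
Qed.

Lemma lebesgue_rV_translate n (a : 'rV[R]_n) (A : set 'rV[R]_n) : measurable A ->
  mu ((fun x => x + a)%R @^-1` A) = mu A.
Proof.
elim: n a A => [|n IH] a A mA.
  rewrite [a]thinmx0; congr (mu _); apply/seteqP.
  by split => x /=; rewrite addr0.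
rewrite /= /lebesgue_rVS /pushforward.
pose a' : 'rV[R]_n := \row_j a ord0 (lift ord0 j).
pose psi (xv : measurableTypeR R * 'rV[R]_n) : measurableTypeR R * 'rV[R]_n :=
  ((xv.1 + a ord0 ord0)%R, (xv.2 + a')%R).
have mtr : measurable_fun setT (fun v : 'rV[R]_n => v + a')%R.
  apply: measurable_fun_rV => i; under eq_fun do rewrite mxE.
  by apply: measurable_funD => //; exact: measurable_coord.
have mpsi : measurable_fun setT psi.
  apply: measurable_fun_pair; first by apply: measurable_funD => //; exact: measurable_fst.
  exact: (measurableT_comp mtr measurable_snd).
have mA' : measurable (@rV_cons R n @^-1` A).
  by rewrite -[X in measurable X]setTI; exact: measurable_rV_cons.
transitivity ((lebesgue_measure \x mu) (psi @^-1` (@rV_cons R n @^-1` A))).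
  congr ((lebesgue_measure \x mu) _); apply/seteqP.
  have E xv : (rV_cons xv + a = rV_cons (psi xv))%R.
    by apply/rowP => i; rewrite !mxE; case: unliftP => [j ->|->] /=; rewrite ?mxE.
  by split => xv /=; rewrite E.
apply/esym.
apply: (product_measure_unique (m' := measure_function_pushforward__canonical__measure_function_Measure
      (@lebesgue_measure R \x mu)%E mpsi)) => //.
move=> B C mB mC; rewrite /pushforward/=.
transitivity ((lebesgue_measure \x mu) (((fun x => x + a ord0 ord0)%R @^-1` B) `*` ((fun v => v + a')%R @^-1` C))).
  by [].
rewrite product_measure1E ?IH//.
- by congr (_ * _); exact: lebesgue_measure_translate.
- by rewrite -[X in measurable X]setTI; apply: measurable_funD.
- by rewrite -[X in measurable X]setTI; apply: mtr.
Qed.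

Lemma lebesgue_rV_cube n (r : R) : (0 < r)%R ->
  mu [set x : 'rV[R]_n | `|x| < r]%R = ((r *+ 2) ^+ n)%:E.
Proof.
move=> r0; elim: n => [|n IH].
  rewrite /= /dirac indicE mem_set ?expr0//=.
  by apply/rV_norm_ltP => // -[].
rewrite /= /lebesgue_rVS /pushforward (_ : _ @^-1` _ =
    (ball (0%R : R) r : set (measurableTypeR R)) `*` [set x : 'rV[R]_n | `|x| < r]%R); last first.
  apply/seteqP; split => -[x v]/=.
    move/(rV_norm_ltP _ r0) => h; split.
      by have := h ord0; rewrite rV_cons0 /ball/= sub0r normrN.
    by apply/rV_norm_ltP => // i; have := h (lift ord0 i); rewrite rV_consS.
  rewrite /ball /= sub0r normrN => -[xr /(rV_norm_ltP _ r0) h].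
  apply/rV_norm_ltP => // i; case: (unliftP ord0 i) => [j|] ->; rewrite ?rV_consS ?rV_cons0//=.
rewrite product_measure1E//; last first.
  apply: measurable_open_rV; rewrite (_ : mkset _ = ball (0%R : 'rV[R]_n) r); first exact: ball_open.
  by apply/seteqP; split => x; rewrite -ball_normE/= sub0r normrN.
  exact: measurable_ball.
by rewrite IH exprS EFinM; congr (_ * _); exact: (lebesgue_measure_ball 0%R (ltW r0)).
Qed.

End lebesgue_rV_basic.

Section measurable_rV_ops.
Context d (T : measurableType d) (R : realType) (n : nat).
Implicit Types f g : T -> 'rV[R]_n.

Lemma measurable_coord_comp f i : measurable_fun setT f ->
  measurable_fun setT (fun t => f t ord0 i : measurableTypeR R).
Proof. exact: (measurableT_comp (measurable_coord i)). Qed.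

Lemma measurable_addrV f g : measurable_fun setT f -> measurable_fun setT g ->
  measurable_fun setT (fun t => f t + g t).
Proof.
move=> mf mg; apply: measurable_fun_rV => i; under eq_fun do rewrite mxE.
by apply: measurable_funD; exact: measurable_coord_comp.
Qed.

Lemma measurable_scalerV (a : R) f : measurable_fun setT f ->
  measurable_fun setT (fun t => a *: f t).
Proof.
move=> mf; apply: measurable_fun_rV => i; under eq_fun do rewrite mxE.
by apply: measurable_funM => //; exact: measurable_coord_comp.
Qed.

Lemma measurable_subrV f g : measurable_fun setT f -> measurable_fun setT g ->
  measurable_fun setT (fun t => f t - g t).
Proof.
move=> mf mg; under eq_fun do rewrite -scaleN1r.
by apply: measurable_addrV => //; exact: measurable_scalerV.
Qed.

Lemma measurable_indic_comp d' (T' : measurableType d') (A : set T') (h : T -> T') :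
  measurable A -> measurable_fun setT h ->
  measurable_fun setT (fun t => (\1_A (h t))%:E : \bar R).
Proof.
by move=> mA mh; apply: measurableT_comp => //;
  exact: (measurableT_comp (measurable_indic _) mh).
Qed.

Lemma measurable_preimage d' (T' : measurableType d') (A : set T') (h : T -> T') :
  measurable A -> measurable_fun setT h -> measurable (h @^-1` A).
Proof. by move=> mA mh; rewrite -[X in measurable X]setTI; exact: mh. Qed.

End measurable_rV_ops.

Lemma integral_indicT d (T : measurableType d) (R : realType)
    (m : {measure set T -> \bar R}) (A : set T) : measurable A ->
  (\int[m]_x (\1_A x)%:E = m A)%E.
Proof. by move=> mA; rewrite integral_indic// setIT. Qed.

(** * Changes of variables with constant Jacobian *)

Section scaling_maps.
Variable R : realType.
Local Notation mu := (lebesgue_rV R _).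
Local Open Scope ereal_scope.

(** Since the measure of a preimage is taken, [k] is the inverse of the absolute value of the
    determinant when [T] is linear and invertible. *)
Definition scales n (T : 'rV[R]_n -> 'rV[R]_n) (k : R) :=
  [/\ (0 < k)%R, measurable_fun setT T &
      forall A, measurable A -> mu (T @^-1` A) = k%:E * mu A].

Lemma ge0_integral_scales n (T : 'rV[R]_n -> 'rV[R]_n) k (f : 'rV[R]_n -> \bar R) :
  scales T k -> measurable_fun setT f -> (forall x, 0 <= f x) ->
  \int[mu]_x f (T x) = k%:E * \int[mu]_x f x.
Proof.
move=> [k0 mT Tk] mf f0.
have := @ge0_integral_pushforward _ _ _ _ R T mT mu setT f measurableT mf (fun x _ => f0 x).
rewrite preimage_setT => <-.
rewrite -(ge0_integral_mscale mu measurableT (NngNum (ltW k0)) mf)//.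
by apply: eq_measure_integral => A mA _; exact: Tk.
Qed.

Lemma scales_translate n (a : 'rV[R]_n) : scales (fun x => x + a)%R 1.
Proof.
split=> //; last by move=> A mA; rewrite lebesgue_rV_translate// mul1e.
by apply: measurable_addrV => //; exact: measurable_cst.
Qed.

Lemma scales_comp n (T1 T2 : 'rV[R]_n -> 'rV[R]_n) k1 k2 :
  scales T1 k1 -> scales T2 k2 -> scales (T1 \o T2) (k1 * k2)%R.
Proof.
move=> [k10 m1 s1] [k20 m2 s2]; split; first exact: mulr_gt0.
  exact: measurableT_comp.
move=> A mA; rewrite comp_preimage s2 ?s1 ?muleA -?EFinM 1?mulrC//.
exact: measurable_preimage.
Qed.

Lemma ge0_integral_translate n (a : 'rV[R]_n) (f : 'rV[R]_n -> \bar R) :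
  measurable_fun setT f -> (forall x, 0 <= f x) ->
  \int[mu]_x f (x + a)%R = \int[mu]_x f x.
Proof.
by move=> mf f0; rewrite (ge0_integral_scales (scales_translate a)) ?mul1e.
Qed.

Lemma measurable_cube n (r : R) : (0 < r)%R -> measurable [set x : 'rV[R]_n | `|x| < r]%R.
Proof.
move=> r0; apply: measurable_open_rV.
rewrite (_ : mkset _ = ball (0%R : 'rV[R]_n) r); first exact: ball_open.
by apply/seteqP; split => x; rewrite -ball_normE/= sub0r normrN.
Qed.

Section additive_maps.
Variables (n : nat) (L L' : 'rV[R]_n -> 'rV[R]_n).
Hypotheses (mL : measurable_fun setT L).
Hypotheses (LD : forall x y, L (x + y)%R = (L x + L y)%R).
Hypotheses (LK : cancel L L') (L'K : cancel L' L).

(* Uniqueness of Haar measure, for [mu] and its pushforward by [L]. *)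
Lemma lebesgue_rV_additive_swap (A B : set 'rV[R]_n) : measurable A -> measurable B ->
  mu A * mu (L @^-1` B) = mu B * mu (L @^-1` ((fun x => - x)%R @^-1` A)).
Proof.
move=> mA mB.
have L0 : L 0%R = 0%R by apply: (addrI (L 0%R)); rewrite -LD !addr0.
have LN x : L (- x)%R = (- L x)%R by apply: (addrI (L x)); rewrite -LD !subrr.
have mL2 d (T : measurableType d) (f : T -> 'rV[R]_n) :
    measurable_fun setT f -> measurable_fun setT (fun t => L (f t)).
  exact: measurableT_comp.
have m1 : measurable_fun setT (fst : 'rV[R]_n * 'rV[R]_n -> _) by exact: measurable_fst.
have m2 : measurable_fun setT (snd : 'rV[R]_n * 'rV[R]_n -> _) by exact: measurable_snd.
have mN : measurable_fun setT (-%R : 'rV[R]_n -> 'rV[R]_n).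
  rewrite (_ : -%R = fun x => -1 *: x)%R; last by apply/funext => x; rewrite scaleN1r.
  exact: measurable_scalerV.
(* The double integral of [F] is computed twice with [y] innermost: directly, after translating [y]
   by [L' x], and after translating [x] by [L y], which turns [F] into [G]. *)
pose F (z : 'rV[R]_n * 'rV[R]_n) := (\1_A z.1)%:E * (\1_B (z.1 + L z.2)%R)%:E : \bar R.
pose G (z : 'rV[R]_n * 'rV[R]_n) := (\1_A (z.1 - L z.2)%R)%:E * (\1_B z.1)%:E : \bar R.
have mF : measurable_fun setT F.
  by apply: emeasurable_funM; apply: measurable_indic_comp => //; apply: measurable_addrV => //; exact: mL2.
have mG : measurable_fun setT G.
  by apply: emeasurable_funM; apply: measurable_indic_comp => //; apply: measurable_subrV => //; exact: mL2.
have F0 z : 0 <= F z by rewrite mule_ge0.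
have G0 z : 0 <= G z by rewrite mule_ge0.
have LB : measurable (L @^-1` B) by exact: measurable_preimage.
have mNA : measurable ((fun x => - x)%R @^-1` A) by exact: measurable_preimage.
have LA : measurable (L @^-1` ((fun x => - x)%R @^-1` A)) by exact: measurable_preimage.
transitivity (\int[mu]_x \int[mu]_y F (x, y)).
  under [RHS]eq_integral => x _.
    rewrite /F/= ge0_integralZl//; last by apply: measurable_indic_comp => //; apply: measurable_addrV => //; exact: mL2.
    rewrite (_ : \int[mu]_y _ = mu (L @^-1` B)); last first.
      rewrite -(integral_indicT mu LB) -[RHS](ge0_integral_translate (L' x))//.
        by apply: eq_integral => y _; rewrite -[RHS]/((\1_B (L (y + L' x)%R))%:E) LD L'K addrC.
      exact: measurable_indic_comp.
    over.
  by rewrite ge0_integralZr//= ?integral_indicT//; exact: measurable_indic_comp.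
rewrite fubini_tonelli//.
transitivity (\int[mu]_y \int[mu]_x G (x, y)).
  apply: eq_integral => y _; rewrite -[RHS](ge0_integral_translate (L y)).
  - by apply: eq_integral => x _; rewrite /F/G/= addrK.
  - by apply: (measurableT_comp mG); apply: measurable_fun_pair => //; exact: measurable_cst.
  - by move=> x; exact: G0.
rewrite -fubini_tonelli//.
under eq_integral => x _.
  rewrite /G/= ge0_integralZr//; last by apply: measurable_indic_comp => //; apply: measurable_subrV => //; exact: mL2.
  rewrite (_ : \int[mu]_y _ = mu (L @^-1` ((fun x => - x)%R @^-1` A))); last first.
    rewrite -(integral_indicT mu LA) -[RHS](ge0_integral_translate (- L' x)%R)//.
      apply: eq_integral => y _; rewrite -[RHS]/((\1_A (- L (y - L' x))%R)%:E).
      by rewrite LD LN L'K opprD opprK addrC.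
    exact: measurable_indic_comp.
  rewrite muleC; over.
by rewrite ge0_integralZr//= ?integral_indicT//; exact: measurable_indic_comp.
Qed.

(** With the symmetric cube [Q] for [A], [lebesgue_rV_additive_swap] says that the measure of the
    preimage of a set is proportional to that of the set. The bounds on [L] and [L'] enclose the
    preimage of [Q] between two cubes, so the factor is positive and finite. *)
Lemma scales_additive (l l' : R) : (0 < l)%R -> (0 < l')%R ->
  (forall x, `|L x| <= l * `|x|)%R -> (forall x, `|L' x| <= l' * `|x|)%R ->
  exists k, scales L k.
Proof.
move=> l0 l'0 Ll L'l.
pose Q := [set x : 'rV[R]_n | `|x| < 1]%R.
have mQ : measurable Q by exact: measurable_cube.
have NQ : (fun x => - x)%R @^-1` Q = Q by apply/seteqP; split => x; rewrite /Q/= normrN.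
have Q2 : mu Q = (2 ^+ n)%:E by rewrite lebesgue_rV_cube.
have LQl : (((l^-1 *+ 2) ^+ n)%:E <= mu (L @^-1` Q)).
  rewrite -lebesgue_rV_cube ?invr_gt0//; apply: le_lebesgue_rV => x /= xl.
  by rewrite /Q/= (le_lt_trans (Ll x))// mulrC -ltr_pdivlMr// div1r.
have LQu : mu (L @^-1` Q) <= ((l' *+ 2) ^+ n)%:E.
  rewrite -lebesgue_rV_cube//; apply: le_lebesgue_rV => x /= xl.
  by rewrite -(LK x) (le_lt_trans (L'l _))// -ltr_pdivlMl// mulVf ?gt_eqF.
have Lfin : mu (L @^-1` Q) \is a fin_num.
  by rewrite ge0_fin_numE// (le_lt_trans LQu)// ltry.
exists (fine (mu (L @^-1` Q)) / 2 ^+ n)%R; split => //.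
  rewrite divr_gt0 ?exprn_gt0// fine_gt0// (lt_le_trans _ LQl) ?lte_fin ?exprn_gt0 ?mulrn_wgt0 ?invr_gt0//.
  by rewrite (le_lt_trans LQu)// ltry.
move=> A mA; have := lebesgue_rV_additive_swap mQ mA; rewrite NQ Q2 => h.
have -> : mu (L @^-1` A) = (2 ^- n)%:E * ((2 ^+ n)%:E * mu (L @^-1` A)).
  by rewrite muleA -EFinM mulVf ?mul1e// gt_eqF// exprn_gt0.
by rewrite h EFinM fineK// [RHS]muleC [X in _ = _ * X]muleC; exact: muleCA.
Qed.

End additive_maps.

(** The factor is read off on the cube [|x| < a], whose preimage is the cube [|x| < 1]. *)
Lemma scales_dilation n (a : R) : (0 < a)%R ->
  scales (fun x : 'rV[R]_n => a *: x)%R (a ^- n)%R.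
Proof.
move=> a0.
have ai0 : (0 < a^-1)%R by rewrite invr_gt0.
have [||||||k [k0 mL sL]] := @scales_additive n (fun x => a *: x)%R (fun x => a^-1 *: x)%R _ _ _ _ a a^-1 a0 ai0.
- by apply: measurable_scalerV.
- by move=> x y; rewrite scalerDr.
- by move=> x; rewrite scalerA mulVf ?scale1r// gt_eqF.
- by move=> x; rewrite scalerA mulfV ?scale1r// gt_eqF.
- by move=> x; rewrite normrZ gtr0_norm.
- by move=> x; rewrite normrZ gtr0_norm.
suff <- : k = (a ^- n)%R by [].
have := sL _ (measurable_cube a0).
rewrite (_ : _ @^-1` _ = [set x : 'rV[R]_n | `|x| < 1]%R); last first.
  by apply/seteqP; split => x /=; rewrite normrZ (gtr0_norm a0) gtr_pMr.
rewrite !lebesgue_rV_cube// -EFinM => -[] h.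
apply: (@mulIf _ ((a *+ 2) ^+ n)%R); first by rewrite gt_eqF// exprn_gt0// mulrn_wgt0.
rewrite -h -[in RHS]mulr_natr exprMn mulrA mulVf ?mul1r//.
by rewrite gt_eqF// exprn_gt0.
Qed.

End scaling_maps.

(** * Crossings of convex sets *)

Ltac measurability_rV := repeat (first
  [ assumption | exact: measurable_cst | exact: measurable_fst
  | exact: measurable_snd | exact: measurable_id | apply: measurable_fun_pair
  | apply: measurable_subrV | apply: measurable_addrV | apply: measurable_scalerV ]).

Lemma measurable_compT d1 d2 d3 (T1 : measurableType d1) (T2 : measurableType d2)
    (T3 : measurableType d3) (f : T2 -> T3) (g : T1 -> T2) :
  measurable_fun setT f -> measurable_fun setT g ->
  measurable_fun setT (fun x => f (g x)).
Proof. exact: measurableT_comp. Qed.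

Lemma sume_const_ord (R : realType) k (c : \bar R) :
  (\sum_(i < k) c = k%:R%:E * c)%E.
Proof.
elim: k => [|k IH]; first by rewrite big_ord0 mul0e.
by rewrite big_ord_recr IH /= -natr1 EFinD ge0_muleDl ?mul1e ?lee_fin// ler0n.
Qed.

Section crossing.
Variable R : realType.
Implicit Types n : nat.
Local Notation mu := (lebesgue_rV R _).
Local Open Scope ereal_scope.

(** The ball is that of the maximum norm, whose volume is explicit; another norm would only change
    constants. *)
Definition ball_kernel n (s : R) (z : 'rV[R]_n) : \bar R :=
  (\1_[set x : 'rV[R]_n | `|x| < s]%R z)%:E.

Definition crossing_fun n (A E : set 'rV[R]_n) (J : 'rV[R]_n -> \bar R)
    (z : 'rV[R]_n * 'rV[R]_n) : \bar R :=
  (\1_E z.1)%:E * (\1_(A `\` E) z.2)%:E * J (z.1 - z.2)%R.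

(** For [A = setT] and [J] even this is the nonlocal perimeter of [E]: each unordered pair is
    counted once, which replaces the factor 1/2. *)
Definition crossing n (A E : set 'rV[R]_n) (J : 'rV[R]_n -> \bar R) : \bar R :=
  \int[mu]_x \int[mu]_y crossing_fun A E J (x, y).

Lemma measurable_norm_lt n (s : R) : measurable [set x : 'rV[R]_n | `|x| < s]%R.
Proof.
have [s0|s0] := ltP 0%R s; first exact: measurable_cube.
rewrite (_ : mkset _ = set0); first exact: measurable0.
by apply/seteqP; split => x //=; rewrite ltNge (le_trans s0).
Qed.

Lemma measurable_ball_kernel n (s : R) : measurable_fun setT (@ball_kernel n s).
Proof. by apply: measurable_indic_comp => //; exact: measurable_norm_lt. Qed.

Lemma ball_kernel_ge0 n (s : R) z : 0 <= @ball_kernel n s z.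
Proof. by rewrite lee_fin. Qed.

Lemma measurable_crossing_fun n (A E : set 'rV[R]_n) J : measurable A -> measurable E ->
  measurable_fun setT J -> measurable_fun setT (crossing_fun A E J).
Proof.
move=> mA mE mJ; apply: emeasurable_funM.
  by apply: emeasurable_funM; apply: measurable_indic_comp; measurability_rV; exact: measurableD.
by apply: (measurable_compT mJ); measurability_rV.
Qed.

Lemma crossing_fun_ge0 n (A E : set 'rV[R]_n) J z : (forall x, 0 <= J x) ->
  0 <= crossing_fun A E J z.
Proof. by move=> J0; rewrite !mule_ge0// lee_fin. Qed.

Lemma le_crossing n (A B E : set 'rV[R]_n) J1 J2 : A `<=` B -> (forall x, 0 <= J1 x) ->
  (forall x, J1 x <= J2 x) -> crossing A E J1 <= crossing B E J2.
Proof.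
move=> AB J0 J12; apply: le_integral_ge0 => x _.
  by apply: integral_ge0 => y _; exact: crossing_fun_ge0.
apply: le_integral_ge0 => y _; first exact: crossing_fun_ge0.
apply: lee_pmul; rewrite ?mule_ge0 ?lee_fin//.
apply: ler_pM; rewrite // !indicE ler_nat.
by case: (boolP (_ \in A `\` E)) => // /set_mem [/AB By nEy]; rewrite mem_set.
Qed.

(** The pair [(x, y)] is sent to the points of parameters [a] and [a + b] on its line. In the
    variables [x] and [z = y - x], this translates [x] by [a z] and dilates [z] by [b], whence the
    Jacobian [b ^ n]. *)
Lemma ge0_integral_shear n (F : 'rV[R]_n * 'rV[R]_n -> \bar R) (a b : R) :
  (0 < b)%R -> measurable_fun setT F -> (forall z, 0 <= F z) ->
  \int[mu]_x \int[mu]_y F (x + a *: (y - x), x + (a + b) *: (y - x))%R =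
  (b ^- n)%:E * \int[mu]_x \int[mu]_y F (x, y).
Proof.
move=> b0 mF F0.
have mFc d (T : measurableType d) (f g : T -> 'rV[R]_n) :
    measurable_fun setT f -> measurable_fun setT g ->
    measurable_fun setT (fun t => F (f t, g t)).
  by move=> mf mg; apply: (measurable_compT mF); exact: measurable_fun_pair.
transitivity (\int[mu]_x \int[mu]_y F (x + a *: y, x + (a + b) *: y)%R).
  apply: eq_integral => x _; rewrite -(ge0_integral_translate x)//.
    by apply: eq_integral => y _; rewrite addrK.
  by apply: mFc; measurability_rV.
rewrite (fubini_tonelli (fun z : 'rV[R]_n * 'rV[R]_n => F (z.1 + a *: z.2, z.1 + (a + b) *: z.2)%R))//; last first.
  by apply: mFc; measurability_rV.
transitivity (\int[mu]_z \int[mu]_x F (x, x + b *: z)%R).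
  apply: eq_integral => z _; rewrite -[RHS](ge0_integral_translate (a *: z)%R)//.
    by apply: eq_integral => x _; rewrite scalerDl addrA.
  by apply: mFc; measurability_rV.
have mG : measurable_fun setT (fun z : 'rV[R]_n * 'rV[R]_n => F (z.1, z.1 + z.2)%R) by apply: mFc; measurability_rV.
etransitivity.
  apply: (ge0_integral_scales (f := fun w => \int[mu]_x F (x, x + w)%R) (scales_dilation n b0)).
  - have := @measurable_fun_fubini_tonelli_G _ _ _ _ R mu _ mG; exact.
  - by move=> x; exact: integral_ge0.
congr (_ * _).
rewrite -(fubini_tonelli (fun z : 'rV[R]_n * 'rV[R]_n => F (z.1, z.1 + z.2)%R))//.
apply: eq_integral => x _; rewrite -[RHS](ge0_integral_translate x)//.
  by apply: eq_integral => y _; rewrite addrC.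
by apply: mFc; measurability_rV.
Qed.

Definition convex_rV n (Q : set 'rV[R]_n) :=
  forall x y (t : R), Q x -> Q y -> (0 <= t <= 1)%R -> Q (x + t *: (y - x))%R.

Lemma first_exit (P : nat -> Prop) k : P 0%N -> ~ P k ->
  exists i : 'I_k, P i /\ ~ P i.+1.
Proof.
elim: k => // k IH P0 nP; have [Pk|nPk] := pselect (P k); first by exists ord_max.
by have [i Pi] := IH P0 nPk; exists (widen_ord (leqnSn k) i).
Qed.

(* A segment from [E] to its complement in [Q], cut in [k] equal pieces, has a
   piece going from [E] to its complement. *)
Lemma crossing_chain n (Q E : set 'rV[R]_n) (k : nat) (s : R) : convex_rV Q ->
  measurable Q -> measurable E -> E `<=` Q -> (0 < k)%N ->
  crossing Q E (ball_kernel (k%:R * s)) <=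
  (k%:R ^+ n.+1)%:E * crossing Q E (ball_kernel s).
Proof.
move=> cQ mQ mE EQ k0.
have kR : (0 < k%:R :> R)%R by rewrite ltr0n.
set F := crossing_fun Q E (ball_kernel s).
have mF : measurable_fun setT F.
  by apply: measurable_crossing_fun => //; exact: measurable_ball_kernel.
have F0 z : 0 <= F z by apply: crossing_fun_ge0; exact: ball_kernel_ge0.
(* [h i x y] detects that the piece of the segment between parameters [i / k] and [(i + 1) / k] goes
   from [E] to its complement. Each of the [k] double integrals equals [k ^ n] times the crossing,
   by [ge0_integral_shear] with [b = 1 / k]. *)
pose h (i : 'I_k) x y := F (x + (i%:R / k%:R) *: (y - x), x + (i%:R / k%:R + k%:R^-1) *: (y - x))%R.
have mh i : measurable_fun setT (fun z : 'rV[R]_n * 'rV[R]_n => h i z.1 z.2).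
  by apply: (measurable_compT mF); measurability_rV.
have mhx i x : measurable_fun setT (h i x).
  by apply: (measurable_compT mF); measurability_rV.
apply: (@le_trans _ _ (\int[mu]_x \int[mu]_y \sum_(i < k) h i x y)).
  apply: le_integral_ge0 => x _.
    by apply: integral_ge0 => y _; apply: crossing_fun_ge0; exact: ball_kernel_ge0.
  apply: le_integral_ge0 => y _; first by apply: crossing_fun_ge0; exact: ball_kernel_ge0.
  have h0 i : 0 <= h i x y by exact: F0.
  have [[Ex [[Qy nEy] xys]]|] := pselect (E x /\ (Q `\` E) y /\ `|x - y| < k%:R * s)%R; last first.
    move=> nh; rewrite /crossing_fun/ball_kernel/=.
    suff -> : (\1_E x)%:E * (\1_(Q `\` E) y)%:E * (\1_[set x | (`|x| < k%:R * s)%R] (x - y)%R)%:E = 0 :> \bar R.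
      by apply: sume_ge0.
    rewrite !indicE; case: (boolP (x \in E)) => [/set_mem Ex|_]; last by rewrite !mul0e.
    case: (boolP (y \in _)) => [/set_mem Ey|_]; last by rewrite mule0 mul0e.
    case: (boolP ((x - y)%R \in _)) => [/set_mem xy|_]; last by rewrite mule0.
    by exfalso; apply: nh.
  pose xi (i : nat) := (x + (i%:R / k%:R) *: (y - x))%R.
  have [i [Ei nEi]] : exists i : 'I_k, E (xi i) /\ ~ E (xi i.+1).
    apply: (first_exit (P := fun j => E (xi j))); first by rewrite /xi mul0r scale0r addr0.
    by rewrite /xi divff ?gt_eqF// scale1r addrC subrK.
  rewrite (bigD1 i)//= (_ : h i x y = 1); last first.
    rewrite /h /F/crossing_fun/= (_ : (i%:R / k%:R + k%:R^-1)%R = (i.+1%:R / k%:R)%R); last first.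
      by rewrite -natr1 mulrDl div1r.
    rewrite !indicE (mem_set Ei) (mem_set (_ : (Q `\` E) _)) ?mul1e; last first.
      split=> //; apply: cQ => //; first exact: EQ.
      by rewrite divr_ge0//= ler_pdivrMr// mul1r ler_nat.
    rewrite /ball_kernel indicE mem_set//=.
    rewrite [X in (`|X| < _)%R](_ : _ = k%:R^-1 *: (x - y))%R; last first.
      rewrite opprD addrACA subrr add0r -scalerBl -natr1 mulrDl div1r opprD addrA subrr add0r.
      by rewrite scaleNr -scalerN opprB.
    by rewrite normrZ gtr0_norm ?invr_gt0// ltr_pdivrMl.
  apply: (@le_trans _ _ 1); last by rewrite leeDl// sume_ge0.
  rewrite /crossing_fun/ball_kernel/= -!EFinM lee_fin !indicE -!natrM.
  by rewrite -[leRHS]/(1%:R) ler_nat; do 3 case: (_ \in _).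
rewrite (eq_integral (fun x => \sum_(i < k) \int[mu]_y h i x y)); last first.
  by move=> x _; apply: ge0_integral_sum => // i y _; exact: F0.
rewrite ge0_integral_sum//; last 2 first.
- by move=> i; have := @measurable_fun_fubini_tonelli_F _ _ _ _ R mu _ (mh i); apply=> z; exact: F0.
- by move=> i x _; apply: integral_ge0 => y _; exact: F0.
rewrite (eq_bigr (fun=> (k%:R ^+ n)%:E * crossing Q E (ball_kernel s))); last first.
  move=> i _; rewrite (ge0_integral_shear (i%:R / k%:R) _ mF F0) ?invr_gt0//.
  by rewrite exprVn invrK.
by rewrite sume_const_ord exprS EFinM -muleA.
Qed.

(** The homothety of centre [x] and ratio [s / D] maps [Q] into itself by convexity, and into the
    cube of radius [s] around [x] because points of [Q] are at distance less than [D]. *)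
Lemma convex_density n (Q : set 'rV[R]_n) (D s : R) x : convex_rV Q -> measurable Q ->
  (0 < s <= D)%R -> (forall x y, Q x -> Q y -> `|x - y| < D)%R -> Q x ->
  ((s / D) ^+ n)%:E * mu Q <= mu (Q `&` [set y | `|x - y| < s]%R).
Proof.
move=> cQ mQ /andP[s0 sD] QD Qx.
have D0 : (0 < D)%R by exact: lt_le_trans sD.
pose e := (s / D)%R; have e0 : (0 < e)%R by rewrite divr_gt0.
have ei0 : (0 < e^-1)%R by rewrite invr_gt0.
have e1 : (e <= 1)%R by rewrite ler_pdivrMr// mul1r.
have [_ _ sS] := scales_comp (scales_translate (x - e^-1 *: x)%R) (scales_dilation n ei0).
have := sS _ mQ; rewrite mul1r exprVn invrK => <-; apply: le_lebesgue_rV => w /= Qw.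
set q := (e^-1 *: w + _)%R in Qw.
have wE : w = (x + e *: (q - x))%R.
  rewrite /q addrCA [(x + _ - x)%R]addrC addKr -scalerBr scalerA mulfV ?gt_eqF// scale1r.
  by rewrite addrC subrK.
have -> : (x - w)%R = (e *: (x - q))%R by rewrite wE opprD addrA subrr add0r -scalerN opprB.
split; first by rewrite wE; apply: cQ => //; rewrite ltW.
by rewrite normrZ gtr0_norm// -ltr_pdivlMl// /e invf_div divfK ?gt_eqF// QD.
Qed.

End crossing.

Section crossing_convex.
Variable R : realType.
Local Notation mu := (lebesgue_rV R _).
Local Open Scope ereal_scope.

Lemma measurable_ball_rV n (x : 'rV[R]_n) (s : R) : measurable [set y | `|x - y| < s]%R.
Proof.
have mf : measurable_fun setT (fun y : 'rV[R]_n => x - y)%R by measurability_rV.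
by have := mf measurableT _ (@measurable_norm_lt R n s); rewrite setTI.
Qed.

Lemma integral_crossing_ball n (A E : set 'rV[R]_n) s x : measurable A -> measurable E ->
  \int[mu]_y crossing_fun A E (ball_kernel s) (x, y) =
  (\1_E x)%:E * mu ((A `\` E) `&` [set y | `|x - y| < s]%R).
Proof.
move=> mA mE.
have mB : measurable ((A `\` E) `&` [set y | `|x - y| < s]%R).
  by apply: measurableI; [exact: measurableD|exact: measurable_ball_rV].
rewrite -(integral_indicT mu mB) -ge0_integralZl//; last first.
  by apply: measurable_indic_comp => //; measurability_rV.
apply: eq_integral => y _; rewrite indicI EFinM muleA; congr (_ * _).
Qed.

(** By [convex_density] every [x] in [E] has at least measure [(s / D)^n q] of [Q] within distance
    [s], of which at most [m] belongs to [E]. *)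
Lemma crossing_ball_density n (Q E : set 'rV[R]_n) (q m D s : R) :
  convex_rV Q -> measurable Q -> measurable E -> E `<=` Q ->
  mu Q = q%:E -> mu E = m%:E -> (0 < s <= D)%R ->
  (forall x y, Q x -> Q y -> `|x - y| < D)%R ->
  (m <= (s / D) ^+ n * q)%R ->
  (m * ((s / D) ^+ n * q - m))%:E <= crossing Q E (ball_kernel s).
Proof.
move=> cQ mQ mE EQ Qq Em sD QD mle.
have -> : (m * ((s / D) ^+ n * q - m))%:E = \int[mu]_x ((\1_E x)%:E * ((s / D) ^+ n * q - m)%:E).
  rewrite ge0_integralZr//; last 2 first.
  - by apply: measurable_indic_comp => //; measurability_rV.
  - by rewrite lee_fin subr_ge0.
  by rewrite (integral_indicT mu mE) [X in X * _]Em.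
apply: le_integral_ge0 => x _; first by rewrite mule_ge0 ?lee_fin ?subr_ge0.
rewrite integral_crossing_ball// indicE; case: (boolP (x \in E)) => [/set_mem Ex|]; last first.
  by rewrite !mul0e.
rewrite !mul1e EFinB leeBlDr// -Em.
have := convex_density cQ mQ sD QD (EQ _ Ex); rewrite Qq -EFinM => h.
apply: (le_trans h); apply: le_trans (measureU2 _ _ _) => //.
- apply: le_lebesgue_rV => y [Qy xy].
  by have [Ey|nEy] := pselect (E y); [right|left; split].
- by apply: measurableI; [exact: measurableD|exact: measurable_ball_rV].
Qed.

(** At radius [a r], the density bound around a point of [E] is twice the measure of [E]. For
    [s >= a r] density alone is enough; for smaller [s], the estimate at radius [a r] is brought
    down to [s] by cutting segments into about [a r / s] pieces. *)
Lemma crossing_ball_convex d (Q : set 'rV[R]_d.+1) (q D : R) :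
  convex_rV Q -> measurable Q -> mu Q = q%:E -> (0 < q)%R -> (0 < D)%R ->
  (forall x y, Q x -> Q y -> `|x - y| < D)%R ->
  exists2 c : R, (0 < c)%R & forall E (r s : R), measurable E -> E `<=` Q ->
    mu E = (r ^+ d.+1)%:E -> (0 < r)%R -> (2 * r ^+ d.+1 <= q)%R -> (0 < s <= D)%R ->
    (c * (s ^+ d.+1 * (r ^+ d * Num.min r s)))%:E <= crossing Q E (ball_kernel s).
Proof.
move=> cQ mQ Qq q0 D0 QD.
have [a a0 an] : exists2 a : R, (0 < a)%R & ((a / D) ^+ d.+1 * q = 2)%R.
  exists (D * (2 / q) `^ (d.+1%:R^-1))%R; first by rewrite mulr_gt0// powR_gt0// divr_gt0.
  rewrite mulrAC divff ?gt_eqF// mul1r -powR_mulrn ?powR_ge0// -powRrM mulVf ?pnatr_eq0//.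
  by rewrite powRr1 ?divr_ge0 ?ltW// divfK ?gt_eqF.
(* [c1] keeps half of the density term when [a r <= s]. [c2] pays the factor [k ^ (d + 2)] of
   [crossing_chain] for [k] pieces with [k s <= 2 a r]. *)
pose c1 := (q / (2 * D ^+ d.+1))%R; pose c2 := ((2 * a) ^- d.+2)%R.
have c10 : (0 < c1)%R by rewrite divr_gt0// mulr_gt0// exprn_gt0.
have c20 : (0 < c2)%R by rewrite invr_gt0 exprn_gt0// mulr_gt0.
exists (Num.min c1 c2); first by rewrite lt_min c10.
move=> E r s mE EQ Er r0 rq /andP[s0 sD].
have sn0 : (0 < s ^+ d.+1)%R by rewrite exprn_gt0.
have rd0 : (0 < r ^+ d)%R by rewrite exprn_gt0.
have cge0 : (0 <= Num.min c1 c2)%R by rewrite le_min !ltW.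
have cle1 : (Num.min c1 c2 <= c1)%R by rewrite ge_min lexx.
have cle2 : (Num.min c1 c2 <= c2)%R by rewrite ge_min lexx orbT.
have Mge0 : (0 <= s ^+ d.+1 * (r ^+ d * Num.min r s))%R.
  by rewrite !mulr_ge0// ?le_min ltW ?ltW.
have rE : ((a * r / D) ^+ d.+1 * q = 2 * r ^+ d.+1)%R.
  by rewrite mulrAC exprMn mulrAC an.
have [ars|sar] := leP (a * r)%R s.
  have h : (2 * r ^+ d.+1 <= (s / D) ^+ d.+1 * q)%R.
    rewrite -rE ler_pM2r// lerXn2r ?nnegrE ?divr_ge0 ?mulr_ge0 ?(ltW a0) ?(ltW r0) ?(ltW s0) ?(ltW D0)//.
    by rewrite ler_pM2r ?invr_gt0.
  apply: le_trans (crossing_ball_density cQ mQ mE EQ Qq Er _ QD _); rewrite ?s0//; last first.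
    by apply: le_trans h; have := exprn_gt0 d.+1 r0; lra.
  rewrite lee_fin; apply: (@le_trans _ _ (c1 * (s ^+ d.+1 * r ^+ d.+1)))%R.
    apply: ler_pM => //.
    by rewrite ler_pM2l// exprSr ler_pM2l// ge_min lexx.
  rewrite (_ : c1 * _ = r ^+ d.+1 * ((s / D) ^+ d.+1 * q / 2))%R; last first.
    by rewrite /c1 expr_div_n; field; rewrite expf_neq0 ?gt_eqF//.
  rewrite ler_pM2l ?exprn_gt0//; lra.
have ars0 : (0 <= a * r / s)%R by rewrite divr_ge0 ?mulr_ge0// ltW.
have [k k0 [ks ks2]] : exists2 k, (0 < k)%N & (a * r <= k%:R * s /\ k%:R * s <= 2 * (a * r))%R.
  have /andP[t1 t2] := truncn_itv ars0.
  exists (Num.truncn (a * r / s)).+1 => //; split; first by rewrite -ler_pdivrMr// ltW.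
  rewrite -natr1 mulrDl mul1r mulrDl mul1r; apply: lerD (ltW sar).
  by rewrite -ler_pdivlMr.
have kR0 : (0 < k%:R :> R)%R by rewrite ltr0n.
(* That [E] has at most half the measure of [Q] says exactly that [a r <= D]. *)
have arD : (0 < a * r <= D)%R.
  have := rq; rewrite -rE -[X in (_ <= X)%R -> _]mul1r (ler_pM2r q0) expr_le1//.
    by rewrite ler_pdivrMr// mul1r mulr_gt0.
  by rewrite ltW// !divr_gt0 ?mulr_gt0.
have h1 := crossing_ball_density cQ mQ mE EQ Qq Er arD QD.
have {}h1 : (r ^+ d.+1 * r ^+ d.+1)%:E <= crossing Q E (ball_kernel (a * r)%R).
  rewrite rE in h1; apply: le_trans (h1 _).
    by rewrite lee_fin ler_pM2l ?exprn_gt0//; lra.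
  by have := exprn_gt0 d.+1 r0; lra.
have h2 : crossing Q E (ball_kernel (a * r)%R) <= crossing Q E (ball_kernel (k%:R * s)%R).
  apply: le_crossing => // [x|x]; first exact: ball_kernel_ge0.
  rewrite lee_fin !indicE ler_nat; case: (boolP (_ \in _)) => // /set_mem/= xar.
  by rewrite mem_set//= (lt_le_trans xar).
have h3 := crossing_chain s cQ mQ mE EQ k0.
have kn0 : (0 < k%:R ^+ d.+2 :> R)%R by rewrite exprn_gt0.
have h5 : ((k%:R ^+ d.+2)^-1 * (r ^+ d.+1 * r ^+ d.+1))%:E <= crossing Q E (ball_kernel s).
  by rewrite EFinM lee_pdivrMl//; exact: le_trans (le_trans h1 h2) h3.
apply: le_trans h5; rewrite lee_fin.
apply: (@le_trans _ _ (c2 * (s ^+ d.+1 * (r ^+ d * s))))%R.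
  apply: ler_pM => //.
  by rewrite !ler_pM2l// ge_min lexx orbT.
rewrite ler_pdivlMl// /c2.
rewrite (_ : k%:R ^+ d.+2 * _ = (k%:R * s / (2 * a)) ^+ d.+2 * r ^+ d)%R; last first.
  by rewrite expr_div_n (exprMn _ _ s) (exprSr s d.+1); ring.
rewrite -exprD (_ : d.+1 + d.+1 = d.+2 + d)%N; last by rewrite addSn addnS !addSn.
rewrite exprD ler_pM2r//; apply: lerXn2r; rewrite ?nnegrE ?(ltW r0)//.
  by rewrite ltW// divr_gt0 ?mulr_gt0.
by rewrite ler_pdivrMr ?mulr_gt0//; lra.
Qed.

End crossing_convex.

(** * Crossings of Lipschitz domains *)

(* The import is local because [finmap] redefines [inE]. *)
Section compact_union.
Import finmap.

Lemma compact_union_ind (T : ptopologicalType) (P : set T -> Prop) (A : set T) :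
  P set0 -> (forall U V, P U -> P V -> P (U `|` V)) -> compact A ->
  (forall x, A x -> exists2 V, open V & V x /\ P V) -> exists2 W, A `<=` W & P W.
Proof.
move=> P0 PU cA h.
have /choice[f fP] : forall x, exists V, A x -> [/\ open V, V x & P V].
  move=> x; have [Ax|nAx] := pselect (A x); last by exists set0.
  by have [V oV [Vx cV]] := h x Ax; exists V.
move: cA; rewrite compact_cover => /(_ _ A f) [x Ax|x Ax|D DA AD].
- by have [] := fP x Ax.
- by exists x => //; have [] := fP x Ax.
exists (\bigcup_(i in [set` D]) f i) => //.
rewrite bigcup_fset big_seq; apply: (big_ind P) => // x xD.
by have /set_mem/fP[] := DA x xD.
Qed.

End compact_union.

Section crossing_bound.
Variables (R : realType) (d : nat) (Omega : set 'rV[R]_d.+1).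
Hypothesis mO : measurable Omega.
Local Notation mu := (lebesgue_rV R _).
Local Open Scope ereal_scope.

(** A local form of the estimate: [r] measures the part of [E] in [V], while crossings are counted
    in all of [Omega]. Asking for [r ^ (d + 1)] to be a lower bound, not the exact measure, makes
    the property stable under unions. *)
Definition crossing_bound (V : set 'rV[R]_d.+1) := measurable V /\
  exists c e s0 : R, [/\ (0 < c)%R, (0 < e)%R, (0 < s0)%R &
    forall E (r s : R), measurable E -> E `<=` Omega -> mu E <= e%:E ->
      (0 < r)%R -> (r ^+ d.+1)%:E <= mu (E `&` V) -> (0 < s <= s0)%R ->
      (c * (s ^+ d.+1 * (r ^+ d * Num.min r s)))%:E <=
      crossing Omega E (ball_kernel s)].

Lemma crossing_bound_set0 : crossing_bound set0.
Proof.
split; first exact: measurable0.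
exists 1%R, 1%R, 1%R; split => // E r s _ _ _ r0.
by rewrite setI0 measure0 lee_fin leNgt exprn_gt0.
Qed.

(** A single piece suffices: as [2 (r/2)^(d+1) <= r^(d+1)], one of [V1] and [V2] contains a part of
    [E] of measure at least [(r/2)^(d+1)]. Halving [r] costs at most a factor [2^(d+1)]. *)
Lemma crossing_boundU V1 V2 : crossing_bound V1 -> crossing_bound V2 ->
  crossing_bound (V1 `|` V2).
Proof.
move=> [mV1 [c1 [e1 [s1 [c10 e10 s10 h1]]]]] [mV2 [c2 [e2 [s2 [c20 e20 s20 h2]]]]].
split; first exact: measurableU.
pose c := Num.min c1 c2.
have c0 : (0 < c)%R by rewrite lt_min c10.
exists (c * 2 ^- d.+1)%R, (Num.min e1 e2), (Num.min s1 s2).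
split; rewrite ?lt_min ?e10 ?s10//.
  by rewrite mulr_gt0// invr_gt0 exprn_gt0.
move=> E r s mE EO Ee r0 rE; rewrite le_min => /and3P[s0 ss1 ss2].
have r20 : (0 < r / 2)%R by rewrite divr_gt0.
have key : ((r / 2) ^+ d.+1)%:E <= mu (E `&` V1) \/ ((r / 2) ^+ d.+1)%:E <= mu (E `&` V2).
  have [|n1] := leP ((r / 2) ^+ d.+1)%:E (mu (E `&` V1)); first by left.
  have [|n2] := leP ((r / 2) ^+ d.+1)%:E (mu (E `&` V2)); first by right.
  exfalso; move: rE; apply/negP; rewrite -ltNge.
  apply: (@le_lt_trans _ _ (mu (E `&` V1) + mu (E `&` V2))).
    by rewrite setIUr; apply: measureU2; exact: measurableI.
  apply: (lt_le_trans (lteD n1 n2)); rewrite -EFinD lee_fin.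
  have dbl (x : R) : (x + x = 2 * x)%R by ring.
  rewrite dbl -ler_pdivlMl// expr_div_n mulrC ler_pM2r ?exprn_gt0//.
  by rewrite lef_pV2 ?posrE ?exprn_gt0// exprS ler_peMr// exprn_ege1// ler1n.
have step c' : (c <= c')%R -> (c * 2 ^- d.+1 * (s ^+ d.+1 * (r ^+ d * Num.min r s)) <=
    c' * (s ^+ d.+1 * ((r / 2) ^+ d * Num.min (r / 2) s)))%R.
  move=> cc'.
  have M : (Num.min r s / 2 <= Num.min (r / 2) s)%R.
    rewrite le_min ler_pM2r ?invr_gt0// ge_min lexx/= ler_pdivrMr//.
    rewrite (@le_trans _ _ s)//; first by rewrite ge_min lexx orbT.
    by rewrite ler_peMr ?ltW// ltr1n.
  have M0 : (0 <= Num.min r s)%R by rewrite le_min !ltW.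
  rewrite -mulrA; apply: ler_pM => //; first exact: ltW.
    by rewrite !mulr_ge0// ?invr_ge0 ?exprn_ge0// ltW.
  rewrite mulrCA ler_pM2l ?exprn_gt0//.
  rewrite [leLHS](_ : _ = (r / 2) ^+ d * (Num.min r s / 2))%R; last first.
    by rewrite expr_div_n exprS invfM; ring.
  by rewrite ler_pM2l// exprn_gt0.
case: key => k.
  apply: le_trans (h1 E (r / 2)%R s mE EO _ r20 k _); last by rewrite s0.
    by rewrite lee_fin step// ge_min lexx.
  by apply: le_trans Ee _; rewrite lee_fin ge_min lexx.
apply: le_trans (h2 E (r / 2)%R s mE EO _ r20 k _); last by rewrite s0.
  by rewrite lee_fin step// ge_min lexx orbT.
by apply: le_trans Ee _; rewrite lee_fin ge_min lexx orbT.
Qed.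

Lemma root_exists (n : nat) (m : R) : (0 < m)%R -> exists2 r : R, (0 < r)%R & (r ^+ n.+1 = m)%R.
Proof.
move=> m0; exists (m `^ n.+1%:R^-1)%R; first by rewrite powR_gt0.
by rewrite -powR_mulrn ?powR_ge0// -powRrM mulVf ?pnatr_eq0// powRr1// ltW.
Qed.

(** [T] is a Lipschitz chart with constant Jacobian, from a convex set [Q] into [Omega], that covers
    the part of [Omega] in [V]. It sends crossings of the pullback of [E] at scale [s / l] to
    crossings of [E] at scale [s], and scales double integrals by [k ^ 2]. *)
Lemma crossing_bound_piece (T T' : 'rV[R]_d.+1 -> 'rV[R]_d.+1) (k l D : R)
    (Q V : set 'rV[R]_d.+1) : scales T k -> cancel T T' -> (0 < l)%R ->
  (forall x y, `|T x - T y| <= l * `|x - y|)%R ->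
  convex_rV Q -> measurable Q -> mu Q < +oo -> (0 < D)%R ->
  (forall x y, Q x -> Q y -> `|x - y| < D)%R ->
  (forall x, Q x -> Omega (T x)) -> measurable V ->
  (forall x, V x -> Omega x -> Q (T' x)) -> crossing_bound V.
Proof.
move=> sT TK l0 Tl cQ mQ Qfin D0 QD QO mV VQ; split => //.
have [k0 mT kT] := sT.
have EQk (E : set 'rV[R]_d.+1) : measurable E -> E `<=` Omega -> k%:E * mu (E `&` V) <= mu (T @^-1` E `&` Q).
  move=> mE EO; rewrite -kT; last exact: measurableI.
  by apply: le_lebesgue_rV => x /= [ETx VTx]; split => //; rewrite -(TK x); apply: VQ => //; exact: EO.
have mEQ E : measurable E -> measurable (T @^-1` E `&` Q).
  by move=> mE; apply: measurableI => //; exact: measurable_preimage.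
have QE : mu Q = (fine (mu Q))%:E by rewrite fineK// ge0_fin_numE.
move: QE; set q := fine (mu Q) => QE.
have q0 : (0 <= q)%R by rewrite fine_ge0.
(* If [Q] is null, so is the part of [E] in [V], and no [r > 0] is admissible. *)
move: q0; rewrite le_eqVlt => /predU1P[q0|q0].
  exists 1%R, 1%R, 1%R; split => // E r s mE EO _ r0 rE _; exfalso.
  have : k%:E * mu (E `&` V) <= 0.
    apply: (le_trans (EQk _ mE EO)); have := @subIsetr _ (T @^-1` E) Q; by move=> /le_lebesgue_rV; rewrite QE -q0.
  by rewrite leNgt mule_gt0 ?lte_fin// (lt_le_trans _ rE)// lte_fin exprn_gt0.
have [c c0 cP] := crossing_ball_convex cQ mQ QE q0 D0 QD.
have [a a0 ak] := root_exists d k0.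
have [b b0 [ba bl]] : exists2 b : R, (0 < b)%R & (b <= a)%R /\ (b <= l^-1)%R.
  exists (Num.min a l^-1)%R; first by rewrite lt_min a0 invr_gt0.
  by split; rewrite ge_min lexx ?orbT.
(* The pullback has measure [rho ^ (d + 1)] with [rho >= a r], and [b] is such that
   [b * min r s <= min rho (s / l)]. The bound [q / (2 k)] on the measure of [E] keeps the pullback
   below half of [Q]. *)
pose C := (k ^- 2 * (c * (l ^- d.+1 * (a ^+ d * b))))%R.
have C0 : (0 < C)%R by rewrite !mulr_gt0// ?invr_gt0 ?exprn_gt0.
exists C, (q / (2 * k))%R, (l * D)%R; split => //; rewrite ?divr_gt0 ?mulr_gt0//.
move=> E r s mE EO Ee r0 rE /andP[s0 ss0].
set E' := T @^-1` E `&` Q.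
have mE' : measurable E' by exact: mEQ.
have E'fin : mu E' \is a fin_num.
  by rewrite ge0_fin_numE//; apply: le_lt_trans Qfin; apply: le_lebesgue_rV; exact: subIsetr.
have E'ge : (k * r ^+ d.+1)%:E <= mu E'.
  by apply: le_trans (EQk _ mE EO); rewrite EFinM lee_pmul2l.
have E'le : mu E' <= (q / 2)%:E.
  apply: (@le_trans _ _ (k%:E * mu E)).
    by rewrite -kT//; apply: le_lebesgue_rV; exact: subIsetl.
  rewrite -lee_pdivlMl//; apply: le_trans Ee _; rewrite -EFinM lee_fin.
  by rewrite invfM mulrA mulrC.
have m0 : (0 < fine (mu E'))%R.
  by rewrite -lte_fin fineK//; apply: lt_le_trans E'ge; rewrite lte_fin mulr_gt0// exprn_gt0.
have [rho rho0 rhoE] := root_exists d m0.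
have E'E : mu E' = (rho ^+ d.+1)%:E by rewrite rhoE fineK.
have arrho : (a * r <= rho)%R.
  rewrite -(@ler_pXn2r _ d.+1)// ?nnegrE ?mulr_ge0 ?(ltW a0) ?(ltW r0) ?(ltW rho0)//.
  by rewrite exprMn ak -lee_fin -E'E.
have sl0 : (0 < s / l)%R by rewrite divr_gt0.
have := cP E' rho (s / l)%R mE' (@subIsetr _ _ _) E'E rho0.
have -> : (2 * rho ^+ d.+1 <= q)%R.
  by move: E'le; rewrite E'E lee_fin ler_pdivlMr// mulrC.
have -> : (0 < s / l <= D)%R by rewrite sl0 ler_pdivrMr// mulrC.
move=> /(_ isT isT) h.
set F := crossing_fun Omega E (ball_kernel s).
have mF : measurable_fun setT F.
  by apply: measurable_crossing_fun => //; exact: measurable_ball_kernel.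
have F0 z : 0 <= F z by apply: crossing_fun_ge0; exact: ball_kernel_ge0.
have E1 : \int[mu]_x \int[mu]_y F (T x, T y) = (k ^+ 2)%:E * crossing Omega E (ball_kernel s).
  pose G x := \int[mu]_y F (x, y).
  have G0 x : 0 <= G x by exact: integral_ge0.
  have mG : measurable_fun setT G.
    by have := @measurable_fun_fubini_tonelli_F _ _ _ _ R mu _ mF; apply=> z; exact: F0.
  transitivity (\int[mu]_x (k%:E * G (T x))).
    apply: eq_integral => x _; rewrite (ge0_integral_scales (f := fun y => F (T x, y)) sT)//.
    by apply: (measurable_compT mF); measurability_rV.
  have k0' : 0 <= k%:E by rewrite lee_fin ltW.
  have mGT : measurable_fun setT (fun x => G (T x)) by exact: (measurable_compT mG mT).
  rewrite (ge0_integralZl mu measurableT mGT (fun x _ => G0 (T x)) k0').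
  by rewrite (ge0_integral_scales sT mG G0) muleA -EFinM expr2.
have k20 : (0 < k ^+ 2)%R by rewrite exprn_gt0.
have h2 : crossing Q E' (ball_kernel (s / l)%R) <= (k ^+ 2)%:E * crossing Omega E (ball_kernel s).
  rewrite -E1; apply: le_integral_ge0 => x _.
    by apply: integral_ge0 => y _; apply: crossing_fun_ge0; exact: ball_kernel_ge0.
  apply: le_integral_ge0 => y _; first by apply: crossing_fun_ge0; exact: ball_kernel_ge0.
  rewrite /F /crossing_fun /ball_kernel -!EFinM lee_fin/= !indicE -!natrM ler_nat.
  case: (boolP (x \in E')) => [/set_mem [/= Ex Qx]|_]; last by rewrite !mul0n.
  case: (boolP (y \in _)) => [/set_mem [Qy nEy]|_]; last by rewrite muln0 mul0n.
  case: (boolP ((x - y)%R \in _)) => [/set_mem/= xy|_]; last by rewrite muln0.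
  rewrite !mem_set//.
    by rewrite /= (le_lt_trans (Tl _ _))// mulrC -ltr_pdivlMr.
  by split; [exact: QO|move=> Ey; exact: nEy].
have h3 : (k ^- 2)%:E * (c * ((s / l) ^+ d.+1 * (rho ^+ d * Num.min rho (s / l))))%:E <=
    crossing Omega E (ball_kernel s).
  by rewrite lee_pdivrMl//; exact: le_trans h h2.
apply: le_trans h3; rewrite -EFinM lee_fin /C -mulrA ler_pM2l ?invr_gt0// -mulrA ler_pM2l//.
rewrite expr_div_n.
rewrite [leLHS](_ : _ = s ^+ d.+1 / l ^+ d.+1 * (((a * r) ^+ d) * (b * Num.min r s)))%R; last first.
  by rewrite exprMn; ring.
rewrite ler_pM2l ?divr_gt0 ?exprn_gt0//.
have M0 : (0 < Num.min r s)%R by rewrite lt_min r0.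
apply: ler_pM; rewrite ?exprn_ge0 ?mulr_ge0 ?(ltW a0) ?(ltW r0) ?(ltW b0) ?(ltW M0)//.
  by rewrite lerXn2r// nnegrE ?mulr_ge0 ?(ltW a0) ?(ltW r0) ?(ltW rho0).
rewrite le_min; apply/andP; split.
  by apply: le_trans arrho; apply: ler_pM; rewrite ?(ltW b0) ?(ltW M0)// ge_min lexx.
by rewrite mulrC; apply: ler_pM; rewrite ?(ltW b0) ?(ltW M0)// ge_min lexx orbT.
Qed.

End crossing_bound.

(** * Charts made of shears and rotations *)

Section lipschitz_maps.
Variable R : realType.

Lemma lipschitz_continuous (V W : normedModType R) (f : V -> W) (l : R) :
  (forall x y, `|f x - f y| <= l * `|x - y|) -> continuous f.
Proof.
move=> fl x; apply/cvgrPdist_lt => e e0.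
have l0 : 0 < `|l| + 1 by rewrite ltr_wpDl.
near=> y; apply: (le_lt_trans (fl x y)).
apply: (@le_lt_trans _ _ ((`|l| + 1) * `|x - y|)).
  by rewrite ler_wpM2r// ler_wpDr// ler_norm.
rewrite -ltr_pdivlMl// mulrC; near: y.
by apply: cvgr_dist_lt => //; rewrite divr_gt0.
Unshelve. all: by end_near. Qed.

Lemma enorm_ge0 n (x : 'rV[R]_n) : 0 <= enorm x.
Proof. exact: sqrtr_ge0. Qed.

Lemma enorm_le_norm n (x : 'rV[R]_n) : enorm x <= n%:R * `|x|.
Proof.
rewrite -[leRHS]ger0_norm ?mulr_ge0// -sqrtr_sqr ler_sqrt ?sqr_ge0//.
apply: (@le_trans _ _ (\sum_(i < n) `|x| ^+ 2)).
  apply: ler_sum => i _; rewrite -[x ord0 i ^+ 2]real_normK ?num_real//.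
  by rewrite lerXn2r ?nnegrE// rV_coord_le.
rewrite sumr_const card_ord -[leLHS]mulr_natl exprMn ler_wpM2r ?sqr_ge0//.
by rewrite -natrX ler_nat; case: n {x} => // n; rewrite expnS leq_pmulr// expn1.
Qed.

Lemma norm_le_enorm n (x : 'rV[R]_n) : `|x| <= enorm x.
Proof.
apply/rV_norm_leP; first exact: enorm_ge0.
move=> i; rewrite -sqrtr_sqr ler_sqrt ?sumr_ge0// => [|j _]; last exact: sqr_ge0.
by rewrite (bigD1 i)//= lerDl sumr_ge0// => j _; rewrite sqr_ge0.
Qed.

Lemma measurable_lipschitz n m (f : 'rV[R]_n -> 'rV[R]_m) l :
  (forall x y, `|f x - f y| <= l * `|x - y|) -> measurable_fun setT f.
Proof.
move=> fl; apply: measurable_fun_rV => i; apply: measurable_continuous_rV.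
apply: (@lipschitz_continuous _ _ _ l) => x y; apply: le_trans (fl x y).
by have := rV_coord_le (f x - f y) i; rewrite !mxE.
Qed.

Lemma norm_mulmx_le n m (A : 'M[R]_(n, m)) :
  exists2 l : R, 0 < l & forall x : 'rV[R]_n, `|x *m A| <= l * `|x|.
Proof.
have A0 : 0 <= \sum_i \sum_j `|A i j| by rewrite !sumr_ge0// => i _; rewrite sumr_ge0.
exists (\sum_i \sum_j `|A i j| + 1); first by rewrite ltr_wpDl.
move=> x; apply/rV_norm_leP; first by rewrite mulr_ge0// addr_ge0.
move=> j; rewrite mxE; apply: (le_trans (ler_norm_sum _ _ _)).
rewrite mulrDl mul1r ler_wpDr// mulr_suml; apply: ler_sum => i _.
rewrite normrM mulrC ler_pM// ?rV_coord_le//.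
by rewrite (bigD1 j)//= lerDl sumr_ge0.
Qed.

Definition rV_tail n (w : 'rV[R]_n.+1) : 'rV[R]_n := \row_j w ord0 (lift ord0 j).

Lemma rV_tail_cons n (xv : measurableTypeR R * 'rV[R]_n) : rV_tail (rV_cons xv) = xv.2.
Proof. by apply/rowP => j; rewrite mxE rV_consS. Qed.

Lemma norm_rV_tail n (w : 'rV[R]_n.+1) : `|rV_tail w| <= `|w|.
Proof. by apply/rV_norm_leP => // i; rewrite mxE rV_coord_le. Qed.

Lemma norm_rV_cons n (t : R) (v : 'rV[R]_n) (b : R) : `|t| <= b -> `|v| <= b ->
  `|rV_cons (t : measurableTypeR R, v)| <= b.
Proof.
move=> tb vb; apply/rV_norm_leP => [|i]; first exact: le_trans tb.
case: (unliftP ord0 i) => [j|] ->; rewrite ?rV_consS ?rV_cons0//=.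
exact: le_trans (rV_coord_le _ _) vb.
Qed.

Definition shear n (g : 'rV[R]_n -> R) (w : 'rV[R]_n.+1) : 'rV[R]_n.+1 :=
  rV_cons (w ord0 ord0 + g (rV_tail w) : measurableTypeR R, rV_tail w).

Lemma shearK n (g h : 'rV[R]_n -> R) : (forall v, g v + h v = 0) ->
  cancel (shear g) (shear h).
Proof.
move=> gh w; rewrite {1}/shear rV_tail_cons rV_cons0/= -addrA gh addr0.
by rewrite [RHS]rV_consP.
Qed.

Lemma shear_lipschitz n (g : 'rV[R]_n -> R) (l : R) : 
  (forall a b, `|g a - g b| <= l * enorm (a - b)) ->
  forall x y, `|shear g x - shear g y| <= (1 + `|l| * n%:R) * `|x - y|.
Proof.
move=> gl x y.
have -> : shear g x - shear g y =
    rV_cons ((x - y) ord0 ord0 + (g (rV_tail x) - g (rV_tail y)) : measurableTypeR R, rV_tail (x - y)).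
  apply/rowP => i; rewrite !mxE; case: unliftP => [j _|_] /=; rewrite ?mxE//.
  by rewrite opprD addrACA.
apply: norm_rV_cons; last first.
  by rewrite (le_trans (norm_rV_tail _))// ler_peMl// lerDl mulr_ge0.
rewrite mulrDl mul1r (le_trans (ler_normD _ _))// lerD ?rV_coord_le//.
apply: (le_trans (gl _ _)).
apply: (@le_trans _ _ (`|l| * enorm (rV_tail x - rV_tail y))).
  by rewrite ler_wpM2r ?enorm_ge0// ler_norm.
rewrite -mulrA ler_wpM2l// (le_trans (enorm_le_norm _))// ler_wpM2l//.
rewrite (_ : _ - _ = rV_tail (x - y)) ?norm_rV_tail//.
by apply/rowP => i; rewrite !mxE.
Qed.

End lipschitz_maps.

Section shear_scales.
Variable R : realType.
Local Notation mu := (lebesgue_rV R _).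
Local Open Scope ereal_scope.

Lemma ge0_integral_rV_cons n (f : 'rV[R]_n.+1 -> \bar R) :
  measurable_fun setT f -> (forall x, 0 <= f x) ->
  \int[mu]_x f x = \int[@lebesgue_measure R]_t \int[mu]_v f (rV_cons (t, v)).
Proof.
move=> mf f0.
have mfc : measurable_fun setT (fun z => f (@rV_cons R n z)).
  exact: (measurable_compT mf (@measurable_rV_cons R n)).
rewrite -(fubini_tonelli1 _ mfc)//.
have := @ge0_integral_pushforward _ _ _ _ R (@rV_cons R n) (@measurable_rV_cons R n)
  (@lebesgue_measure R \x mu) setT f measurableT mf (fun x _ => f0 x).
by rewrite preimage_setT => <-.
Qed.

Lemma ge0_integral_lebesgue_translate (a : R) (f : measurableTypeR R -> \bar R) :
  measurable_fun setT f -> (forall x, 0 <= f x) ->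
  \int[lebesgue_measure]_x f (x + a)%R = \int[lebesgue_measure]_x f x.
Proof.
move=> mf f0.
have mph : measurable_fun setT (fun x : measurableTypeR R => (x + a)%R : measurableTypeR R).
  exact: measurable_funD.
have := @ge0_integral_pushforward _ _ _ _ R _ mph lebesgue_measure setT f measurableT mf (fun x _ => f0 x).
rewrite preimage_setT => <-.
by apply: eq_measure_integral => A mA _; exact: lebesgue_measure_translate.
Qed.

(** For a fixed tail, the shear translates the first coordinate; Tonelli, with that coordinate
    innermost, reduces the claim to translation invariance on the line. *)
Lemma scales_shear n (g : 'rV[R]_n -> R) :
  measurable_fun setT (g : 'rV[R]_n -> measurableTypeR R) -> scales (shear g) 1.
Proof.
move=> mg.
have mS : measurable_fun setT (shear g).
  have mtail : measurable_fun setT (@rV_tail R n).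
    by apply: measurable_fun_rV => i; under eq_fun do rewrite mxE; exact: measurable_coord.
  apply: (measurable_compT (@measurable_rV_cons R n)); apply: measurable_fun_pair => //.
  by apply: measurable_funD; [exact: measurable_coord|exact: (measurable_compT mg mtail)].
split => // A mA; rewrite mul1e.
have mSA : measurable (shear g @^-1` A) by exact: measurable_preimage.
pose f (x : 'rV[R]_n.+1) : \bar R := (\1_A x)%:E.
have mf : measurable_fun setT f by apply: measurable_indic_comp => //; measurability_rV.
have f0 x : 0 <= f x by rewrite lee_fin.
rewrite -(integral_indicT mu mA) -(integral_indicT mu mSA).
transitivity (\int[mu]_x f (shear g x)) => //.
rewrite ge0_integral_rV_cons//; last exact: (measurable_compT mf mS).
rewrite -[RHS]/(\int[mu]_x f x) (ge0_integral_rV_cons mf f0).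
have mc : measurable_fun setT (fun z => f (@rV_cons R n z)).
  exact: (measurable_compT mf (@measurable_rV_cons R n)).
have mSc : measurable_fun setT (fun z => f (shear g (@rV_cons R n z))).
  exact: (measurable_compT mf (measurable_compT mS (@measurable_rV_cons R n))).
rewrite [LHS](fubini_tonelli (m1 := @lebesgue_measure R) (m2 := mu) _ mSc (fun z => f0 _)).
rewrite [RHS](fubini_tonelli (m1 := @lebesgue_measure R) (m2 := mu) _ mc (fun z => f0 _)).
apply: eq_integral => v _.
rewrite -[RHS](ge0_integral_lebesgue_translate (g v))//.
  by apply: eq_integral => t _; rewrite /shear rV_tail_cons rV_cons0.
by apply: (measurable_compT mc); apply: measurable_fun_pair.
Qed.

End shear_scales.

Section rotation.
Variables (R : realType) (d : nat) (Q : 'M[R]_d.+1).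
Hypothesis QQT : Q *m Q^T = 1%:M.
Implicit Types x w : 'rV[R]_d.+1.

(** The graph variable, last in [lipschitz_boundary], is moved to the front, the coordinate that the
    recursive definition of the measure singles out. *)
Definition graph_coords x : 'rV[R]_d.+1 :=
  rV_cons ((x *m Q) ord0 ord_max : measurableTypeR R, col' ord_max (x *m Q)).

Definition graph_coords_inv w : 'rV[R]_d.+1 :=
  (\row_i oapp (rV_tail w ord0) (w ord0 ord0) (unlift ord_max i)) *m Q^T.

Lemma graph_coordsK : cancel graph_coords graph_coords_inv.
Proof.
move=> x; rewrite /graph_coords_inv rV_tail_cons rV_cons0/=.
rewrite (_ : \row__ _ = x *m Q); first by rewrite -mulmxA QQT mulmx1.
by apply/rowP => i; rewrite mxE; case: unliftP => [j ->|->] //=; rewrite mxE.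
Qed.

Lemma graph_coords_invK : cancel graph_coords_inv graph_coords.
Proof.
move=> w; rewrite /graph_coords /graph_coords_inv -mulmxA (mulmx1C QQT) mulmx1.
rewrite [RHS]rV_consP; congr (rV_cons (_, _)); first by rewrite mxE unlift_none.
by apply/rowP => j; rewrite !mxE liftK/= mxE.
Qed.

Lemma graph_coordsD x y : graph_coords (x + y) = graph_coords x + graph_coords y.
Proof.
apply/rowP => i; rewrite !mxE; case: unliftP => [j _|_] /=; rewrite ?mxE -big_split/=;
  by apply: eq_bigr => k _; rewrite mxE mulrDl.
Qed.

Lemma graph_coordsB x y : graph_coords (x - y) = graph_coords x - graph_coords y.
Proof. by apply: (addIr (graph_coords y)); rewrite -graph_coordsD !subrK. Qed.

Lemma graph_coords_invB x y :
  graph_coords_inv (x - y) = graph_coords_inv x - graph_coords_inv y.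
Proof.
by apply: (can_inj graph_coordsK); rewrite graph_coordsB !graph_coords_invK.
Qed.

Lemma norm_graph_coords : exists2 l : R, 0 < l & forall x, `|graph_coords x| <= l * `|x|.
Proof.
have [l l0 Ql] := norm_mulmx_le Q; exists l => // x.
apply: le_trans (Ql x); apply: norm_rV_cons; first exact: rV_coord_le.
by apply/rV_norm_leP => // i; rewrite mxE rV_coord_le.
Qed.

Lemma norm_graph_coords_inv : exists2 l : R, 0 < l & forall x, `|graph_coords_inv x| <= l * `|x|.
Proof.
have [l l0 Ql] := norm_mulmx_le Q^T; exists l => // x.
apply: le_trans (Ql _) _; rewrite ler_pM2l//; apply/rV_norm_leP => // i.
rewrite mxE; case: unliftP => [j _|_] /=; last exact: rV_coord_le.
by rewrite mxE rV_coord_le.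
Qed.

Lemma scales_graph_coords : exists k, scales graph_coords_inv k.
Proof.
have [l l0 h] := norm_graph_coords; have [l' l'0 h'] := norm_graph_coords_inv.
have m : measurable_fun setT graph_coords_inv.
  apply: (measurable_lipschitz (l := l')) => x y; rewrite -graph_coords_invB; exact: h'.
apply: (scales_additive m _ graph_coords_invK graph_coordsK l'0 l0 h' h) => x y.
by apply: (can_inj graph_coordsK); rewrite graph_coordsD !graph_coords_invK.
Qed.

End rotation.

Section lipschitz_domain.
Variables (R : realType) (d : nat).
Local Notation mu := (lebesgue_rV R _).

Lemma bounded_closure n (A : set 'rV[R]_n) : bounded_set A -> bounded_set (closure A).
Proof.
move=> [M [Mr AM]]; exists (M + 2); split; first by rewrite realD// real1.
move=> y My x xA; have [z [Az xz]] := xA _ (nbhsx_ballx x 1 ltr01).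
have zM : `|z| <= M + 1 by apply: AM => //; rewrite ltrDl.
have -> : x = z + (x - z) by rewrite addrC subrK.
move: xz; rewrite -ball_normE/= => xz.
rewrite (le_trans (ler_normD _ _))//; lra.
Qed.

Lemma lebesgue_rV_bounded n (A : set 'rV[R]_n) : bounded_set A -> (mu A < +oo)%E.
Proof.
move=> [M [Mr AM]].
pose b := `|M| + 2.
have b0 : 0 < b by rewrite ltr_wpDl.
apply: (@le_lt_trans _ _ (mu [set x : 'rV[R]_n | `|x| < b])).
  apply: le_lebesgue_rV => x Ax /=; apply: (@le_lt_trans _ _ (`|M| + 1)).
    by apply: AM => //; rewrite ltr_pwDr// ler_norm.
  by rewrite ltrD2l ltr1n.
by rewrite lebesgue_rV_cube// ltry.
Qed.

Lemma bounded_ball n (x : 'rV[R]_n) e : bounded_set (ball x e).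
Proof.
exists (`|x| + e); split; first by rewrite num_real.
move=> y xy z; rewrite -ball_normE/= => xz.
have -> : z = x - (x - z) by rewrite opprB addrC subrK.
rewrite (le_trans (ler_normB _ _))//; lra.
Qed.

Lemma convex_ball_rV n (x : 'rV[R]_n) e : convex_rV (ball x e).
Proof.
move=> y z t; rewrite -ball_normE/= => xy xz /andP[t0 t1].
have -> : x - (y + t *: (z - y)) = (1 - t) *: (x - y) + t *: (x - z).
  by apply/rowP => i; rewrite !mxE; ring.
rewrite (le_lt_trans (ler_normD _ _))// !normrZ (ger0_norm t0) ger0_norm ?subr_ge0//.
set m := Num.max `|x - y| `|x - z|.
apply: (@le_lt_trans _ _ ((1 - t) * m + t * m)); last by rewrite -mulrDl subrK mul1r gt_max xy.
by rewrite lerD// ler_wpM2l ?subr_ge0// le_max lexx ?orbT.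
Qed.

Lemma ball_diameter n (x : 'rV[R]_n) e y z : ball x e y -> ball x e z -> `|y - z| < 2 * e.
Proof.
rewrite -ball_normE/= => xy xz; have -> : y - z = (x - z) - (x - y).
  by apply/rowP => i; rewrite !mxE; ring.
rewrite (le_lt_trans (ler_normB _ _))//; lra.
Qed.

Variable Omega : set 'rV[R]_d.+1.
Hypothesis oO : open Omega.

Let mO : measurable Omega := measurable_open_rV oO.

Lemma crossing_bound_interior x : Omega x ->
  exists2 V, open V & V x /\ crossing_bound Omega V.
Proof.
move=> Ox; have /nbhs_ballP[/= e e0 xeO] : nbhs x Omega by exact: open_nbhs_nbhs.
exists (ball x e); [exact: ball_open|split; first exact: ballxx].
have mB : measurable (ball x e) by apply: measurable_open_rV; exact: ball_open.
have sid : scales (@id 'rV[R]_d.+1) 1 by split => // A mA; rewrite mul1e.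
apply: (@crossing_bound_piece R d Omega mO id id 1 1 (2 * e) (ball x e) (ball x e) sid) => //.
- by move=> y z; rewrite mul1r.
- exact: convex_ball_rV.
- by apply: lebesgue_rV_bounded; exact: bounded_ball.
- by rewrite mulr_gt0.
- by move=> y z; exact: ball_diameter.
Qed.

(** Rotating the coordinates and subtracting [g] from the graph variable turns [Omega] near [x0]
    into the points of a cube with positive first coordinate, a convex set to which
    [crossing_bound_piece] applies. *)
Lemma crossing_bound_boundary x0 : lipschitz_boundary Omega -> closure Omega x0 ->
  ~ Omega x0 -> exists2 V, open V & V x0 /\ crossing_bound Omega V.
Proof.
move=> lO cx0 nOx0.
have [|Q [g [L [r [QQT gL r0 Or]]]]] := lO x0.
  by split => //; move: oO => /interior_id ->.
have [l l0 cl] := norm_graph_coords Q.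
have [l' l'0 cl'] := norm_graph_coords_inv Q.
have [k sk] := scales_graph_coords QQT.
pose h v := - g v.
have hL a b : `|h a - h b| <= L * enorm (a - b) by rewrite /h -opprD normrN gL.
pose S := 1 + `|L| * d%:R.
have S0 : 0 < S by rewrite ltr_wpDr// mulr_ge0.
pose T w := graph_coords_inv Q (shear g w).
pose T' x := shear h (graph_coords Q x).
have TK : cancel T T'.
  move=> w; rewrite /T /T' graph_coords_invK//.
  by apply: (shearK (g := g)) => v; rewrite /h subrr.
have T'K : cancel T' T.
  move=> w; rewrite /T /T' (shearK (g := h)) ?graph_coordsK// => v.
  by rewrite /h addNr.
have Tl x y : `|T x - T y| <= (l' * S) * `|x - y|.
  rewrite /T -graph_coords_invB// (le_trans (cl' _))// -mulrA ler_pM2l//.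
  exact: shear_lipschitz.
have T'l x y : `|T' x - T' y| <= (S * l) * `|x - y|.
  rewrite /T' (le_trans (shear_lipschitz hL _ _))// -mulrA ler_pM2l//.
  by rewrite -graph_coordsB.
have cT' : continuous T' := lipschitz_continuous T'l.
have mg : measurable_fun setT (g : 'rV[R]_d -> measurableTypeR R).
  apply: measurable_continuous_rV; apply: (@lipschitz_continuous _ _ _ _ (`|L| * d%:R)) => a b.
  apply: (le_trans (gL a b)); rewrite -mulrA.
  apply: (@le_trans _ _ (`|L| * enorm (a - b))).
    by rewrite ler_wpM2r ?enorm_ge0// ler_norm.
  by rewrite ler_wpM2l// enorm_le_norm.
have sT : scales T (k * 1) by exact: (scales_comp sk (scales_shear mg)).
pose w0 := T' x0.
(* [T] then maps the cube of radius [e] around [w0] into the Euclidean ball where the graph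
   describes [Omega]: [l' S] is a Lipschitz constant of [T], and [enorm] is at most [d + 1] times
   the maximum norm. *)
pose e := r / (d.+1%:R * (l' * S)).
have lS0 : 0 < l' * S by rewrite mulr_gt0.
have e0 : 0 < e by rewrite divr_gt0// mulr_gt0.
have near_x0 w : ball w0 e w -> enorm (T w - x0) < r.
  rewrite -ball_normE/= => w0w; rewrite (le_lt_trans (enorm_le_norm _))//.
  rewrite -(T'K x0) -/w0 mulrC -ltr_pdivlMr//.
  rewrite (le_lt_trans (Tl _ _))// mulrC -ltr_pdivlMr//.
  by rewrite distrC (lt_le_trans w0w)// /e invfM mulrA.
have OTE w : ball w0 e w -> Omega (T w) <-> 0 < w ord0 ord0.
  move=> /near_x0/Or ->; have := TK w; rewrite /T' => /(congr1 (fun v : 'rV[R]_d.+1 => (v ord0 ord0, rV_tail v))).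
  rewrite /shear rV_cons0/= rV_tail_cons/= /graph_coords rV_cons0/= rV_tail_cons/= => -[<- _].
  by rewrite /h subr_gt0.
pose B := ball w0 e `&` [set w : 'rV[R]_d.+1 | 0 < w ord0 ord0].
have mball : measurable (ball w0 e) by apply: measurable_open_rV; exact: ball_open.
have mB : measurable B.
  apply: measurableI => //.
  have := @measurable_coord R d.+1 ord0 measurableT `]0, +oo[%classic (measurable_itv _).
  rewrite setTI; congr measurable; apply/seteqP; split => w /=; by rewrite in_itv/= andbT.
exists (T' @^-1` (ball w0 e)).
  by apply: open_comp => [x _|]; [exact: cT'|exact: ball_open].
split; first exact: ballxx.
apply: (@crossing_bound_piece R d Omega mO T T' _ _ (2 * e) B _ sT TK lS0 Tl) => //.
- move=> x y t [Bx /= x0'] [By /= y0'] t01; split; first exact: convex_ball_rV.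
  by rewrite /= !mxE; move: t01 => /andP[t0 t1]; nra.
- apply: (@le_lt_trans _ _ (mu (ball w0 e))); first by apply: le_lebesgue_rV; exact: subIsetl.
  by apply: lebesgue_rV_bounded; exact: bounded_ball.
- by rewrite mulr_gt0.
- by move=> y z [By _] [Bz _]; exact: (ball_diameter By Bz).
- by move=> w [Bw w0']; exact/(OTE w Bw).
- apply: measurable_preimage => //; exact: (measurable_lipschitz T'l).
- by move=> x Bx Ox; split => //=; apply/(OTE _ Bx); rewrite T'K.
Qed.

(** The closure of [Omega] is compact, hence contained in a finite union of sets with a
    [crossing_bound], centred at interior or boundary points; on such a union the local estimate is
    global. *)
Lemma crossing_lipschitz_domain : bounded_set Omega -> lipschitz_boundary Omega ->
  exists c e s0 : R, [/\ 0 < c, 0 < e, 0 < s0 &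
    forall E (r s : R), measurable E -> E `<=` Omega -> (mu E <= e%:E)%E ->
      0 < r -> ((r ^+ d.+1)%:E <= mu E)%E -> 0 < s <= s0 ->
      ((c * (s ^+ d.+1 * (r ^+ d * Num.min r s)))%:E <=
      crossing Omega E (ball_kernel s))%E].
Proof.
move=> bO lO.
have cO : compact (closure Omega).
  by apply: bounded_closed_compact; [exact: bounded_closure|exact: closed_closure].
have [x cx|W OW [_ [c [e [s0 [c0 e0 s00 h]]]]]] := compact_union_ind (@crossing_bound_set0 R d Omega)
    (@crossing_boundU R d Omega) cO.
  have [Ox|nOx] := pselect (Omega x); first exact: crossing_bound_interior.
  exact: crossing_bound_boundary.
exists c, e, s0; split => // E r s mE EO Ee r0 rE; apply: h => //.
by rewrite setIidl//; apply: subset_trans EO _; apply: subset_trans OW; exact: subset_closure.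
Qed.

End lipschitz_domain.

(** * Radial kernels and layer cakes *)

Section norms.
Variable R : realType.

Lemma is_norm_lipschitz n (N : 'rV[R]_n -> R) : is_norm N ->
  exists2 b : R, 0 < b & forall x, N x <= b * `|x|.
Proof.
move=> [ND NZ N0].
have N00 : N 0 = 0 by rewrite -(scale0r 0) NZ normr0 mul0r.
have Nge0 x : 0 <= N x.
  have := ND x (-1 *: x); rewrite NZ normrN1 mul1r scaleN1r subrr N00; lra.
exists (\sum_i N (delta_mx ord0 i) + 1); first by rewrite ltr_wpDl// sumr_ge0.
move=> x; rewrite [in N x](row_sum_delta x) mulrDl mul1r ler_wpDr// mulr_suml.
have : forall s : seq 'I_n, N (\sum_(j <- s) x ord0 j *: delta_mx ord0 j) <=
    \sum_(j <- s) N (delta_mx ord0 j) * `|x|.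
  elim=> [|j s IH]; first by rewrite !big_nil N00.
  rewrite !big_cons (le_trans (ND _ _))// lerD// NZ mulrC ler_wpM2l// rV_coord_le//.
exact.
Qed.

Lemma is_norm_ge0 n (N : 'rV[R]_n -> R) x : is_norm N -> 0 <= N x.
Proof.
move=> [ND NZ _]; have N00 : N 0 = 0 by rewrite -(scale0r 0) NZ normr0 mul0r.
have := ND x (-1 *: x); rewrite NZ normrN1 mul1r scaleN1r subrr N00; lra.
Qed.

Lemma is_norm_sub n (N : 'rV[R]_n -> R) x y : is_norm N -> `|N x - N y| <= N (x - y).
Proof.
move=> [ND NZ _]; rewrite ler_norml; apply/andP; split.
  have := ND (-1 *: (x - y)) x; rewrite NZ normrN1 mul1r.
  by rewrite scaleN1r opprB subrK; lra.
by have := ND (x - y) y; rewrite subrK; lra.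
Qed.

Lemma is_norm_continuous n (N : 'rV[R]_n -> R) : is_norm N -> continuous N.
Proof.
move=> nN; have [b b0 Nb] := is_norm_lipschitz nN.
apply: (@lipschitz_continuous _ _ _ _ b) => x y.
by apply: le_trans (Nb _); exact: is_norm_sub.
Qed.

(** The constant is the minimum of [N] on the unit sphere of the maximum norm, which is compact, and
    nonempty since the dimension is positive. *)
Lemma is_norm_coercive d (N : 'rV[R]_d.+1 -> R) : is_norm N ->
  exists2 a : R, 0 < a & forall x, a * `|x| <= N x.
Proof.
move=> nN; have [ND NZ N0] := nN.
pose S := [set x : 'rV[R]_d.+1 | `|x| = 1].
have cS : compact S.
  apply: bounded_closed_compact.
    by exists 1; split; [exact: real1|move=> y y1 x; rewrite /S/= => ->; exact: ltW].
  apply: (closed_comp (f := fun x : 'rV[R]_d.+1 => `|x|) (D := [set 1])).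
    by move=> x _; exact: norm_continuous.
  exact: closed_eq.
have S0 : S !=set0.
  exists (const_mx 1); apply/eqP; rewrite eq_le; apply/andP; split.
    by apply/rV_norm_leP => // i; rewrite mxE normr1.
  by have := rV_coord_le (const_mx 1 : 'rV[R]_d.+1) ord0; rewrite mxE normr1.
have [c /set_mem cS1 cmin] := compact_EVT_min S0 cS (continuous_subspaceT (is_norm_continuous nN)).
exists (N c).
  rewrite lt_neqAle is_norm_ge0// andbT eq_sym; apply/eqP => /N0 c0.
  by move: cS1; rewrite /S/= c0 normr0 => /esym/eqP; rewrite oner_eq0.
move=> x; have [->|x0] := eqVneq x 0; first by rewrite normr0 mulr0 is_norm_ge0.
have nx : 0 < `|x| by rewrite normr_gt0.
have := cmin (`|x|^-1 *: x); rewrite NZ gtr0_norm ?invr_gt0// ler_pdivlMl// mulrC; apply.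
by apply/mem_set; rewrite /S/= normrZ gtr0_norm ?invr_gt0// mulVf// gt_eqF.
Qed.

Lemma enormZ n (a : R) (x : 'rV[R]_n) : enorm (a *: x) = `|a| * enorm x.
Proof.
rewrite /enorm (eq_bigr (fun i => a ^+ 2 * x ord0 i ^+ 2)); last first.
  by move=> i _; rewrite mxE exprMn.
by rewrite -mulr_sumr sqrtrM ?sqr_ge0// sqrtr_sqr.
Qed.

Lemma sum_sqr_ge0 n (x : 'rV[R]_n) : 0 <= \sum_i x ord0 i ^+ 2.
Proof. by rewrite sumr_ge0// => i _; rewrite sqr_ge0. Qed.

Lemma sqr_enorm n (x : 'rV[R]_n) : enorm x ^+ 2 = \sum_i x ord0 i ^+ 2.
Proof. by rewrite sqr_sqrtr// sum_sqr_ge0. Qed.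

(** Cauchy-Schwarz by Lagrange's identity: twice the difference of the squared sides is the double
    sum of [(x_i y_j - x_j y_i)^2]. *)
Lemma dot_le_enorm n (x y : 'rV[R]_n) :
  \sum_i x ord0 i * y ord0 i <= enorm x * enorm y.
Proof.
have h0 : 0 <= enorm x * enorm y by rewrite mulr_ge0// enorm_ge0.
apply: (le_trans (ler_norm _)).
rewrite -(@ler_pXn2r _ 2)// ?nnegrE// real_normK ?num_real// exprMn !sqr_enorm.
rewrite -subr_ge0 -(pmulr_rge0 _ (ltr0Sn R 1)).
have -> : 2 * ((\sum_i x ord0 i ^+ 2) * (\sum_i y ord0 i ^+ 2) - (\sum_i x ord0 i * y ord0 i) ^+ 2) =
  \sum_i \sum_j (x ord0 i * y ord0 j - x ord0 j * y ord0 i) ^+ 2.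
  rewrite [RHS](eq_bigr (fun i => \sum_j (x ord0 i ^+ 2 * y ord0 j ^+ 2
      + x ord0 j ^+ 2 * y ord0 i ^+ 2 - 2 * ((x ord0 i * y ord0 i) * (x ord0 j * y ord0 j))))); last first.
    by move=> i _; apply: eq_bigr => j _; ring.
  under [RHS]eq_bigr => i _.
    rewrite !big_split/= -mulr_sumr -mulr_suml sumrN -!mulr_sumr.
    over.
  rewrite !big_split/= -mulr_suml sumrN -!mulr_sumr -mulr_suml.
  ring.
by rewrite sumr_ge0// => i _; rewrite sumr_ge0// => j _; rewrite sqr_ge0.
Qed.

Lemma enormD n (x y : 'rV[R]_n) : enorm (x + y) <= enorm x + enorm y.
Proof.
have h0 : 0 <= enorm x + enorm y by rewrite addr_ge0// enorm_ge0.
rewrite -(@ler_pXn2r _ 2)// ?nnegrE ?enorm_ge0// sqrrD !sqr_enorm.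
rewrite (eq_bigr (fun i => x ord0 i ^+ 2 + (x ord0 i * y ord0 i) *+ 2 + y ord0 i ^+ 2)); last first.
  by move=> i _; rewrite mxE sqrrD.
by rewrite !big_split/=; have := dot_le_enorm x y; lra.
Qed.

Lemma enorm_is_norm n : is_norm (@enorm R n).
Proof.
split; [exact: enormD|exact: enormZ|move=> x ex].
apply/eqP; rewrite -normr_le0 -ex; exact: norm_le_enorm.
Qed.

End norms.

(** * Euclidean balls and radially nonincreasing envelopes *)

Section eballs.
Variable R : realType.
Local Notation mu := (lebesgue_rV R _).
Local Open Scope ereal_scope.

Lemma measurable_norm_fun n (N : 'rV[R]_n -> R) : is_norm N ->
  measurable_fun setT (N : 'rV[R]_n -> measurableTypeR R).
Proof. by move=> nN; apply: measurable_continuous_rV; exact: is_norm_continuous. Qed.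

Lemma measurable_eball n r : measurable (@eball R n r).
Proof.
have := measurable_norm_fun (enorm_is_norm R n) measurableT (measurable_itv `]-oo, r[).
by rewrite setTI; congr measurable; apply/seteqP; split => x /=; rewrite in_itv.
Qed.

Lemma eball_le0 n (r : R) : (r <= 0)%R -> @eball R n r = set0.
Proof.
move=> r0; apply/seteqP; split => x //=; rewrite /eball/= => xr.
by have := lt_le_trans xr r0; rewrite ltNge enorm_ge0.
Qed.

Lemma eball_measure d : exists2 w : R, (0 < w)%R &
  forall r : R, (0 <= r)%R -> mu (@eball R d.+1 r) = (w * r ^+ d.+1)%:E.
Proof.
have fin1 : mu (@eball R d.+1 1) < +oo.
  apply: (@le_lt_trans _ _ (mu [set x : 'rV[R]_d.+1 | `|x| < 1]%R)).
    by apply: le_lebesgue_rV => x; rewrite /eball/=; apply: le_lt_trans; exact: norm_le_enorm.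
  by rewrite lebesgue_rV_cube// ltry.
have pos1 : 0 < mu (@eball R d.+1 1).
  have D0 : (0 < (d.+1%:R : R)^-1)%R by rewrite invr_gt0.
  apply: (@lt_le_trans _ _ (mu [set x : 'rV[R]_d.+1 | `|x| < d.+1%:R^-1]%R)).
    by rewrite lebesgue_rV_cube// lte_fin exprn_gt0// mulrn_wgt0.
  apply: le_lebesgue_rV => x; rewrite /eball/= => xD.
  by rewrite (le_lt_trans (enorm_le_norm _))// -ltr_pdivlMl// mulr1.
exists (fine (mu (@eball R d.+1 1))); first by rewrite fine_gt0// pos1.
move=> r; rewrite le_eqVlt => /predU1P[<-|r0].
  by rewrite eball_le0// measure0 expr0n mulr0.
have ri0 : (0 < r^-1)%R by rewrite invr_gt0.
have [_ _ sD] := scales_dilation d.+1 ri0.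
have -> : @eball R d.+1 r = (fun x => r^-1 *: x)%R @^-1` (@eball R d.+1 1).
  by apply/seteqP; split => x; rewrite /eball/= enormZ gtr0_norm// ltr_pdivrMl// mulr1.
rewrite sD; last exact: measurable_eball.
by rewrite exprVn invrK EFinM fineK ?ge0_fin_numE// muleC.
Qed.

(** In positive dimension every [m >= 0] is the measure of some ball, so [xget] in [ball_of_measure]
    does not return its default value. *)
Lemma ball_of_measureE d : exists2 w : R, (0 < w)%R &
  (forall r : R, (0 <= r)%R -> mu (@eball R d.+1 r) = (w * r ^+ d.+1)%:E) /\
  (forall m : R, (0 <= m)%R -> exists r : R,
    [/\ (0 <= r)%R, (w * r ^+ d.+1 = m)%R & @ball_of_measure R d.+1 m = eball r]).
Proof.
have [w w0 wE] := eball_measure d; exists w => //; split => // m m0.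
rewrite /ball_of_measure; set P := [set r | _].
have [r0 [r00 r0m]] : P !=set0.
  have [mE|mp] : m = 0%R \/ (0 < m)%R by move: m0; rewrite le_eqVlt => /predU1P[<-|]; [left|right].
    by exists 0%R; split => //=; rewrite wE// expr0n mulr0 mE.
  have mw0 : (0 < m / w)%R by rewrite divr_gt0.
  have [r r0 rE] := root_exists d mw0.
  by exists r; split; rewrite /= ?(ltW r0)// wE ?(ltW r0)// rE mulrC divfK// gt_eqF.
have [x0 xm] : P (xget 0%R P) by apply: (xgetPex 0%R (P := P)); exists r0.
exists (xget 0%R P); split => //.
by move: xm; rewrite wE// => -[].
Qed.

End eballs.

Section radial_sup.
Variables (R : realType) (n : nat) (N : 'rV[R]_n -> R) (K : 'rV[R]_n -> \bar R).
Hypotheses (nN : is_norm N) (K0 : forall x, (0 <= K x)%E).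
Local Open Scope ereal_scope.

Definition radial_sup z := ereal_sup [set K y | y in [set y | (N z <= N y)%R]].

Lemma le_radial_sup z : K z <= radial_sup z.
Proof. by apply: ereal_sup_ubound; exists z => /=. Qed.

Lemma radial_sup_ge0 z : 0 <= radial_sup z.
Proof. exact: le_trans (K0 z) (le_radial_sup z). Qed.

Lemma radial_sup_antitone x y : (N x <= N y)%R -> radial_sup y <= radial_sup x.
Proof.
move=> xy; apply: ge_ereal_sup => _ [z /= yz <-].
by apply: ereal_sup_ubound; exists z => //=; exact: le_trans yz.
Qed.

Lemma radial_sup_le (c : R) z : (0 < c)%R ->
  (forall x y, (N x <= N y)%R -> c%:E * K y <= K x) -> c%:E * radial_sup z <= K z.
Proof.
move=> c0 cK; rewrite -lee_pdivlMl//; apply: ge_ereal_sup => _ [y /= zy <-].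
by rewrite lee_pdivlMl//; exact: cK.
Qed.

Lemma is_normN x : N (- x)%R = N x.
Proof. by have [_ NZ _] := nN; rewrite -scaleN1r NZ normrN1 mul1r. Qed.

Lemma radial_supN z : radial_sup (- z)%R = radial_sup z.
Proof. by rewrite /radial_sup is_normN. Qed.

(** Whatever the measurability of [K], a superlevel set of [radial_sup] is the preimage under [N] of
    a downward closed set of reals, hence of an interval. *)
Lemma measurable_radial_sup : measurable_fun setT radial_sup.
Proof.
apply: (measurability _ (ErealGenOInfty.measurableE R)) => //= _ [_ [t ->] <-].
pose A := [set r : R | exists2 z, (r <= N z)%R & t%:E < radial_sup z].
have mA : measurable A.
  apply: is_interval_measurable => a b [za _ _] [zb bz tz] c /andP[ac cb].
  by exists zb => //; exact: le_trans cb bz.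
have := measurable_norm_fun nN measurableT mA; congr measurable; rewrite !setTI.
apply/seteqP; split=> z /=; rewrite in_itv/= andbT.
  by move=> [y zy ty]; apply: (lt_le_trans ty); exact: radial_sup_antitone.
by move=> tz; exists z.
Qed.

End radial_sup.

Section layer_cake.
Variable R : realType.
Local Notation mu := (lebesgue_rV R _).
Local Notation leb := (@lebesgue_measure R).
Local Open Scope ereal_scope.

(** The condition [0 < t] is built in so that layer cake integrals run over the whole line. *)
Definition level n (J : 'rV[R]_n -> \bar R) (t : R) (z : 'rV[R]_n) : \bar R :=
  (\1_[set x | (0 < t)%R /\ (t%:E < J x)%E] z)%:E.

Lemma level_ge0 n (J : 'rV[R]_n -> \bar R) t z : 0 <= level J t z.
Proof. by rewrite lee_fin. Qed.

Lemma integral_interval_indic (a : \bar R) : 0 <= a ->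
  \int[leb]_t (\1_[set s : R | (0 < s)%R /\ (s%:E < a)%E] t)%:E = a.
Proof.
case: a => [a a0|_|//].
  have -> : [set s : R | (0 < s)%R /\ s%:E < a%:E] = `]0%R, a[%classic.
    by apply/seteqP; split => t /=; rewrite in_itv/= lte_fin; [move=> [-> ->]|move=> /andP[]].
  rewrite integral_indicT; last exact: measurable_itv.
  rewrite [LHS]lebesgue_measure_itv/= lte_fin; case: ltP => [_|]; first by rewrite oppr0 adde0.
  by move: a0; rewrite lee_fin => a0 a0'; congr EFin; apply/eqP; rewrite eq_le a0.
have -> : [set s : R | (0 < s)%R /\ s%:E < +oo] = `]0%R, +oo[%classic.
  by apply/seteqP; split => t /=; rewrite in_itv/= andbT ltry; [move=> []|].
rewrite integral_indicT; last exact: measurable_itv.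
by rewrite [LHS]lebesgue_measure_itv/= ltry.
Qed.

Section time_integrals.
Variables (n : nat) (H : measurableTypeR R * ('rV[R]_n * 'rV[R]_n) -> \bar R).
Hypotheses (mH : measurable_fun setT H) (H0 : forall z, 0 <= H z).

Let G (p : measurableTypeR R * 'rV[R]_n) := \int[mu]_y H (p.1, (p.2, y)).

Let mG : measurable_fun setT G.
Proof.
pose H' (q : (measurableTypeR R * 'rV[R]_n) * 'rV[R]_n) := H (q.1.1, (q.1.2, q.2)).
have mH' : measurable_fun setT H'.
  apply: (measurable_compT mH); apply: measurable_fun_pair.
    exact: measurableT_comp measurable_fst measurable_fst.
  apply: measurable_fun_pair; last exact: measurable_snd.
  exact: measurableT_comp measurable_snd measurable_fst.
have H'0 q : 0 <= H' q by exact: H0.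
by have := @measurable_fun_fubini_tonelli_F _ _ _ _ R mu _ mH' H'0; exact.
Qed.

Let G0 p : 0 <= G p. Proof. exact: integral_ge0. Qed.

Lemma measurable_iint :
  measurable_fun setT (fun t : measurableTypeR R => \int[mu]_x \int[mu]_y H (t, (x, y))).
Proof. by have := @measurable_fun_fubini_tonelli_F _ _ _ _ R mu _ mG G0; exact. Qed.

Lemma tonelli3 : \int[leb]_t \int[mu]_x \int[mu]_y H (t, (x, y)) =
  \int[mu]_x \int[mu]_y \int[leb]_t H (t, (x, y)).
Proof.
rewrite (fubini_tonelli (m1 := leb) (m2 := mu) _ mG G0).
apply: eq_integral => x _.
have mHx : measurable_fun setT (fun p : measurableTypeR R * 'rV[R]_n => H (p.1, (x, p.2))).
  apply: (measurable_compT mH); apply: measurable_fun_pair; first exact: measurable_fst.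
  by apply: measurable_fun_pair; [exact: measurable_cst|exact: measurable_snd].
by rewrite (fubini_tonelli (m1 := leb) (m2 := mu) _ mHx (fun p => H0 _)).
Qed.

End time_integrals.

Lemma measurable_levels n (J : 'rV[R]_n -> \bar R) : measurable_fun setT J ->
  measurable_fun setT (fun u : measurableTypeR R * ('rV[R]_n * 'rV[R]_n) =>
    level J u.1 (u.2.1 - u.2.2)%R).
Proof.
move=> mJ.
pose S := [set u : measurableTypeR R * ('rV[R]_n * 'rV[R]_n) |
  (0 < u.1)%R /\ (u.1%:E < J (u.2.1 - u.2.2)%R)].
have mu2 : measurable_fun setT (fun u : measurableTypeR R * ('rV[R]_n * 'rV[R]_n) => u.2.1 - u.2.2)%R.
  by apply: measurable_subrV; apply: measurableT_comp => //; exact: measurable_snd.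
have mS : measurable S.
  have m1 : measurable_fun setT (fun u : measurableTypeR R * ('rV[R]_n * 'rV[R]_n) => u.1%:E : \bar R).
    by apply: measurableT_comp => //; exact: measurable_fst.
  have A := measurable_lte measurableT (measurable_cst (0%:E : \bar R)) m1.
  have B := measurable_lte measurableT m1 (measurable_compT mJ mu2).
  have := measurableI _ _ A B; congr measurable.
  by apply/seteqP; split => u /=; rewrite /S/= !lte_fin => -[] // [_ ?] [_ ?].
apply: (eq_measurable_fun (fun u => (\1_S u)%:E)); last first.
  by apply: measurable_indic_comp => //; exact: measurable_id.
by move=> [t [x y]] _.
Qed.

Lemma integral_level n (J : 'rV[R]_n -> \bar R) z : 0 <= J z ->
  \int[leb]_t level J t z = J z.
Proof. by move=> Jz; rewrite -[RHS]integral_interval_indic. Qed.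

Lemma measurable_level_time n (J : 'rV[R]_n -> \bar R) z :
  measurable_fun setT (level J ^~ z : measurableTypeR R -> \bar R).
Proof.
apply: (eq_measurable_fun (fun t : measurableTypeR R => (\1_[set s : R | (0 < s)%R /\ (s%:E < J z)%E] t)%:E)) => //.
apply: measurable_indic_comp; last exact: measurable_id.
have m1 : measurable_fun setT (fun u : measurableTypeR R => u%:E : \bar R).
  by apply/measurable_EFinP; exact: measurable_id.
have A := measurable_lte measurableT (measurable_cst (0%:E : \bar R)) m1.
have B := measurable_lte measurableT m1 (measurable_cst (J z)).
have := measurableI _ _ A B; congr measurable.
by apply/seteqP; split => u /=; rewrite !lte_fin => -[] // [_ ?] [_ ?].
Qed.

Let crossing_level_fun n (A E : set 'rV[R]_n) J
    (u : measurableTypeR R * ('rV[R]_n * 'rV[R]_n)) : \bar R :=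
  (\1_E u.2.1)%:E * (\1_(A `\` E) u.2.2)%:E * level J u.1 (u.2.1 - u.2.2)%R.

Let measurable_crossing_level_fun n (A E : set 'rV[R]_n) J : measurable A -> measurable E ->
  measurable_fun setT J -> measurable_fun setT (crossing_level_fun A E J).
Proof.
move=> mA mE mJ; apply: emeasurable_funM; last exact: measurable_levels.
apply: emeasurable_funM; apply: measurable_indic_comp; rewrite //; try exact: measurableD.
  by apply: measurableT_comp => //; exact: measurable_snd.
by apply: measurableT_comp => //; exact: measurable_snd.
Qed.

Let crossing_level_fun_ge0 n (A E : set 'rV[R]_n) J u : 0 <= crossing_level_fun A E J u.
Proof. by rewrite !mule_ge0 ?lee_fin. Qed.

Lemma measurable_crossing_level n (A E : set 'rV[R]_n) J : measurable A -> measurable E ->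
  measurable_fun setT J ->
  measurable_fun setT (fun t : measurableTypeR R => crossing A E (level J t)).
Proof.
move=> mA mE mJ.
exact: (measurable_iint (measurable_crossing_level_fun mA mE mJ) (crossing_level_fun_ge0 A E J)).
Qed.

Lemma crossing_layer_cake n (A E : set 'rV[R]_n) J : measurable A -> measurable E ->
  measurable_fun setT J -> (forall x, 0 <= J x) ->
  crossing A E J = \int[leb]_t crossing A E (level J t).
Proof.
move=> mA mE mJ J0; apply/esym.
transitivity (\int[leb]_t \int[mu]_x \int[mu]_y crossing_level_fun A E J (t, (x, y))) => //.
rewrite (tonelli3 (measurable_crossing_level_fun mA mE mJ) (crossing_level_fun_ge0 A E J)).
apply: eq_integral => x _; apply: eq_integral => y _.
have c0 : 0 <= (\1_E x)%:E * (\1_(A `\` E) y)%:E :> \bar R by rewrite mule_ge0.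
rewrite (ge0_integralZl leb measurableT (measurable_level_time J (x - y)%R)
  (fun t _ => level_ge0 J t (x - y)%R) c0).
by rewrite integral_level.
Qed.

Lemma half_double (c : \bar R) : 0 <= c -> 2^-1%:E * (c + c) = c.
Proof.
case: c => [c _||//]; last by move=> _; rewrite addye// gt0_muley// lte_fin invr_gt0.
by rewrite -EFinD -EFinM; congr EFin; field.
Qed.

(** Pairs leaving [B] and pairs entering it contribute equally because [J] is even, which cancels
    the factor 1/2. [K], later a rearrangement, enters by monotonicity only and need not be
    measurable. *)
Lemma perimeter_le_crossing n (K J : 'rV[R]_n -> \bar R) (B : set 'rV[R]_n) :
  measurable B -> measurable_fun setT J -> (forall x, 0 <= K x) ->
  (forall x, K x <= J x) -> (forall x, J (- x)%R = J x) ->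
  perimeter K B <= crossing setT B J.
Proof.
move=> mB mJ K0 KJ JN.
have J0 x : 0 <= J x := le_trans (K0 x) (KJ x).
pose F := crossing_fun setT B J.
have mF : measurable_fun setT F by exact: measurable_crossing_fun.
have F0 z : 0 <= F z by exact: crossing_fun_ge0.
have mFs : measurable_fun setT (fun z : 'rV[R]_n * 'rV[R]_n => F (z.2, z.1)).
  by apply: (measurable_compT mF); measurability_rV.
have E1 : \int[mu]_y \int[mu]_x F (x, y) = crossing setT B J.
  by rewrite -(fubini_tonelli (m1 := mu) (m2 := mu) _ mF F0).
have mF1 y : measurable_fun setT (fun x => F (x, y)) by apply: (measurable_compT mF); measurability_rV.
have mF2 y : measurable_fun setT (fun x => F (y, x)) by apply: (measurable_compT mF); measurability_rV.
have mG1 : measurable_fun setT (fun y => \int[mu]_x F (x, y)).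
  by have := @measurable_fun_fubini_tonelli_G _ _ _ _ R mu _ mF F0; exact.
have mG2 : measurable_fun setT (fun y => \int[mu]_x F (y, x)).
  by have := @measurable_fun_fubini_tonelli_F _ _ _ _ R mu _ mF F0; exact.
have h : \int[mu]_y \int[mu]_x ((`|\1_B x - \1_B y|%R)%:E * K (x - y)%R) <=
    crossing setT B J + crossing setT B J.
  have G10 y : [set: 'rV[R]_n] y -> 0 <= \int[mu]_x F (x, y) by move=> _; exact: integral_ge0.
  have G20 y : [set: 'rV[R]_n] y -> 0 <= \int[mu]_x F (y, x) by move=> _; exact: integral_ge0.
  rewrite -[X in _ <= X + _]E1 -[X in _ <= _ + X]/(\int[mu]_y \int[mu]_x F (y, x)).
  rewrite -(ge0_integralD mu measurableT G10 mG1 G20 mG2).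
  apply: le_integral_ge0 => y _.
    by apply: integral_ge0 => x _; rewrite mule_ge0.
  rewrite -(ge0_integralD mu measurableT (fun x _ => F0 (x, y)) (mF1 y) (fun x _ => F0 (y, x)) (mF2 y)).
  apply: le_integral_ge0 => x _; first by rewrite mule_ge0.
  apply: (@le_trans _ _ ((`|\1_B x - \1_B y|%R)%:E * J (x - y)%R)).
    by rewrite lee_wpmul2l.
  rewrite /F /crossing_fun/= setTD -(JN (y - x)%R) opprB !indicE !in_setC.
  case: (x \in B); case: (y \in B); rewrite /= ?subrr ?subr0 ?sub0r ?normrN ?normr0 ?normr1;
    by rewrite ?(mule0,mul0e,mul1e,mule1,adde0,add0e).
rewrite /perimeter.
have c0 : 0 <= crossing setT B J by apply: integral_ge0 => x _; exact: integral_ge0.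
apply: (@le_trans _ _ (2^-1%:E * (crossing setT B J + crossing setT B J))).
  by apply: lee_wpmul2l h; rewrite lee_fin invr_ge0.
rewrite half_double; [exact: lexx|exact: c0].
Qed.

End layer_cake.

(** * The isoperimetric inequality *)

Section euclidean_shell.
Variable R : realType.
Local Notation mu := (lebesgue_rV R _).
Local Open Scope ereal_scope.

Lemma exprB_le (x y : R) n : (0 <= y <= x)%R ->
  (x ^+ n.+1 - y ^+ n.+1 <= n.+1%:R * (x ^+ n * (x - y)))%R.
Proof.
move=> /andP[y0 yx]; have x0 : (0 <= x)%R by exact: le_trans yx.
rewrite subrXX mulrCA mulrC mulrA; apply: ler_wpM2r; first by rewrite subr_ge0.
rewrite (_ : x ^+ n * n.+1%:R = \sum_(i < n.+1) x ^+ n)%R; last first.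
  by rewrite sumr_const card_ord mulr_natr.
apply: ler_sum => i _; rewrite -[in leRHS](subnK (leq_ord i)) exprD /=.
by apply: ler_pM; rewrite ?exprn_ge0// lerXn2r// nnegrE.
Qed.

Lemma lebesgue_rV_ball_center n (x : 'rV[R]_n) (s : R) : (0 < s)%R ->
  mu [set y | `|x - y| < s]%R = ((s *+ 2) ^+ n)%:E.
Proof.
move=> s0; rewrite -(lebesgue_rV_cube n s0) -(lebesgue_rV_translate (- x)%R (measurable_cube s0)).
by congr (mu _); apply/seteqP; split => y /=; rewrite distrC.
Qed.

(** A point of the ball sees the outside within maximum-norm distance [s] only if it lies in a shell
    of Euclidean thickness at most [D * min r s], where [D] compares the two norms. It then sees at
    most the volume [(2 s)^(d+1)] of a cube. *)
Lemma crossing_eball_ball d : exists2 C : R, (0 < C)%R & forall r s : R, (0 < r)%R -> (0 < s)%R ->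
  crossing setT (@eball R d.+1 r) (ball_kernel s) <=
  (C * (s ^+ d.+1 * (r ^+ d * Num.min r s)))%:E.
Proof.
have [w w0 wE] := eball_measure R d.
pose D : R := d.+1%:R; have D0 : (0 < D)%R by rewrite ltr0n.
have D1 : (1 <= D)%R by rewrite ler1n.
exists (2 ^+ d.+1 * (w * (D * D)))%R.
  by rewrite !mulr_gt0// exprn_gt0.
move=> r s r0 s0; pose r' := Num.max 0%R (r - D * s)%R.
have r'0 : (0 <= r')%R by rewrite le_max lexx.
have r'r : (r' <= r)%R.
  by rewrite ge_max (ltW r0)/= lerBlDr lerDl mulr_ge0// ltW.
have rr' : (r - r' <= D * Num.min r s)%R.
  have Ds : (s <= D * s)%R by rewrite ler_peMl// ltW.
  have Dr : (r <= D * r)%R by rewrite ler_peMl// ltW.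
  rewrite /r'; have [h|h] := leP (r - D * s)%R 0%R; have [rs|sr] := leP r s; lra.
have mB : measurable (@eball R d.+1 r) by exact: measurable_eball.
have mB' : measurable (@eball R d.+1 r') by exact: measurable_eball.
have mS : measurable (@eball R d.+1 r `\` eball r') by exact: measurableD.
apply: (@le_trans _ _ (\int[mu]_x ((\1_(@eball R d.+1 r `\` eball r') x)%:E * ((s *+ 2) ^+ d.+1)%:E))).
  apply: le_integral_ge0 => x _.
    by apply: integral_ge0 => y _; apply: crossing_fun_ge0; exact: ball_kernel_ge0.
  rewrite integral_crossing_ball//.
  rewrite [in X in X * _ <= _]indicE; case: (boolP (x \in eball r)) => [/set_mem xr|_]; last first.
    by rewrite mul0e mule_ge0// lee_fin ?exprn_ge0// mulrn_wge0// ltW.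
  rewrite mul1e indicE; case: (boolP (x \in eball r `\` eball r')) => [_|/negP nx].
    rewrite mul1e -(lebesgue_rV_ball_center x s0); apply: le_lebesgue_rV; exact: subIsetr.
  rewrite mul0e (_ : _ `&` _ = set0) ?measure0//.
  apply/seteqP; split => y //= [[_ yr] xys].
  have xr' : (enorm x < r')%R.
    by apply/not_notP => nxr; apply: nx; apply/mem_set; split.
  apply: yr; rewrite /eball/= (_ : y = x + - (x - y))%R; last by rewrite opprB addrC subrK.
  apply: (le_lt_trans (enormD _ _)); rewrite -scaleN1r enormZ normrN1 mul1r.
  have h : (enorm (x - y) < D * s)%R.
    by apply: (le_lt_trans (enorm_le_norm _)); rewrite ltr_pM2l.
  move: xr'; rewrite /r' lt_max => /orP[|xr']; first by rewrite ltNge enorm_ge0.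
  by lra.
rewrite ge0_integralZr//; last 2 first.
- by apply: measurable_indic_comp => //; exact: measurable_id.
- by rewrite lee_fin exprn_ge0// mulrn_wge0// ltW.
rewrite [X in X * _ <= _](_ : _ = (w * r ^+ d.+1 - w * r' ^+ d.+1)%:E); last first.
  rewrite (integral_indicT mu mS) EFinB -(wE r (ltW r0)) -(wE r' r'0) measureD//.
    rewrite setIidr// => x; rewrite /eball/= => /lt_le_trans; exact.
  by have := wE r (ltW r0); rewrite /= => ->; exact: ltry.
rewrite -EFinM lee_fin -mulrBr -[(s *+ 2)%R]mulr_natr exprMn.
have h1 := exprB_le d (introT andP (conj r'0 r'r)).
have rd0 : (0 < r ^+ d)%R by rewrite exprn_gt0.
have h2 : (r ^+ d.+1 - r' ^+ d.+1 <= D * (r ^+ d * (D * Num.min r s)))%R.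
  apply: (le_trans h1); rewrite ler_pM2l// ler_pM2l//.
rewrite (_ : 2 ^+ d.+1 * _ * _ = (w * (D * (r ^+ d * (D * Num.min r s)))) * (s ^+ d.+1 * 2 ^+ d.+1))%R; last by ring.
by rewrite ler_pM2r ?mulr_gt0 ?exprn_gt0// ler_pM2l.
Qed.

End euclidean_shell.

Section rearrangement_bound.
Variables (R : realType) (d : nat) (N : 'rV[R]_d.+1 -> R) (K : 'rV[R]_d.+1 -> \bar R).
Hypotheses (nN : is_norm N) (K0 : forall x, (0 <= K x)%E).
Local Notation mu := (lebesgue_rV R _).
Local Open Scope ereal_scope.

(* If [radial_sup N K ((a / b) *: x) <= t] then [{K > t}] lies in the Euclidean
   ball through [x], so that its rearrangement does not contain [x]. *)
Lemma rearrangement_le_radial_sup (a b : R) x : (0 < a)%R -> (0 < b)%R ->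
  (forall x, a * enorm x <= N x)%R -> (forall x, N x <= b * enorm x)%R ->
  rearrangement K x <= radial_sup N K ((a / b) *: x)%R.
Proof.
move=> a0 b0 aN Nb; set Jx := radial_sup N K _.
have Jx0 : 0 <= Jx by exact: radial_sup_ge0.
rewrite -[leRHS]integral_interval_indic//.
apply: (@le_trans _ _ (\int[lebesgue_measure]_(t in `]0%R, +oo[)
    (\1_[set s : R | (0 < s)%R /\ (s%:E < Jx)%E] t)%:E)); last first.
  by apply: le_integral_subset => // t _; rewrite lee_fin.
apply: le_integral_ge0 => // t /=; rewrite in_itv/= andbT => t0.
rewrite lee_fin !indicE ler_nat; case: (boolP (x \in _)) => // /set_mem xS.
rewrite mem_set//; split => //; apply/not_notP => /negP; rewrite -leNgt => Jt.
have [w w0 [wE bE]] := ball_of_measureE R d.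
set S := [set y | _] in xS.
have SE : S `<=` eball (enorm x).
  move=> y /= ty; rewrite /eball/= ltNge; apply/negP => xy.
  have : radial_sup N K y <= Jx.
    apply: radial_sup_antitone; have [_ NZ _] := nN; rewrite NZ gtr0_norm ?divr_gt0//.
    apply: le_trans (aN y); rewrite mulrAC ler_pdivrMr// -mulrA ler_pM2l//.
    by apply: (le_trans (Nb x)); rewrite mulrC ler_pM2r.
  move=> h; have := lt_le_trans ty (le_trans (le_trans (le_radial_sup _ _ _) h) Jt).
  by rewrite ltxx.
have muS : mu S <= (w * enorm x ^+ d.+1)%:E.
  by rewrite -wE ?enorm_ge0//; exact: le_lebesgue_rV.
have muSfin : mu S \is a fin_num by rewrite ge0_fin_numE// (le_lt_trans muS)// ltry.
have [r [r0 rm rE]] := bE (fine (mu S)) (fine_ge0 (measure_ge0 _ _)).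
move: xS; rewrite /set_rearrangement rE /eball/= => xr.
have : (w * r ^+ d.+1 <= w * enorm x ^+ d.+1)%R by rewrite rm -lee_fin fineK.
rewrite ler_pM2l// ler_pXn2r ?nnegrE ?enorm_ge0// => rx.
by have := lt_le_trans xr rx; rewrite ltxx.
Qed.

End rearrangement_bound.

Section level_comparison.
Variables (R : realType) (d : nat) (N : 'rV[R]_d.+1 -> R) (K : 'rV[R]_d.+1 -> \bar R).
Variables (p c0 : R).
Hypotheses (nN : is_norm N) (K0 : forall x, (0 <= K x)%E) (c00 : 0 < c0) (p0 : 0 <= p).
Local Notation mu := (lebesgue_rV R _).
Local Open Scope ereal_scope.
Hypothesis cK : forall x y, (N x <= N y)%R -> c0%:E * K y <= K x.
Hypothesis Kint : \int[mu]_z (K z * (Num.min 1 (enorm z `^ p))%:E) < +oo.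
Local Notation J := (radial_sup N K).

Let J0 x : 0 <= J x. Proof. exact: radial_sup_ge0. Qed.
Let mJ : measurable_fun setT J. Proof. exact: measurable_radial_sup. Qed.
Let c0J z : c0%:E * J z <= K z. Proof. exact: radial_sup_le. Qed.

Lemma weight_ge0 (z : 'rV[R]_d.+1) : (0 <= Num.min 1 (enorm z `^ p))%R.
Proof. by rewrite le_min ler01 powR_ge0. Qed.

(** Were [J z] infinite, [J], and thus [K >= c0 J], would be infinite where [N] is at most [N z], in
    particular on a shell [A] of positive measure. The shell stays away from the origin, so the
    weight is positive on it and [Kint] fails. *)
Lemma radial_sup_fin z : z != 0%R -> J z < +oo.
Proof.
move=> z0; rewrite ltNge; apply/negP; rewrite leye_eq => /eqP Jz.
have [b b0 Nb] := is_norm_lipschitz nN.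
have [a a0 aN] := is_norm_coercive nN.
have Nz : (0 < N z)%R by rewrite (lt_le_trans _ (aN z))// mulr_gt0// normr_gt0.
pose h := (N z / b)%R; have h0 : (0 < h)%R by rewrite divr_gt0.
have h20 : (0 < h / 2)%R by rewrite divr_gt0.
pose A := [set x : 'rV[R]_d.+1 | `|x| < h]%R `\` [set x | `|x| < h / 2]%R.
have mA : measurable A by apply: measurableD; exact: measurable_cube.
have A0 : 0 < mu A.
  have AE : mu A = ((h *+ 2) ^+ d.+1 - (h / 2 *+ 2) ^+ d.+1)%:E.
    rewrite EFinB -(lebesgue_rV_cube d.+1 h0) -(lebesgue_rV_cube d.+1 h20) measureD//.
    - by rewrite setIidr// => x /= /lt_trans; apply; lra.
    - exact: measurable_cube.
    - exact: measurable_cube.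
    - by have := lebesgue_rV_cube d.+1 h0; rewrite /= => ->; exact: ltry.
  rewrite AE lte_fin subr_gt0 ltr_pXn2r// ?nnegrE ?mulrn_wge0 ?(ltW h0) ?(ltW h20)//.
  by rewrite ltrMn2r/= ltr_pdivrMr// ltr_pMr// ltr1n.
have AK x : A x -> K x * (Num.min 1 (enorm x `^ p))%:E = +oo.
  move=> [/= xh /negP]; rewrite -leNgt => hx.
  have Kx : K x = +oo.
    apply/eqP; rewrite -leye_eq; apply: le_trans (c0J x).
    rewrite (_ : J x = +oo) ?gt0_muley ?lte_fin//.
    apply/eqP; rewrite -leye_eq -Jz; apply: radial_sup_antitone.
    by rewrite (le_trans (Nb x))// mulrC -ler_pdivlMr// ltW.
  rewrite Kx gt0_mulye// lte_fin lt_min ltr01/= powR_gt0//.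
  exact: lt_le_trans (lt_le_trans h20 hx) (norm_le_enorm x).
have : \int[mu]_(x in A) (+oo : \bar R) <= \int[mu]_z (K z * (Num.min 1 (enorm z `^ p))%:E).
  apply: (@le_trans _ _ (\int[mu]_(x in A) (K x * (Num.min 1 (enorm x `^ p))%:E))).
    by apply: le_integral_ge0 => [x _|x Ax]; rewrite ?leey// AK.
  by apply: le_integral_subset => // x _; rewrite mule_ge0// lee_fin weight_ge0.
rewrite integral_cst// gt0_mulye//.
by rewrite leye_eq => /eqP KE; move: Kint; rewrite KE ltxx.
Qed.

(** Inside the unit ball the integrand is at most [t]; outside, the weight in [Kint] equals 1 and
    [c0 J <= K]. This is the cost of the low levels per unit of measure. *)
Lemma integral_min_radial_sup (t : R) : (0 <= t)%R -> \int[mu]_z (mine (J z) t%:E) < +oo.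
Proof.
move=> t0.
have mB := @measurable_eball R d.+1 1.
pose g z := (\1_(~` @eball R d.+1 1) z)%:E * J z.
have mg : measurable_fun setT g.
  apply: emeasurable_funM => //; apply: measurable_indic_comp; last exact: measurable_id.
  exact: measurableC.
have g0 z : 0 <= g z by rewrite mule_ge0// lee_fin.
have gK : c0%:E * \int[mu]_z g z <= \int[mu]_z (K z * (Num.min 1 (enorm z `^ p))%:E).
  rewrite -(ge0_integralZl mu measurableT mg (fun x _ => g0 x)); last by rewrite lee_fin ltW.
  apply: le_integral_ge0 => z _; first by rewrite mule_ge0// lee_fin ltW.
  rewrite /g indicE; case: (boolP (z \in _)) => [/set_mem/= zB|_]; last first.
    by rewrite mul0e mule0 mule_ge0// lee_fin weight_ge0.
  have zB1 : (1 <= enorm z)%R by rewrite leNgt; apply/negP.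
  rewrite mul1e (_ : Num.min _ _ = 1%R) ?mule1//.
  by apply/min_idPl; rewrite -(powRr0 (enorm z)); exact: ler_powR.
have intg : \int[mu]_z g z < +oo.
  rewrite ltNge leye_eq; apply/negP => /eqP gE.
  move: gK; rewrite gE gt0_muley ?lte_fin// leye_eq => /eqP KE.
  by move: Kint; rewrite KE ltxx.
pose h z := (\1_(@eball R d.+1 1) z)%:E * t%:E.
have mh : measurable_fun setT h.
  by apply: emeasurable_funM => //; apply: measurable_indic_comp => //; exact: measurable_id.
have h0 z : 0 <= h z by rewrite mule_ge0// lee_fin.
apply: (@le_lt_trans _ _ (\int[mu]_z (h z + g z))).
  apply: le_integral_ge0 => z _; first by rewrite le_min J0 lee_fin.
  rewrite /h /g !indicE in_setC; case: (z \in _) => /=.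
    by rewrite mul1e mul0e adde0 ge_min lexx orbT.
  by rewrite mul1e mul0e add0e ge_min lexx.
rewrite (ge0_integralD mu measurableT (fun x _ => h0 x) mh (fun x _ => g0 x) mg).
apply: lte_add_pinfty => //.
have mi : measurable_fun setT (fun z => (\1_(@eball R d.+1 1) z)%:E : \bar R).
  by apply: measurable_indic_comp => //; exact: measurable_id.
rewrite (ge0_integralZr mu measurableT mi) => [|x _|]; rewrite ?lee_fin//.
rewrite (integral_indicT mu mB).
have [w w0 wE] := eball_measure R d.
by have := wE 1%R ler01; rewrite /= => ->; rewrite -EFinM; exact: ltry.
Qed.

Let JN z : J (- z)%R = J z. Proof. exact: radial_supN. Qed.

(* For [t >= t0], the superlevel sets of [J] and of its dilation are both
   comparable to a ball of radius [s <= s0]. *)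
Lemma crossing_level_comparison (Omega : set 'rV[R]_d.+1) (w k : R) :
  open Omega -> bounded_set Omega -> lipschitz_boundary Omega ->
  (0 < w)%R -> (0 < k)%R ->
  exists C e t0 : R, [/\ (0 < C)%R, (0 < e)%R, (0 <= t0)%R &
    forall E (r t : R), measurable E -> E `<=` Omega -> (0 < r)%R ->
      mu E = (w * r ^+ d.+1)%:E -> mu E <= e%:E -> (t0 <= t)%R ->
      crossing setT (@eball R d.+1 r) (level (fun z => J (k *: z)%R) t) <=
      C%:E * crossing Omega E (level J t)].
Proof.
move=> oO bO lO w0 k0.
have [c [e [s0 [c_gt0 e0 s00 cP]]]] := crossing_lipschitz_domain oO bO lO.
have [Cs Cs0 CsP] := crossing_eball_ball R d.
have [b b0 Nb] := is_norm_lipschitz nN.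
have [a a0 aN] := is_norm_coercive nN.
have [ND NZ NE0] := nN.
have [kw kw0 kwE] := root_exists d w0.
(* Levels [t] above the value of [J] on the sphere [N z = delta] are exceeded only where
   [N z < delta], so the inscribed radius [sup S / b] below is at most [s0]. *)
pose delta := (b * s0)%R; have delta0 : (0 < delta)%R by rewrite mulr_gt0.
have [z1 z10 Nz1] : exists2 z1 : 'rV[R]_d.+1, z1 != 0%R & N z1 = delta.
  pose u : 'rV[R]_d.+1 := const_mx 1%R.
  have u0 : u != 0%R.
    apply/eqP => /rowP/(_ ord0); rewrite !mxE => /eqP; rewrite oner_eq0//.
  have Nu : (0 < N u)%R by rewrite (lt_le_trans _ (aN u))// mulr_gt0// normr_gt0.
  exists ((delta / N u) *: u)%R.
    by rewrite scaler_eq0 negb_or u0 andbT mulf_neq0 ?invr_eq0// gt_eqF.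
  by rewrite NZ gtr0_norm ?divr_gt0// divfK// gt_eqF.
have J1 : J z1 \is a fin_num by rewrite ge0_fin_numE// radial_sup_fin.
(* If [J (k *: z)] exceeds [t], then [a k |z| <= sup S = b s], so [|z| < lam s]; the factor 2 makes
   the inequality strict. *)
pose lam := (2 * b / (a * k))%R.
have lam0 : (0 < lam)%R by rewrite divr_gt0 ?mulr_gt0.
have [M M0 [M1 M2]] : exists2 M : R, (0 < M)%R & (kw^-1 <= M)%R /\ (lam <= M)%R.
  exists (Num.max kw^-1 lam)%R; first by rewrite lt_max lam0 orbT.
  by split; rewrite le_max lexx ?orbT.
pose C := (Cs * lam ^+ d.+1 * M / (c * kw ^+ d))%R.
have ckw : (0 < c * kw ^+ d)%R by rewrite mulr_gt0// exprn_gt0.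
have C0 : (0 < C)%R by rewrite divr_gt0// !mulr_gt0// exprn_gt0.
exists C, e, (fine (J z1)); split=> [//|//||E r t mE EO r0 Er Ee t1].
  by rewrite fine_ge0.
have t0 : (0 <= t)%R by apply: le_trans t1; rewrite fine_ge0.
have cross0 A E' L : (forall z, 0 <= L z) -> 0 <= crossing A E' L.
  move=> L0; apply: integral_ge0 => x _; apply: integral_ge0 => y _.
  exact: crossing_fun_ge0.
have rhs0 : 0 <= C%:E * crossing Omega E (level J t).
  apply: mule_ge0; first by rewrite lee_fin ltW.
  by apply: cross0 => z; exact: level_ge0.
set J' := fun z => J (k *: z)%R.
have Jt z : t%:E < J z -> (N z < delta)%R.
  move=> tz; rewrite ltNge; apply/negP; rewrite -Nz1 => zz.
  have h : J z <= J z1 by exact: radial_sup_antitone.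
  have h1 : J z1 <= t%:E by rewrite -(fineK J1) lee_fin.
  by have := lt_le_trans tz (le_trans h h1); rewrite ltxx.
(* A level set reduced to the origin gives no crossing, since a point of the ball differs from a
   point outside it. This settles [t <= 0], an empty superlevel set, and one on which [N]
   vanishes. *)
have vanish : (forall z, (0 < t)%R -> t%:E < J' z -> z = 0%R) ->
    crossing setT (@eball R d.+1 r) (level J' t) <= C%:E * crossing Omega E (level J t).
  move=> J'0; suff -> : crossing setT (@eball R d.+1 r) (level J' t) = 0 by [].
  apply: integral0_eq => x _; apply: integral0_eq => y _.
  rewrite /crossing_fun/= setTD indicE; case: (boolP (x \in _)) => [/set_mem xr|_]; last by rewrite !mul0e.
  rewrite indicE; case: (boolP (y \in _)) => [/set_mem yr|_]; last by rewrite mule0 mul0e.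
  rewrite /level indicE; case: (boolP ((x - y)%R \in _)) => [/set_mem/= [t_gt0 /(J'0 _ t_gt0) xy]|_]; last by rewrite mule0.
  by exfalso; apply: yr; rewrite (_ : y = x)//; apply/eqP; rewrite eq_sym -subr_eq0 xy.
have [t_le0|t_gt0] := leP t 0%R.
  by apply: vanish => z; rewrite ltNge t_le0.
pose S := [set N z | z in [set z | t%:E < J z]].
have [Sne|Sem] := pselect (S !=set0); last first.
  by apply: vanish => z _ tz; exfalso; apply: Sem; exists (N (k *: z)%R); exists (k *: z)%R.
have Sub : has_sup S by split => //; exists delta => _ [z /= tz <-]; apply/ltW/Jt.
have Sle z : t%:E < J z -> (N z <= sup S)%R.
  by move=> tz; apply: (sup_upper_bound Sub); exists z.
have [sig0|sig0] := leP (sup S) 0%R.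
  apply: vanish => z _ /Sle h.
  have /NE0/eqP : N (k *: z)%R = 0%R.
    by apply/eqP; rewrite eq_le is_norm_ge0// andbT; exact: le_trans h sig0.
  by rewrite scaler_eq0 gt_eqF//= => /eqP.
pose s := (sup S / b)%R.
have s_gt0 : (0 < s)%R by rewrite divr_gt0.
have ss0 : (s <= s0)%R.
  rewrite ler_pdivrMr// mulrC; apply: ge_sup => // _ [z /= tz <-]; exact/ltW/Jt.
have inner z : ball_kernel s z <= level J t z.
  rewrite lee_fin !indicE ler_nat; case: (boolP (z \in _)) => // /set_mem/= zs.
  have zS : (N z < sup S)%R by rewrite (le_lt_trans (Nb z))// mulrC -ltr_pdivlMr.
  have [_ [z' /= tz' <-] zz'] := sup_gt Sne zS.
  have tz : t%:E < J z by apply: (lt_le_trans tz'); apply: radial_sup_antitone; exact: ltW.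
  by rewrite mem_set.
have outer z : level J' t z <= ball_kernel (lam * s)%R z.
  rewrite lee_fin !indicE ler_nat; case: (boolP (z \in _)) => // /set_mem/= [_ tz].
  have kz := Sle _ tz.
  rewrite mem_set//= -(@ltr_pM2l _ (a * k)) ?mulr_gt0// (_ : a * k * (lam * s) = 2 * sup S)%R; last first.
    by rewrite /lam /s; field; rewrite !gt_eqF.
  have : (a * (k * `|z|) <= N (k *: z))%R by have := aN (k *: z)%R; rewrite normrZ gtr0_norm.
  by rewrite mulrA => h; apply: (le_lt_trans (le_trans h kz)); rewrite ltr_pMl// ltr1n.
have h1 : crossing setT (@eball R d.+1 r) (level J' t) <=
    (Cs * ((lam * s) ^+ d.+1 * (r ^+ d * Num.min r (lam * s))))%:E.
  apply: le_trans (CsP _ _ r0 (mulr_gt0 lam0 s_gt0)); apply: le_crossing => // z.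
  exact: level_ge0.
have krE : ((kw * r) ^+ d.+1)%:E <= mu E by rewrite exprMn kwE Er.
have h2 := cP E (kw * r)%R s mE EO Ee (mulr_gt0 kw0 r0) krE (introT andP (conj s_gt0 ss0)).
have h3 : crossing Omega E (ball_kernel s) <= crossing Omega E (level J t).
  by apply: le_crossing => // z; exact: ball_kernel_ge0.
apply: (le_trans h1).
apply: (@le_trans _ _ (C%:E * (c * (s ^+ d.+1 * ((kw * r) ^+ d * Num.min (kw * r) s)))%:E)); last first.
  by apply: lee_wpmul2l; [rewrite lee_fin ltW|exact: le_trans h2 h3].
rewrite -EFinM lee_fin.
have mle : (Num.min r (lam * s) <= M * Num.min (kw * r) s)%R.
  rewrite minr_pMr ?(ltW M0)// le_min; apply/andP; split.
    rewrite ge_min mulrA ler_peMl ?(ltW r0)//.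
    by rewrite -ler_pdivrMr// div1r.
  by rewrite ge_min ler_pM2r// M2 orbT.
rewrite /C (_ : Cs * lam ^+ d.+1 * M / (c * kw ^+ d) * (c * (s ^+ d.+1 * ((kw * r) ^+ d * Num.min (kw * r) s))) =
  Cs * ((lam * s) ^+ d.+1 * (r ^+ d * (M * Num.min (kw * r) s))))%R; last first.
  have kwd : (kw ^+ d != 0)%R by rewrite expf_neq0// gt_eqF.
  have c_neq0 : (c != 0)%R by rewrite gt_eqF.
  by rewrite !exprMn; field; rewrite kwd c_neq0.
have l1 : (0 < (lam * s) ^+ d.+1)%R by rewrite exprn_gt0// mulr_gt0.
have r1 : (0 < r ^+ d)%R by rewrite exprn_gt0.
by rewrite (ler_pM2l Cs0) (ler_pM2l l1) (ler_pM2l r1).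
Qed.

End level_comparison.

Section crossing_integrals.
Variable R : realType.
Local Notation mu := (lebesgue_rV R _).
Local Notation leb := (@lebesgue_measure R).
Local Open Scope ereal_scope.

Lemma crossing_ge0 n (A E : set 'rV[R]_n) J : (forall x, 0 <= J x) -> 0 <= crossing A E J.
Proof.
move=> J0; apply: integral_ge0 => x _; apply: integral_ge0 => y _.
exact: crossing_fun_ge0.
Qed.

Lemma crossing_le_integral n (B : set 'rV[R]_n) (J : 'rV[R]_n -> \bar R) : measurable B ->
  measurable_fun setT J -> (forall x, 0 <= J x) -> (forall x, J (- x)%R = J x) ->
  crossing setT B J <= mu B * \int[mu]_z J z.
Proof.
move=> mB mJ J0 JN.
have mi : measurable_fun setT (fun x : 'rV[R]_n => (\1_B x)%:E : \bar R).
  by apply: measurable_indic_comp => //; exact: measurable_id.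
have I0 : 0 <= \int[mu]_z J z by exact: integral_ge0.
rewrite -(integral_indicT mu mB).
have i0 x : [set: 'rV[R]_n] x -> 0 <= (\1_B x)%:E :> \bar R by rewrite lee_fin.
rewrite -(ge0_integralZr mu measurableT mi i0 I0).
apply: le_integral_ge0 => x _; first by apply: integral_ge0 => y _; exact: crossing_fun_ge0.
have <- : \int[mu]_y J (x - y)%R = \int[mu]_z J z.
  rewrite -[RHS](ge0_integral_translate (- x)%R)//.
  by apply: eq_integral => y _; rewrite -JN opprB.
have mJx : measurable_fun setT (fun y : 'rV[R]_n => J (x - y)%R).
  by apply: (measurable_compT mJ); measurability_rV.
rewrite -(ge0_integralZl mu measurableT mJx (fun y _ => J0 _)); last by rewrite lee_fin.
apply: le_integral_ge0 => y _; first exact: crossing_fun_ge0.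
rewrite /crossing_fun/= -muleA; apply: lee_wpmul2l; first by rewrite lee_fin.
by rewrite indicE; case: (_ \in _); rewrite ?mul1e ?mul0e.
Qed.

End crossing_integrals.

Section isoperimetric.
Variables (R : realType) (d : nat) (N : 'rV[R]_d.+1 -> R) (K : 'rV[R]_d.+1 -> \bar R).
Variables (p c0 : R).
Hypotheses (nN : is_norm N) (K0 : forall x, (0 <= K x)%E) (c00 : 0 < c0) (p0 : 0 <= p).
Local Notation mu := (lebesgue_rV R _).
Local Open Scope ereal_scope.
Hypothesis cK : forall x y, (N x <= N y)%R -> c0%:E * K y <= K x.
Hypothesis Kint : \int[mu]_z (K z * (Num.min 1 (enorm z `^ p))%:E) < +oo.
Local Notation J := (radial_sup N K).

(** The hypothesis, tested on the ball with the measure of [E], bounds [m^(1/q)] by the crossing of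
    that ball for [J']. Its layer cake is split at [t0]: high levels are compared with those of [E],
    low ones form [Jm], whose integral [T] is finite. *)
Lemma isoperimetric (Omega : set 'rV[R]_d.+1) (q C1 : R) :
  open Omega -> bounded_set Omega -> lipschitz_boundary Omega -> (0 < q)%R -> (0 < C1)%R ->
  (forall m : R, (0 < m)%R ->
     (m `^ q^-1 / C1)%:E <= perimeter (rearrangement K) (@ball_of_measure R d.+1 m)) ->
  exists C : R, (0 < C)%R /\ forall E m, measurable E -> E `<=` Omega -> mu E = m%:E ->
    (m `^ q^-1)%:E <= C%:E * (crossing Omega E J + m%:E).
Proof.
move=> oO bO lO q0 C10 hper.
have J0 x : 0 <= J x by exact: radial_sup_ge0.
have mJ : measurable_fun setT J by exact: measurable_radial_sup.
have [w w0 [wE bE]] := ball_of_measureE R d.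
have [b b0 Nb] := is_norm_lipschitz nN.
have [a a0 aN] := is_norm_coercive nN.
pose a' := (a / d.+1%:R)%R; have a'0 : (0 < a')%R by rewrite divr_gt0.
have aN' x : (a' * enorm x <= N x)%R.
  apply: le_trans (aN x); rewrite /a' mulrAC ler_pdivrMr// -mulrA ler_pM2l// mulrC.
  exact: enorm_le_norm.
have Nb' x : (N x <= b * enorm x)%R.
  by apply: (le_trans (Nb x)); rewrite ler_pM2l// norm_le_enorm.
pose k := (a' / b)%R; have k0 : (0 < k)%R by rewrite divr_gt0.
pose J' z := J (k *: z)%R.
have J'0 z : 0 <= J' z by exact: J0.
have mJ' : measurable_fun setT J' by apply: (measurable_compT mJ); measurability_rV.
have J'N z : J' (- z)%R = J' z by rewrite /J' scalerN radial_supN.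
have [C [e [t0 [C_gt0 e0 t00 hC]]]] :=
  crossing_level_comparison nN K0 c00 cK Kint oO bO lO w0 k0.
pose Jm z := mine (J' z) t0%:E.
have Jm0 z : 0 <= Jm z by rewrite le_min J'0 lee_fin.
have mJm : measurable_fun setT Jm by apply: measurable_mine => //; exact: measurable_cst.
have JmN z : Jm (- z)%R = Jm z by rewrite /Jm J'N.
have Tfin : \int[mu]_z Jm z \is a fin_num.
  rewrite ge0_fin_numE; last exact: integral_ge0.
  rewrite (ge0_integral_scales (f := fun z => mine (J z) t0%:E) (scales_dilation _ k0)).
  - by rewrite lte_mul_pinfty ?lee_fin ?invr_ge0 ?exprn_ge0 ?ltW//; exact: (integral_min_radial_sup nN K0 c00 p0 cK Kint t00).
  - by apply: measurable_mine => //; exact: measurable_cst.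
  - by move=> z; rewrite le_min J0 lee_fin.
pose T := fine (\int[mu]_z Jm z).
have T0 : (0 <= T)%R by rewrite fine_ge0// integral_ge0.
have mO : measurable Omega by exact: measurable_open_rV.
have Ofin : mu Omega \is a fin_num by rewrite ge0_fin_numE// lebesgue_rV_bounded.
pose M := fine (mu Omega).
(* The first summand serves sets of measure at most [e]. For larger ones,
   [m^(1/q) <= M^(1/q) <= (M^(1/q) / e) m]. *)
pose Cf := (C1 * (C + T) + M `^ q^-1 / e)%R.
have Me0 : (0 <= M `^ q^-1 / e)%R by rewrite divr_ge0 ?powR_ge0// ltW.
have CT0 : (0 < C1 * (C + T))%R by rewrite mulr_gt0// ltr_wpDr.
exists Cf; split; first by rewrite ltr_wpDr.
move=> E m mE EO Em.
have m0 : (0 <= m)%R by rewrite -lee_fin -Em.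
have cr0 : 0 <= crossing Omega E J by exact: crossing_ge0.
have S0 : 0 <= crossing Omega E J + m%:E by apply: adde_ge0 => //; rewrite lee_fin.
have [m_0|m_gt0] : m = 0%R \/ (0 < m)%R by move: m0; rewrite le_eqVlt => /predU1P[<-|]; [left|right].
  rewrite {1}m_0 powR0 ?invr_eq0 ?gt_eqF//; apply: mule_ge0 => //.
  by rewrite lee_fin ltW// ltr_wpDr.
have [me|em] := leP m e; last first.
  apply: (@le_trans _ _ ((M `^ q^-1 / e)%:E * m%:E)).
    rewrite -EFinM lee_fin mulrAC -mulrA.
    apply: (@le_trans _ _ (M `^ q^-1)%R).
      apply: ge0_ler_powR; rewrite ?nnegrE ?invr_ge0 ?(ltW q0)//.
        by rewrite fine_ge0.
      by rewrite -lee_fin fineK// -Em; exact: le_lebesgue_rV.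
    rewrite ler_peMr ?powR_ge0// ler_pdivlMr// mul1r ltW//.
  apply: lee_pmul; rewrite ?lee_fin//; last by rewrite leeDr.
  by rewrite lerDr ltW.
have [r [r0 rm rE]] := bE m m0.
have r_gt0 : (0 < r)%R.
  by rewrite lt_neqAle r0 andbT; apply/eqP => r00; move: m_gt0; rewrite -rm -r00 expr0n mulr0 ltxx.
have per : (m `^ q^-1 / C1)%:E <= crossing setT (@eball R d.+1 r) J'.
  apply: le_trans (hper m m_gt0) _; rewrite rE; apply: perimeter_le_crossing => //.
  - exact: measurable_eball.
  - by move=> x; apply: integral_ge0 => t _; rewrite lee_fin.
  - by move=> x; exact: rearrangement_le_radial_sup.
have mB : measurable (@eball R d.+1 r) by exact: measurable_eball.
(* From [t0] on, the comparison of levels yields the first term; below [t0], where [J'] exceeds [t]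
   so does [Jm]. *)
have key t : crossing setT (@eball R d.+1 r) (level J' t) <=
    C%:E * crossing Omega E (level J t) + crossing setT (@eball R d.+1 r) (level Jm t).
  have lv L : 0 <= crossing Omega E (level L t) by apply: crossing_ge0 => z; exact: level_ge0.
  have lB L : 0 <= crossing setT (@eball R d.+1 r) (level L t).
    by apply: crossing_ge0 => z; exact: level_ge0.
  have [t0t|tt0] := leP t0 t.
    apply: (le_trans (hC E r t mE EO r_gt0 _ _ t0t)); rewrite ?Em ?rm ?lee_fin//.
    by apply: leeDl; exact: lB.
  apply: (@le_trans _ _ (crossing setT (@eball R d.+1 r) (level Jm t))).
    apply: le_crossing => // z; first exact: level_ge0.
    rewrite lee_fin !indicE ler_nat; case: (boolP (z \in _)) => // /set_mem/= [t_gt0 tz].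
    by rewrite mem_set//; split => //; rewrite lt_min tz lte_fin.
  by apply: leeDr; apply: mule_ge0; [rewrite lee_fin ltW|exact: lv].
have mcl : measurable_fun setT (fun t : measurableTypeR R => C%:E * crossing Omega E (level J t)).
  by apply: emeasurable_funM; [exact: measurable_cst|exact: measurable_crossing_level].
have mcB := measurable_crossing_level measurableT mB mJm.
have total : crossing setT (@eball R d.+1 r) J' <= C%:E * crossing Omega E J + m%:E * T%:E.
  rewrite (crossing_layer_cake measurableT mB mJ' J'0) (crossing_layer_cake mO mE mJ J0).
  apply: (@le_trans _ _ (\int[lebesgue_measure]_t (C%:E * crossing Omega E (level J t)
      + crossing setT (@eball R d.+1 r) (level Jm t)))).
    apply: le_integral_ge0 => t _; last exact: key.
    by apply: crossing_ge0 => z; exact: level_ge0.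
  rewrite (ge0_integralD lebesgue_measure measurableT _ mcl _ mcB); last 2 first.
  - by move=> t _; apply: mule_ge0; [rewrite lee_fin ltW|apply: crossing_ge0 => z; exact: level_ge0].
  - by move=> t _; apply: crossing_ge0 => z; exact: level_ge0.
  apply: leeD.
    have mcr := measurable_crossing_level mO mE mJ.
    have cr0' (t : measurableTypeR R) : setT t -> 0 <= crossing Omega E (level J t).
      by move=> _; apply: crossing_ge0 => z; exact: level_ge0.
    have C0' : 0 <= C%:E by rewrite lee_fin ltW.
    by rewrite (ge0_integralZl lebesgue_measure measurableT mcr cr0' C0').
  rewrite -(crossing_layer_cake measurableT mB mJm Jm0).
  apply: (le_trans (crossing_le_integral mB mJm Jm0 JmN)).
  by rewrite /T fineK// -rm -(wE r r0).
have : (m `^ q^-1)%:E <= C1%:E * (C%:E * crossing Omega E J + m%:E * T%:E).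
  by rewrite -lee_pdivrMl// -EFinM mulrC; exact: le_trans per total.
move/le_trans; apply.
apply: (@le_trans _ _ (C1%:E * ((C + T)%:E * (crossing Omega E J + m%:E)))).
  apply: lee_wpmul2l; first by rewrite lee_fin ltW.
  have mE0 : 0 <= m%:E :> \bar R by rewrite lee_fin.
  rewrite [leRHS](ge0_muleDr _ cr0 mE0); apply: leeD.
    by apply: (lee_wpmul2r cr0); rewrite lee_fin lerDl.
  by rewrite -!EFinM lee_fin mulrC ler_wpM2r// lerDr ltW.
rewrite muleA -EFinM; apply: (lee_wpmul2r S0).
by rewrite lee_fin lerDl.
Qed.

End isoperimetric.

(** * Superlevel sets and coarea *)

Section superlevel_sets.
Context dT (T : measurableType dT) (R : realType).
Variables (m : {sigma_finite_measure set T -> \bar R}) (v : T -> R).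
Hypotheses (mv : measurable_fun setT v) (v0 : forall x, 0 <= v x).
Local Notation leb := (@lebesgue_measure R).

(** Empty for [t <= 0], so that integrals over [t] may run over the whole line. *)
Definition superlevel (t : R) := [set x | 0 < t < v x].

Lemma measurable_superlevels :
  measurable [set z : measurableTypeR R * T | superlevel z.1 z.2].
Proof.
have m1 : measurable_fun setT (fun z : measurableTypeR R * T => z.1%:E : \bar R).
  by apply/measurable_EFinP; exact: measurable_fst.
have m2 : measurable_fun setT (fun z : measurableTypeR R * T => (v z.2)%:E : \bar R).
  by apply/measurable_EFinP; exact: measurable_compT mv measurable_snd.
have A := measurable_lte measurableT (measurable_cst (0%:E : \bar R)) m1.
have B := measurable_lte measurableT m1 m2.
have := measurableI _ _ A B; congr measurable.
by apply/seteqP; split => z /=; rewrite /superlevel/= !lte_fin; [move=> [[_ ->] [_ ->]]|move=> /andP[]].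
Qed.

Lemma measurable_superlevel t : measurable (superlevel t).
Proof.
have mt : measurable_fun setT (fun x : T => (t : measurableTypeR R, x)).
  by apply: measurable_fun_pair; [exact: measurable_cst|exact: measurable_id].
exact: (measurable_preimage measurable_superlevels mt).
Qed.

Let ind (z : measurableTypeR R * T) : \bar R := (\1_[set z | superlevel z.1 z.2] z)%:E.

Let mind : measurable_fun setT ind.
Proof. by apply: measurable_indic_comp; [exact: measurable_superlevels|exact: measurable_id]. Qed.

Let ind_superlevel t x : ind (t, x) = (\1_(superlevel t) x)%:E.
Proof. by []. Qed.

Lemma measurable_measure_superlevel :
  measurable_fun setT (fun t : measurableTypeR R => m (superlevel t)).
Proof.
have ind0 z : (0 <= ind z)%E by rewrite lee_fin.
have := @measurable_fun_fubini_tonelli_F _ _ _ _ R m ind mind ind0.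
apply: eq_measurable_fun => t _; rewrite /fubini_F.
by rewrite -[RHS](integral_indicT m (measurable_superlevel t)).
Qed.

Lemma integral_measure_superlevel :
  (\int[leb]_t m (superlevel t) = \int[m]_x (v x)%:E)%E.
Proof.
have ind0 z : (0 <= ind z)%E by rewrite lee_fin.
transitivity (\int[leb]_t \int[m]_x ind (t, x))%E.
  by apply: eq_integral => t _; rewrite -[LHS](integral_indicT m (measurable_superlevel t)).
rewrite (fubini_tonelli (m1 := leb) (m2 := m) _ mind ind0); apply: eq_integral => x _.
rewrite -[RHS]integral_interval_indic ?lee_fin//; apply: eq_integral => t _.
rewrite ind_superlevel !indicE; congr ((nat_of_bool _)%:R%:E).
apply/idP/idP => /set_mem/= h; apply/mem_set; move: h; rewrite /superlevel/= lte_fin.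
  by move=> /andP.
by move=> [-> ->].
Qed.

Variable q : R.
Hypothesis q1 : 1 <= q.
Hypothesis finS : forall t, (m (superlevel t) < +oo)%E.
Local Notation G t := (fine (m (superlevel t)) `^ q^-1).

Let q0 : 0 < q. Proof. exact: lt_le_trans q1. Qed.
Let G0 t : 0 <= G t. Proof. exact: powR_ge0. Qed.

Let mG : measurable_fun setT (fun t : measurableTypeR R => (G t)%:E).
Proof.
apply/measurable_EFinP; apply: (measurable_compT (measurable_powR q^-1)).
by apply: measurableT_comp measurable_measure_superlevel; exact: fine_measurable.
Qed.

(** On []0, t[] the nonincreasing function [G] is at least [G t]. *)
Lemma superlevel_chebyshev t : 0 < t -> ((t * G t)%:E <= \int[leb]_s (G s)%:E)%E.
Proof.
move=> t0.
have G0' : (0 <= (G t)%:E)%E by rewrite lee_fin.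
have mI : measurable (`]0, t[%classic : set (measurableTypeR R)) by exact: measurable_itv.
have -> : ((t * G t)%:E = \int[leb]_s ((G t)%:E * (\1_(`]0, t[%classic : set (measurableTypeR R)) s)%:E))%E.
  rewrite (ge0_integralZl leb measurableT (measurable_indic_comp mI (@measurable_id _ _ setT)) (fun s _ => _) G0') ?lee_fin//.
  by rewrite integral_indicT// [X in (_ * X)%E]lebesgue_measure_itv/= lte_fin t0 sube0 -EFinM mulrC.
apply: le_integral_ge0 => s _; first by apply: mule_ge0 => //; rewrite lee_fin.
rewrite indicE; case: (boolP (s \in _)) => [/set_mem/=|_]; last by rewrite mule0 lee_fin.
rewrite in_itv/= mule1 lee_fin => /andP[s0 st].
apply: ge0_ler_powR; rewrite ?nnegrE ?invr_ge0 ?(ltW q0)//; try exact: fine_ge0.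
apply: fine_le; rewrite ?ge0_fin_numE ?finS//.
apply: le_measure; rewrite ?inE; try exact: measurable_superlevel.
by move=> x; rewrite /superlevel/= => /andP[_ tv]; rewrite s0 (lt_trans st).
Qed.

(** The measure of the superlevel set is [G t ^ (q - 1) * G t], and [t * G t] is at most [i] by
    [superlevel_chebyshev]. *)
Lemma superlevel_powR t (i : R) : (\int[leb]_s (G s)%:E = i%:E)%E ->
  t `^ (q - 1) * fine (m (superlevel t)) <= i `^ (q - 1) * G t.
Proof.
move=> iE; have i0 : 0 <= i by rewrite -lee_fin -iE; apply: integral_ge0 => s _; rewrite lee_fin.
have [t0|t0] := ltP 0 t; last first.
  rewrite (_ : superlevel t = set0) ?measure0 ?mulr0 ?mulr_ge0 ?powR_ge0//.
  by apply/seteqP; split => x //; rewrite /superlevel/= ltNge t0.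
have g0 : 0 <= fine (m (superlevel t)) by exact: fine_ge0.
have gE : fine (m (superlevel t)) = G t `^ (q - 1) * G t.
  rewrite -[X in _ * X]powRr1// -powRD; last by rewrite subrK gt_eqF.
  by rewrite subrK -powRrM mulVf ?gt_eqF// powRr1.
rewrite {1}gE mulrA; apply: ler_wpM2r => //; rewrite -powRM ?(ltW t0)//.
apply: ge0_ler_powR; rewrite ?nnegrE ?subr_ge0//; first by rewrite mulr_ge0 ?(ltW t0).
by rewrite -lee_fin -iE; exact: superlevel_chebyshev.
Qed.

(** Keeping only []a/2, a[], where [t^(q-1)] is at least [(a/2)^(q-1)], gives [(a/2)^q]; the loss
    [2^q] becomes the factor 2 in [superlevel_Lq]. *)
Lemma powR_le_integral (a : R) : 0 <= a ->
  ((a `^ q)%:E <= (2 `^ q)%:E * \int[leb]_t ((t `^ (q - 1))%:E * (\1_[set t : R | (0 < t < a)%R] t)%:E))%E.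
Proof.
rewrite le_eqVlt => /predU1P[<-|a0].
  rewrite powR0 ?gt_eqF//; apply: mule_ge0; first by rewrite lee_fin powR_ge0.
  by apply: integral_ge0 => t _; rewrite lee_fin mulr_ge0 ?powR_ge0.
have a20 : 0 < a / 2 by rewrite divr_gt0.
have -> : ((a `^ q)%:E = (2 `^ q)%:E * ((a / 2) `^ q)%:E)%E.
  by rewrite -EFinM -powRM ?(ltW a20)//; congr (_ `^ _)%:E; field.
apply: lee_wpmul2l; first by rewrite lee_fin powR_ge0.
have c0 : (0 <= ((a / 2) `^ (q - 1))%:E)%E by rewrite lee_fin powR_ge0.
have mI : measurable (`]a / 2, a[%classic : set (measurableTypeR R)) by exact: measurable_itv.
have -> : (((a / 2) `^ q)%:E = \int[leb]_t (((a / 2) `^ (q - 1))%:E *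
    (\1_(`](a / 2)%R, a[%classic : set (measurableTypeR R)) t)%:E))%E.
  rewrite (ge0_integralZl leb measurableT (measurable_indic_comp mI (@measurable_id _ _ setT)) (fun s _ => _) c0) ?lee_fin//.
  rewrite integral_indicT// [X in (_ * X)%E]lebesgue_measure_itv/= lte_fin ifT; last by lra.
  rewrite -EFinB -EFinM (_ : a - a / 2 = (a / 2) `^ 1); last by rewrite powRr1 ?(ltW a20)//; field.
  by rewrite -powRD ?subrK// gt_eqF.
apply: le_integral_ge0 => s _; first by rewrite mule_ge0// lee_fin.
rewrite indicE; case: (boolP (s \in _)) => [/set_mem/=|_]; last first.
  by rewrite mule0 mule_ge0 ?lee_fin ?powR_ge0.
rewrite in_itv/= mule1 => /andP[sa sa']; rewrite indicE mem_set/=; last by rewrite sa' (lt_trans a20).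
rewrite mule1 lee_fin; apply: ge0_ler_powR; rewrite ?nnegrE ?subr_ge0 ?(ltW a20) ?(ltW sa)//.
exact/ltW/(lt_trans a20).
Qed.

(** The embedding of the Lorentz space [L^(q,1)] into [L^q]. In the layer cake of [v^q],
    [superlevel_powR] trades the weight [t^(q-1)] for [i^(q-1)] and leaves one factor [G t], whose
    integral is [i]. *)
Lemma superlevel_Lq :
  ((\int[m]_x (v x `^ q)%:E) `^ q^-1 <= 2%:E * \int[leb]_t (G t)%:E)%E.
Proof.
have I0 : (0 <= \int[leb]_t (G t)%:E)%E by apply: integral_ge0 => t _; rewrite lee_fin.
case IE: (\int[leb]_t (G t)%:E)%E I0 => [i||] // I0; last by rewrite gt0_muley ?leey// lte_fin.
have i0 : 0 <= i by rewrite -lee_fin.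
pose H (z : measurableTypeR R * T) : \bar R := ((z.1 `^ (q - 1))%:E * ind z)%E.
have H0 z : (0 <= H z)%E by rewrite mule_ge0 ?lee_fin ?powR_ge0.
have mp : measurable_fun setT (fun t : measurableTypeR R => t `^ (q - 1)).
  exact: measurable_powR.
have mH : measurable_fun setT H.
  apply: emeasurable_funM => //; apply/measurable_EFinP.
  exact: measurable_compT mp measurable_fst.
have key : (\int[m]_x (v x `^ q)%:E <= ((2 * i) `^ q)%:E)%E.
  apply: (@le_trans _ _ (\int[m]_x ((2 `^ q)%:E * \int[leb]_t H (t, x)))%E).
    apply: le_integral_ge0 => x _; first by rewrite lee_fin powR_ge0.
    exact: powR_le_integral.
  have c0 : (0 <= (2 `^ q)%:E)%E by rewrite lee_fin powR_ge0.
  have mF : measurable_fun setT (fun x => \int[leb]_t H (t, x))%E.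
    by have := @measurable_fun_fubini_tonelli_G _ _ _ _ R leb H mH H0; exact.
  rewrite (ge0_integralZl m measurableT mF (fun x _ => integral_ge0 _ (fun t _ => H0 (t, x))) c0).
  rewrite powRM// EFinM; apply: lee_wpmul2l => //.
  rewrite -(fubini_tonelli (m1 := leb) (m2 := m) _ mH H0).
  apply: (@le_trans _ _ (\int[leb]_t ((i `^ (q - 1))%:E * (G t)%:E))%E).
    apply: le_integral_ge0 => t _; first by apply: integral_ge0 => x _; exact: H0.
    have t0 : (0 <= (t `^ (q - 1))%:E)%E by rewrite lee_fin powR_ge0.
    have mi := measurable_indic_comp (R := R) (measurable_superlevel t) (@measurable_id _ _ setT).
    have -> : (\int[m]_x H (t, x) = (t `^ (q - 1))%:E * m (superlevel t))%E.
      rewrite -(integral_indicT m (measurable_superlevel t)).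
      by rewrite -(ge0_integralZl m measurableT mi (fun x _ => _) t0).
    rewrite -[X in (_ * X <= _)%E]fineK ?ge0_fin_numE ?finS//.
    by rewrite -!EFinM lee_fin; exact: superlevel_powR.
  have i0' : (0 <= (i `^ (q - 1))%:E)%E by rewrite lee_fin powR_ge0.
  have G0' (t : measurableTypeR R) : setT t -> (0 <= (G t)%:E)%E by rewrite lee_fin.
  rewrite (ge0_integralZl leb measurableT mG G0' i0').
  rewrite IE -EFinM lee_fin -[X in _ * X <= _](powRr1 i0) -powRD ?subrK//.
  by rewrite gt_eqF.
rewrite -EFinM -[X in (_ <= X%:E)%E](@powRr1 _ (2 * i)) ?mulr_ge0//.
have qq : q * q^-1 = 1 by rewrite mulfV// gt_eqF.
rewrite (_ : (2 * i) `^ 1 = ((2 * i) `^ q) `^ q^-1); last by rewrite -powRrM qq.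
rewrite -poweR_EFin.
apply: gt0_ler_poweR; rewrite ?invr_ge0 ?(ltW q0) ?in_itv/= ?leey ?andbT ?lee_fin ?powR_ge0//.
by apply: integral_ge0 => x _; rewrite lee_fin powR_ge0.
Qed.

End superlevel_sets.

Section coarea.
Variables (R : realType) (n : nat).
Local Notation mu := (lebesgue_rV R _).
Local Notation leb := (@lebesgue_measure R).
Local Open Scope ereal_scope.

(** For even [J] this is the integral under the root in [W_seminorm]; indicators replace the domains
    of integration, so that Tonelli applies on the whole product space. *)
Definition energy (Omega : set 'rV[R]_n) (J : 'rV[R]_n -> \bar R) (p : R) (v : 'rV[R]_n -> R) :=
  \int[mu]_x \int[mu]_y ((\1_Omega x)%:E * (\1_Omega y)%:E *
    (`|v x - v y| `^ p)%:E * J (x - y)%R).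

Variables (Omega : set 'rV[R]_n) (J : 'rV[R]_n -> \bar R) (v : 'rV[R]_n -> R).
Hypotheses (mO : measurable Omega) (mJ : measurable_fun setT J) (J0 : forall x, 0 <= J x).
Hypothesis mv : measurable_fun setT v.
Hypothesis vO : forall x, ~ Omega x -> v x = 0%R.

Let S := [set z : measurableTypeR R * 'rV[R]_n | superlevel v z.1 z.2].
Let SC := (setT `*` Omega) `\` S.

Let mS : measurable S. Proof. exact: (measurable_superlevels mv). Qed.

Let mSC : measurable SC.
Proof. by apply: measurableD => //; exact: measurableX. Qed.

Let H (z : measurableTypeR R * ('rV[R]_n * 'rV[R]_n)) : \bar R :=
  (\1_S (z.1, z.2.1))%:E * (\1_SC (z.1, z.2.2))%:E * J (z.2.1 - z.2.2)%R.

Let mH : measurable_fun setT H.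
Proof.
have m1 : measurable_fun setT (fun z : measurableTypeR R * ('rV[R]_n * 'rV[R]_n) => (z.1, z.2.1)).
  apply: measurable_fun_pair; first exact: measurable_fst.
  exact: measurableT_comp measurable_fst measurable_snd.
have m2 : measurable_fun setT (fun z : measurableTypeR R * ('rV[R]_n * 'rV[R]_n) => (z.1, z.2.2)).
  apply: measurable_fun_pair; first exact: measurable_fst.
  exact: measurableT_comp measurable_snd measurable_snd.
apply: emeasurable_funM.
  by apply: emeasurable_funM; apply: measurable_indic_comp.
apply: (measurable_compT mJ); apply: measurable_subrV.
  exact: measurableT_comp measurable_fst measurable_snd.
exact: measurableT_comp measurable_snd measurable_snd.
Qed.

Let H0 z : 0 <= H z. Proof. by rewrite !mule_ge0 ?lee_fin. Qed.

Let crossing_superlevelE t :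
  crossing Omega (superlevel v t) J = \int[mu]_x \int[mu]_y H (t, (x, y)).
Proof.
apply: eq_integral => x _; apply: eq_integral => y _.
rewrite /crossing_fun/H/= !indicE; congr (_ * (nat_of_bool _)%:R%:E * _).
apply/idP/idP => /set_mem h; apply/mem_set; first by case: h.
by case: h => -[].
Qed.

Lemma measurable_crossing_superlevel :
  measurable_fun setT (fun t : measurableTypeR R => crossing Omega (superlevel v t) J).
Proof.
apply: (eq_measurable_fun (fun t : measurableTypeR R => \int[mu]_x \int[mu]_y H (t, (x, y)))).
  by move=> t _; rewrite crossing_superlevelE.
exact: measurable_iint.
Qed.

(** For fixed [x] and [y], the levels [t] whose superlevel set contains [x] but not [y] lie in [[v
    y, v x[], of length at most [|v x - v y|]. As [v] vanishes off [Omega], such an [x] is in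
    [Omega]. *)
Lemma coarea_le : \int[leb]_t crossing Omega (superlevel v t) J <= energy Omega J 1 v.
Proof.
have -> : \int[leb]_t crossing Omega (superlevel v t) J =
    \int[leb]_t \int[mu]_x \int[mu]_y H (t, (x, y)).
  by apply: eq_integral => t _; exact: crossing_superlevelE.
rewrite (tonelli3 mH H0); apply: le_integral_ge0 => x _.
  by apply: integral_ge0 => y _; apply: integral_ge0 => t _; exact: H0.
apply: le_integral_ge0 => y _; first by apply: integral_ge0 => t _; exact: H0.
rewrite /H/=.
have mx : measurable_fun setT (fun t : measurableTypeR R => (t, x)).
  by apply: measurable_fun_pair; [exact: measurable_id|exact: measurable_cst].
have my : measurable_fun setT (fun t : measurableTypeR R => (t, y)).
  by apply: measurable_fun_pair; [exact: measurable_id|exact: measurable_cst].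
have mi : measurable_fun setT (fun t : measurableTypeR R => (\1_S (t, x))%:E * (\1_SC (t, y))%:E : \bar R).
  by apply: emeasurable_funM; apply: measurable_indic_comp.
have i0 (t : measurableTypeR R) : setT t -> 0 <= (\1_S (t, x))%:E * (\1_SC (t, y))%:E :> \bar R.
  by rewrite -EFinM lee_fin.
rewrite (ge0_integralZr leb measurableT mi i0 (J0 _)); apply: (lee_wpmul2r (J0 _)).
have mI : measurable (`[v y, v x[%classic : set (measurableTypeR R)) by exact: measurable_itv.
apply: (@le_trans _ _ (\int[leb]_t ((\1_Omega x)%:E * (\1_Omega y)%:E *
    (\1_(`[v y, v x[%classic : set (measurableTypeR R)) t)%:E))).
  apply: le_integral_ge0 => // t _.
  rewrite !indicE; case: (boolP ((t, x) \in S)) => [/set_mem|_]; last by rewrite mul0e -!EFinM lee_fin.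
  rewrite /S/=/superlevel/= => /andP[t0 tx].
  case: (boolP ((t, y) \in SC)) => [/set_mem[/= [_ Oy] ny]|_]; last by rewrite mule0 -!EFinM lee_fin.
  have Ox : Omega x by apply: contrapT => nOx; move: tx; rewrite (vO nOx) ltNge (ltW t0).
  have ty : (v y <= t)%R.
    by rewrite leNgt; apply/negP => ty; apply: ny; rewrite /S/= /superlevel/= t0.
  rewrite (mem_set Ox) (mem_set Oy) (@mem_set _ _ t)/= ?mule1//.
  by rewrite in_itv/= ty tx.
have c0 : 0 <= (\1_Omega x)%:E * (\1_Omega y)%:E :> \bar R by rewrite -EFinM lee_fin.
rewrite (ge0_integralZl leb measurableT (measurable_indic_comp mI (@measurable_id _ _ setT)) (fun s _ => _) c0) ?lee_fin//.
apply: lee_wpmul2l => //; rewrite integral_indicT// [leLHS]lebesgue_measure_itv/= lte_fin powRr1//.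
by case: ifP => h; rewrite -?EFinB lee_fin// ler_norm.
Qed.

End coarea.

(** * The Poincaré inequality *)

Lemma powR_abs_triangle (R : realType) (p a b c : R) : 0 < p ->
  `|a - c| `^ p <= 2 `^ p * (`|a - b| `^ p + `|c - b| `^ p).
Proof.
move=> p0; pose m := Num.max `|a - b| `|c - b|.
have m0 : 0 <= m by rewrite le_max normr_ge0.
apply: (@le_trans _ _ ((2 * m) `^ p)).
  apply: ge0_ler_powR; rewrite ?nnegrE ?mulr_ge0 ?(ltW p0)//.
  have -> : a - c = (a - b) - (c - b) by ring.
  apply: (le_trans (ler_normB _ _)).
  have l1 : `|a - b| <= m by rewrite le_max lexx.
  have l2 : `|c - b| <= m by rewrite le_max lexx orbT.
  by lra.
rewrite powRM//; apply: ler_wpM2l; first exact: powR_ge0.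
have [->|->] : m = `|a - b| \/ m = `|c - b| by rewrite /m; case: leP; [right|left].
  by rewrite lerDl powR_ge0.
by rewrite lerDr powR_ge0.
Qed.

Section double_integral.
Context dT (T : measurableType dT) (R : realType).
Variables (m : {sigma_finite_measure set T -> \bar R}) (p : R) (v : T -> R).
Hypotheses (mv : measurable_fun setT v) (p0 : 0 < p).
Local Open Scope ereal_scope.

Lemma integral_indic_mul (A : set T) (f : T -> \bar R) :
  \int[m]_(x in A) f x = \int[m]_x ((\1_A x)%:E * f x).
Proof.
by rewrite integral_mkcond epatch_indic; apply: eq_integral => x _; rewrite muleC.
Qed.

Definition oscillation (A B : set T) : \bar R :=
  \int[m]_(x in A) \int[m]_(y in B) (`|v x - v y| `^ p)%:E.

Lemma measurable_powR_diff : measurable_fun setT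
  (fun z : T * T => (`|v z.1 - v z.2| `^ p)%:E : \bar R).
Proof.
have m1 : measurable_fun setT (fun z : T * T => v z.1) by exact: measurable_compT mv measurable_fst.
have m2 : measurable_fun setT (fun z : T * T => v z.2) by exact: measurable_compT mv measurable_snd.
have mB : measurable_fun setT (fun z : T * T => v z.1 - v z.2)%R by exact: measurable_funB.
have mN : measurable_fun setT (fun z : T * T => `|v z.1 - v z.2|)%R by exact: measurableT_comp.
apply/measurable_EFinP; exact: (measurable_compT (measurable_powR p) mN).
Qed.

Lemma measurable_powR_diffr x : measurable_fun setT (fun y => (`|v x - v y| `^ p)%:E : \bar R).
Proof.
have mx : measurable_fun setT (fun y : T => (x, y)).
  by apply: measurable_fun_pair; [exact: measurable_cst|exact: measurable_id].
exact: measurable_compT measurable_powR_diff mx.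
Qed.

Let w0 x y : 0 <= (`|v x - v y| `^ p)%:E. Proof. by rewrite lee_fin powR_ge0. Qed.

Lemma measurable_oscillation_fun B : measurable B ->
  measurable_fun setT (fun x => \int[m]_(y in B) (`|v x - v y| `^ p)%:E).
Proof.
move=> mB; under eq_fun do rewrite integral_indic_mul.
pose F (z : T * T) : \bar R := (\1_B z.2)%:E * (`|v z.1 - v z.2| `^ p)%:E.
have mF : measurable_fun setT F.
  apply: emeasurable_funM; last exact: measurable_powR_diff.
  by apply: measurable_indic_comp => //; exact: measurable_snd.
have F0 z : 0 <= F z by rewrite mule_ge0.
by have := @measurable_fun_fubini_tonelli_F _ _ _ _ R m F mF F0; exact.
Qed.

Lemma oscillation_ge0 A B : 0 <= oscillation A B.
Proof. by apply: integral_ge0 => x _; apply: integral_ge0 => y _; exact: w0. Qed.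

Lemma oscillationC A B : measurable A -> measurable B -> oscillation A B = oscillation B A.
Proof.
move=> mA mB; pose F (z : T * T) : \bar R :=
  (\1_A z.1)%:E * ((\1_B z.2)%:E * (`|v z.1 - v z.2| `^ p)%:E).
have mF : measurable_fun setT F.
  apply: emeasurable_funM.
    by apply: measurable_indic_comp => //; exact: measurable_fst.
  apply: emeasurable_funM; last exact: measurable_powR_diff.
  by apply: measurable_indic_comp => //; exact: measurable_snd.
have F0 z : 0 <= F z by rewrite !mule_ge0.
have pull (C D : set T) : measurable D -> oscillation C D =
    \int[m]_x \int[m]_y ((\1_C x)%:E * ((\1_D y)%:E * (`|v x - v y| `^ p)%:E)).
  move=> mD; rewrite /oscillation integral_indic_mul; apply: eq_integral => x _.
  rewrite integral_indic_mul.
  have mG : measurable_fun setT (fun y => (\1_D y)%:E * (`|v x - v y| `^ p)%:E).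
    apply: emeasurable_funM; last exact: measurable_powR_diffr.
    by apply: measurable_indic_comp => //; exact: measurable_id.
  have G0 y : [set: T] y -> 0 <= (\1_D y)%:E * (`|v x - v y| `^ p)%:E by move=> _; rewrite mule_ge0.
  have c0 : 0 <= (\1_C x)%:E :> \bar R by rewrite lee_fin.
  by rewrite (ge0_integralZl m measurableT mG G0 c0).
rewrite (pull A B mB) (pull B A mA) (fubini_tonelli (m1 := m) (m2 := m) _ mF F0).
apply: eq_integral => y _; apply: eq_integral => x _.
by rewrite /F/= muleCA distrC.
Qed.

Lemma oscillationU A B C : measurable B -> measurable C -> measurable A ->
  oscillation A (B `|` C) <= oscillation A B + oscillation A C.
Proof.
move=> mB mC mA.
have mo D : measurable D -> measurable_fun A (fun x => \int[m]_(y in D) (`|v x - v y| `^ p)%:E).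
  by move=> mD; apply: measurable_funTS; exact: measurable_oscillation_fun.
have o0 D x : A x -> 0 <= \int[m]_(y in D) (`|v x - v y| `^ p)%:E.
  by move=> _; apply: integral_ge0 => y _; exact: w0.
rewrite -(ge0_integralD m mA (o0 B) (mo B mB) (o0 C) (mo C mC)).
apply: le_integral_ge0 => x Ax; first exact: o0.
have mD : measurable (C `\` B) by exact: measurableD.
have -> : B `|` C = B `|` (C `\` B).
  by apply/seteqP; split => y [By|Cy]; [left|have [?|?] := pselect (B y); [left|right]|left|right; case: Cy].
have mw (E : set T) : measurable_fun E (fun y => (`|v x - v y| `^ p)%:E).
  by apply: measurable_funTS; exact: measurable_powR_diffr.
rewrite (ge0_integral_setU m mB mD (mw _) (fun y _ => w0 x y)); last by apply/disj_set2P; exact: setDIK.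
by apply: leeD => //; apply: le_integral_subset => // y [].
Qed.

(** Integrate [|v x - v z|^p <= 2^p (|v x - v y|^p + |v z - v y|^p)] over [x] in [A], [y] in [B] and
    [z] in [C]. *)
Lemma oscillation_chain A B C (a b c : R) : measurable A -> measurable B -> measurable C ->
  m A = a%:E -> m B = b%:E -> m C = c%:E -> (0 <= a)%R -> (0 <= b)%R -> (0 <= c)%R ->
  b%:E * oscillation A C <=
    (2 `^ p)%:E * (c%:E * oscillation A B + a%:E * oscillation C B).
Proof.
move=> mA mB mC aE bE cE a0 b0 c0.
pose f D x := \int[m]_(y in D) (`|v x - v y| `^ p)%:E.
have mf D E : measurable D -> measurable_fun E (f D).
  by move=> mD; apply: measurable_funTS; exact: measurable_oscillation_fun.
have f0 D x : 0 <= f D x by apply: integral_ge0 => y _; exact: w0.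
have k0 : 0 <= (2 `^ p)%:E :> \bar R by rewrite lee_fin powR_ge0.
have mw (D : set T) x : measurable_fun D (fun y => (`|v x - v y| `^ p)%:E).
  by apply: measurable_funTS; exact: measurable_powR_diffr.
have b0' : 0 <= b%:E by rewrite lee_fin.
have c0' : 0 <= c%:E by rewrite lee_fin.
have a0' : 0 <= a%:E by rewrite lee_fin.
have o0 := oscillation_ge0.
have pt x z : b%:E * (`|v x - v z| `^ p)%:E <= (2 `^ p)%:E * (f B x + f B z).
  have -> : b%:E * (`|v x - v z| `^ p)%:E = \int[m]_(y in B) cst (`|v x - v z| `^ p)%:E y.
    by rewrite (integral_cst m mB) [RHS]muleC; congr (_ * _); exact: esym bE.
  have mD : measurable_fun B (fun y => (`|v x - v y| `^ p)%:E + (`|v z - v y| `^ p)%:E).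
    by apply: emeasurable_funD; exact: mw.
  rewrite -(ge0_integralD m mB (fun y _ => w0 x y) (mw B x) (fun y _ => w0 z y) (mw B z)).
  rewrite -(ge0_integralZl m mB mD (fun y _ => adde_ge0 (w0 x y) (w0 z y)) k0).
  apply: le_integral_ge0 => y _; first exact: w0.
  by rewrite /= -EFinD -EFinM lee_fin; exact: powR_abs_triangle.
have fC x : b%:E * f C x <= (2 `^ p)%:E * (c%:E * f B x + oscillation C B).
  rewrite -(ge0_integralZl m mC (mw C x) (fun y _ => w0 x y) b0').
  apply: (@le_trans _ _ (\int[m]_(z in C) ((2 `^ p)%:E * (f B x + f B z)))).
    by apply: le_integral_ge0 => z _; [exact: mule_ge0|exact: pt].
  have mD : measurable_fun C (fun z => f B x + f B z).
    by apply: emeasurable_funD; [exact: measurable_cst|exact: mf].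
  rewrite (ge0_integralZl m mC mD (fun z _ => adde_ge0 (f0 B x) (f0 B z)) k0).
  apply: lee_wpmul2l => //.
  rewrite (ge0_integralD m mC (fun z _ => f0 B x) (measurable_cst _) (fun z _ => f0 B z) (mf B C mB)).
  by apply: leeD => //; rewrite (integral_cst m mC (f B x)) muleC; apply: lee_wpmul2r => //; rewrite -cE.
have mfC : measurable_fun A (f C) by exact: mf.
rewrite /oscillation -(ge0_integralZl m mA mfC (fun x _ => f0 C x) b0').
apply: (@le_trans _ _ (\int[m]_(x in A) ((2 `^ p)%:E * (c%:E * f B x + oscillation C B)))).
  by apply: le_integral_ge0 => x _; [exact: mule_ge0|exact: fC].
have mcf : measurable_fun A (fun x => c%:E * f B x).
  by apply: emeasurable_funM; [exact: measurable_cst|exact: mf].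
have cf0 x : 0 <= c%:E * f B x by exact: mule_ge0.
have mD : measurable_fun A (fun x => c%:E * f B x + oscillation C B).
  by apply: emeasurable_funD => //; exact: measurable_cst.
rewrite (ge0_integralZl m mA mD (fun x _ => adde_ge0 (cf0 x) (o0 C B)) k0).
apply: lee_wpmul2l => //.
rewrite (ge0_integralD m mA (fun x _ => cf0 x) mcf (fun x _ => o0 C B) (measurable_cst _)).
rewrite (ge0_integralZl m mA (mf B A mB) (fun x _ => f0 B x) c0').
by apply: leeD => //; rewrite (integral_cst m mA (oscillation C B)) muleC; apply: lee_wpmul2r => //; rewrite -aE.
Qed.

End double_integral.

Section mean_power.
Context dT (T : measurableType dT) (R : realType).
Variables (m : {measure set T -> \bar R}) (D : set T) (M p : R).
Hypotheses (mD : measurable D) (M0 : 0 < M) (DM : m D = M%:E) (p1 : 1 <= p).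

(* With [a] the mean of [f] and [l := a / 2], integrate
   [f <= l + l ^ (1 - p) * f ^ p]. *)
Lemma powR_mean_le (f : T -> R) : measurable_fun D f -> (forall x, 0 <= f x) ->
  m.-integrable D (EFin \o f) ->
  (((M^-1 * \int[m]_(x in D) f x) `^ p)%:E <=
    (2 `^ p / M)%:E * \int[m]_(x in D) (f x `^ p)%:E)%E.
Proof.
move=> mf f0 intf; have p0 : 0 < p by exact: lt_le_trans p1.
set a := M^-1 * _.
have X0 : (0 <= \int[m]_(x in D) (f x `^ p)%:E)%E.
  by apply: integral_ge0 => x _; rewrite lee_fin powR_ge0.
have a0 : 0 <= a.
  rewrite mulr_ge0 ?invr_ge0 ?(ltW M0)//; apply: fine_ge0.
  by apply: integral_ge0 => x _; rewrite lee_fin.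
have k0 : 0 < 2 `^ p / M :> R by rewrite divr_gt0// powR_gt0.
move: a0; rewrite le_eqVlt => /predU1P[<-|a0].
  by rewrite powR0 ?gt_eqF// mule_ge0// lee_fin ltW.
have aE : (\int[m]_(x in D) (f x)%:E = (M * a)%:E)%E.
  by rewrite /a mulrA mulfV ?gt_eqF// mul1r fineK//; exact: integrable_fin_num.
pose l := a / 2; have l0 : 0 < l by rewrite divr_gt0.
have la : a = 2 * l by rewrite /l; field.
pose k := (l `^ (p - 1))^-1; have k_gt0 : 0 < k by rewrite invr_gt0 powR_gt0.
have pt x : f x <= l + k * f x `^ p.
  have [fl|lf] := leP (f x) l.
    by apply: (le_trans fl); rewrite lerDl mulr_ge0 ?powR_ge0 ?(ltW k_gt0).
  have fx0 : 0 < f x by exact: lt_trans lf.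
  apply: (@le_trans _ _ (k * f x `^ p)); last by rewrite lerDr ltW.
  rewrite /k mulrC ler_pdivlMr ?powR_gt0//.
  have -> : f x `^ p = f x * f x `^ (p - 1).
    rewrite -[X in X * _]powRr1 ?(ltW fx0)// -powRD; last by rewrite (gt_eqF fx0) implybT.
    by congr (_ `^ _); ring.
  rewrite ler_pM2l//; apply: ge0_ler_powR; rewrite ?nnegrE ?subr_ge0 ?(ltW l0) ?(ltW fx0) ?(ltW lf)//.
have mfp : measurable_fun D (fun x => (f x `^ p)%:E : \bar R).
  by apply/measurable_EFinP; exact: measurableT_comp (measurable_powR p) mf.
have key : ((M * a)%:E <= (l * M)%:E + k%:E * \int[m]_(x in D) (f x `^ p)%:E)%E.
  have kE0 : (0 <= k%:E)%E by rewrite lee_fin ltW.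
  have fp0 x : D x -> (0 <= (f x `^ p)%:E)%E by rewrite lee_fin powR_ge0.
  rewrite -aE -(ge0_integralZl m mD mfp fp0 kE0).
  rewrite EFinM -DM -(integral_cst m mD l%:E).
  have mk : measurable_fun D (fun x => k%:E * (f x `^ p)%:E)%E.
    by apply: emeasurable_funM => //; exact: measurable_cst.
  have c0 (x : T) : D x -> (0 <= cst l%:E x)%E by rewrite lee_fin ltW.
  have d0 (x : T) : D x -> (0 <= k%:E * (f x `^ p)%:E)%E by move=> Dx; rewrite mule_ge0// fp0.
  rewrite -(ge0_integralD m mD c0 (measurable_cst _) d0 mk).
  by apply: le_integral_ge0 => x _; rewrite lee_fin.
move: key X0; case: (\int[m]_(x in D) _)%E => [X||] //; last first.
  by move=> _ _; rewrite gt0_muley ?leey// lte_fin.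
rewrite -!EFinM -EFinD !lee_fin la => key X0.
have {}key : M * l <= k * X by lra.
rewrite powRM ?(ltW l0)// -mulrA; apply: ler_wpM2l; first exact: powR_ge0.
rewrite mulrC ler_pdivlMr//.
have -> : l `^ p = l * l `^ (p - 1).
  rewrite -[X in X * _]powRr1 ?(ltW l0)// -powRD; last by rewrite (gt_eqF l0) implybT.
  by congr (_ `^ _); ring.
move: key; rewrite /k mulrC [X in _ <= X]mulrC ler_pdivlMr ?powR_gt0// => key.
by apply: le_trans key; rewrite le_eqVlt; apply/orP; left; apply/eqP; ring.
Qed.

End mean_power.

Section poincare.
Variables (R : realType) (n : nat) (Omega : set 'rV[R]_n) (p rho : R).
Hypotheses (oO : open Omega) (cO : connected Omega) (bO : bounded_set Omega).
Hypotheses (p1 : 1 <= p) (rho0 : 0 < rho).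
Local Notation mu := (lebesgue_rV R _).
Local Notation osc := (oscillation mu p).
Local Notation En := (energy Omega (ball_kernel rho) p).

Let p0 : 0 < p. Proof. exact: lt_le_trans p1. Qed.
Let mO : measurable Omega. Proof. exact: measurable_open_rV. Qed.
(** Points of two cubes of radius [rho / 4] whose centres are within [rho / 2] are within [rho] of
    each other. *)
Let r := rho / 4.
Let r0 : 0 < r. Proof. by rewrite divr_gt0. Qed.

Lemma lebesgue_rV_open_gt0 (U : set 'rV[R]_n) x : open U -> U x -> (0 < mu U)%E.
Proof.
move=> oU Ux; have /nbhs_ballP[e /= e0 eU] := oU x Ux.
apply: (@lt_le_trans _ _ (mu [set y : 'rV[R]_n | `|x - y| < e]%R)).
  by rewrite lebesgue_rV_ball_center// lte_fin exprn_gt0// mulrn_wgt0.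
apply: le_lebesgue_rV => y /= xy; apply: eU; by rewrite -ball_normE.
Qed.

Lemma oscillation_local (A B : set 'rV[R]_n) v : A `<=` Omega -> B `<=` Omega ->
  (forall x y, A x -> B y -> `|x - y| < rho) -> (osc v A B <= En v)%E.
Proof.
move=> AO BO AB; rewrite /oscillation/energy integral_indic_mul.
have w0 x y : (0 <= (`|v x - v y| `^ p)%:E)%E by rewrite lee_fin powR_ge0.
have i0 x : (0 <= \int[mu]_(y in B) (`|v x - v y| `^ p)%:E)%E.
  by apply: integral_ge0 => y _; exact: w0.
apply: le_integral_ge0 => x _; first by apply: mule_ge0; [rewrite lee_fin|exact: i0].
have e0 y : (0 <= (\1_Omega x)%:E * (\1_Omega y)%:E *
    (`|v x - v y| `^ p)%:E * ball_kernel rho (x - y))%E.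
  by rewrite !mule_ge0 ?lee_fin ?powR_ge0.
rewrite {1}indicE; case: (boolP (x \in A)) => [/set_mem Ax|_]; last first.
  by rewrite mul0e; apply: integral_ge0 => y _; exact: e0.
rewrite mul1e integral_indic_mul; apply: le_integral_ge0 => y _.
  by apply: mule_ge0; rewrite ?lee_fin.
rewrite {1}indicE; case: (boolP (y \in B)) => [/set_mem By|_]; last by rewrite mul0e; exact: e0.
rewrite !indicE (mem_set (AO _ Ax)) (mem_set (BO _ By)) !mul1e /ball_kernel indicE.
by rewrite mem_set/= ?mule1//; exact: AB.
Qed.

Lemma energy_ge0 (J : 'rV[R]_n -> \bar R) v : (forall x, 0 <= J x)%E ->
  (0 <= energy Omega J p v)%E.
Proof.
move=> J0; apply: integral_ge0 => x _; apply: integral_ge0 => y _.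
by apply: mule_ge0 => //; rewrite !mule_ge0 ?lee_fin ?powR_ge0.
Qed.

Let En0 v : (0 <= En v)%E.
Proof. by apply: energy_ge0 => x; exact: ball_kernel_ge0. Qed.

Let mem_ball_center (x : 'rV[R]_n) (e : R) : 0 < e -> ball x e x.
Proof. by move=> e0; rewrite -ball_normE/= subrr normr0. Qed.

Let ball_dist (x y : 'rV[R]_n) (e : R) : ball x e y -> `|x - y| < e.
Proof. by rewrite -ball_normE. Qed.

Let piece x := Omega `&` ball x r.

Let piece_measure x : Omega x -> exists2 a : R, 0 < a & mu (piece x) = a%:E.
Proof.
move=> Ox; have oP : open (piece x) by apply: openI => //; exact: ball_open.
have P0 : (0 < mu (piece x))%E.
  by apply: (@lebesgue_rV_open_gt0 (piece x) x oP); split => //; exact: mem_ball_center.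
have Pf : (mu (piece x) < +oo)%E.
  apply: le_lt_trans (lebesgue_rV_bounded bO); apply: le_lebesgue_rV; exact: subIsetl.
exists (fine (mu (piece x))); first by rewrite fine_gt0// P0.
by rewrite fineK// ge0_fin_numE.
Qed.

Let mpiece x : measurable (piece x).
Proof. by apply: measurableI => //; apply: measurable_open_rV; exact: ball_open. Qed.

(** Call a centre good if the oscillation between its piece and the piece at [x0] is controlled. By
    [oscillation_chain] goodness passes between centres of [Omega] at distance less than [rho / 2],
    so good centres form an open and closed subset of [Omega], hence all of it. Finitely many pieces
    cover [Omega], and a last chain through the piece at [x0] compares [Omega] with itself. *)
Lemma oscillation_connected : exists2 C : R, 0 <= C &
  forall v, measurable_fun setT v -> (osc v Omega Omega <= C%:E * En v)%E.
Proof.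
have [E0|[x0 Ox0]] : Omega = set0 \/ Omega !=set0.
  by have [/eqP ?|/set0P ?] := boolP (Omega == set0); [left|right].
  exists 0 => // v _; rewrite mul0e /oscillation E0 integral_set0; exact: lexx.
have [b b0 bE] := piece_measure Ox0.
pose good (V : set 'rV[R]_n) := measurable V /\ exists2 C : R, 0 <= C &
  forall v, measurable_fun setT v -> (osc v (piece x0) (Omega `&` V) <= C%:E * En v)%E.
have good_step x y : Omega x -> Omega y -> `|x - y| < rho / 2 -> good (ball x r) -> good (ball y r).
  move=> Ox Oy xy [_ [C C0 hC]]; split; first by apply: measurable_open_rV; exact: ball_open.
  have [a a0 aE] := piece_measure Ox; have [c c0 cE] := piece_measure Oy.
  exists (2 `^ p * (c * C + b) / a); first by rewrite divr_ge0 ?mulr_ge0 ?powR_ge0 ?addr_ge0 ?mulr_ge0// ltW.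
  move=> v mv.
  have := oscillation_chain mv p0 (mpiece x0) (mpiece x) (mpiece y) bE aE cE (ltW b0) (ltW a0) (ltW c0).
  move=> h; rewrite [X in X%:E](mulrC _ a^-1) EFinM -muleA -lee_pdivrMl ?invr_gt0// invrK.
  apply: (le_trans h); rewrite EFinM -muleA.
  apply: lee_wpmul2l; first by rewrite lee_fin powR_ge0.
  rewrite EFinD [leRHS]ge0_muleDl ?lee_fin ?mulr_ge0 ?(ltW b0) ?(ltW c0)//.
  apply: leeD.
    by rewrite EFinM -muleA; apply: lee_wpmul2l; [rewrite lee_fin ltW|exact: hC].
  apply: lee_wpmul2l; first by rewrite lee_fin ltW.
  apply: oscillation_local => [z []//|z []//|z w [_ zy] [_ wx]].
  move: zy wx; rewrite -!ball_normE/= => zy wx.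
  have -> : z - w = (x - w) - (y - z) - (x - y) by apply/rowP => i; rewrite !mxE; ring.
  apply: (le_lt_trans (ler_normB _ _)); apply: (@lt_le_trans _ _ (r + r + rho / 2)); last by rewrite /r; lra.
  apply: ltrD => //; apply: (le_lt_trans (ler_normB _ _)); exact: ltrD.
have good0 : good (ball x0 r).
  split; first by apply: measurable_open_rV; exact: ball_open.
  exists 1 => // v mv; rewrite mul1e; apply: oscillation_local => [z []//|z []//|z w [_ +] [_ +]].
  rewrite -!ball_normE/= => zy wx.
  have -> : z - w = (x0 - w) - (x0 - z) by apply/rowP => i; rewrite !mxE; ring.
  apply: (le_lt_trans (ler_normB _ _)); apply: (@lt_le_trans _ _ (r + r)); last by move: (rho0); rewrite /r; lra.
  exact: ltrD.
have good_all : [set x | Omega x /\ good (ball x r)] = Omega.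
  have rho2 : 0 < rho / 2 by rewrite divr_gt0.
  apply: cO; first by exists x0.
    exists (\bigcup_(x in [set x | Omega x /\ good (ball x r)]) ball x (rho / 2)).
      by apply: bigcup_open => x _; exact: ball_open.
    apply/seteqP; split => [x [Ox gx]|y [Oy [x [Ox gx]]]].
      by split => //; exists x => //; exact: mem_ball_center.
    by move=> /ball_dist xy; split; [exact: Oy|exact: (good_step x y Ox Oy xy gx)].
  (* Closedness in [Omega]: the good centres are the points of [Omega] outside all balls of radius
     [rho / 2] around bad centres. *)
  exists (~` \bigcup_(x in [set x | Omega x /\ ~ good (ball x r)]) ball x (rho / 2)).
    by apply: open_closedC; apply: bigcup_open => x _; exact: ball_open.
  apply/seteqP; split => [x [Ox gx]|x [Ox nx]].
    split; first exact: Ox.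
    move=> [y [Oy ngy]] /ball_dist yx; apply: ngy.
    by rewrite distrC in yx; exact: (good_step x y Ox Oy yx gx).
  split; first exact: Ox.
  by apply: contrapT => ngx; apply: nx; exists x; [split|exact: mem_ball_center].
have goodU U V : good U -> good V -> good (U `|` V).
  move=> [mU [C1 C10 h1]] [mV [C2 C20 h2]]; split; first exact: measurableU.
  exists (C1 + C2); first exact: addr_ge0.
  move=> v mv; rewrite setIUr.
  apply: (le_trans (oscillationU mu p mv (measurableI _ _ mO mU) (measurableI _ _ mO mV) (mpiece x0))).
  by rewrite EFinD [leRHS]ge0_muleDl ?lee_fin//; apply: leeD; [exact: h1|exact: h2].
have good_set0 : good set0.
  split; first exact: measurable0.
  exists 0 => // v mv; rewrite mul0e setI0.
  rewrite /oscillation; under eq_integral do rewrite integral_set0.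
  by rewrite integral0; exact: lexx.
have [|W OW [_ [C C0 hC]]] := compact_union_ind good_set0 goodU
    (bounded_closed_compact (bounded_closure bO) (@closed_closure _ Omega)).
  move=> x cx; have [y [Oy xy]] := cx _ (nbhsx_ballx x r r0).
  exists (ball y r); first exact: ball_open.
  by split; [exact: ball_sym|move: Oy; rewrite -{1}good_all => -[]].
have OWE : Omega `&` W = Omega by apply: setIidl; exact: subset_trans (@subset_closure _ Omega) OW.
have Of : (mu Omega < +oo)%E by exact: lebesgue_rV_bounded.
have ME : mu Omega = (fine (mu Omega))%:E by rewrite fineK// ge0_fin_numE.
move: ME; set M := fine _ => ME.
have M0 : 0 <= M by exact: fine_ge0.
exists (2 `^ p * (M * C + M * C) / b).
  by rewrite divr_ge0 ?mulr_ge0 ?powR_ge0 ?addr_ge0 ?mulr_ge0// ltW.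
move=> v mv.
have := oscillation_chain mv p0 mO (mpiece x0) mO ME bE ME M0 (ltW b0) M0.
rewrite (oscillationC mu p mv mO (mpiece x0)) => h.
have {}hC := hC v mv; rewrite OWE in hC.
rewrite [X in X%:E](mulrC _ b^-1) EFinM -muleA -lee_pdivrMl ?invr_gt0// invrK.
apply: (le_trans h); rewrite EFinM -muleA.
apply: lee_wpmul2l; first by rewrite lee_fin powR_ge0.
rewrite EFinD [leRHS]ge0_muleDl ?lee_fin ?mulr_ge0//.
by rewrite EFinM -muleA; apply: leeD; apply: lee_wpmul2l.
Qed.

(** [v x - average Omega v] is the mean over [y] of [v x - v y]; [powR_mean_le] moves the power
    inside the mean, and integrating in [x] leaves the oscillation of [v] on [Omega]. *)
Lemma poincare_average : exists2 C : R, 0 <= C &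
  forall v, measurable_fun setT v -> mu.-integrable Omega (EFin \o v) ->
    (\int[mu]_(x in Omega) (`|v x - average Omega v| `^ p)%:E <= C%:E * En v)%E.
Proof.
have [C C0 hC] := oscillation_connected.
have [E0|[x0 Ox0]] : Omega = set0 \/ Omega !=set0.
  by have [/eqP ?|/set0P ?] := boolP (Omega == set0); [left|right].
  exists 0 => // v _ _; rewrite mul0e E0 integral_set0; exact: lexx.
have Of : (mu Omega < +oo)%E by exact: lebesgue_rV_bounded.
have Op := lebesgue_rV_open_gt0 oO Ox0.
have ME : mu Omega = (fine (mu Omega))%:E by rewrite fineK// ge0_fin_numE.
have M0 : 0 < fine (mu Omega) by rewrite fine_gt0// Op.
set M := fine (mu Omega) in ME M0.
have k0 : 0 <= 2 `^ p / M by rewrite divr_ge0 ?powR_ge0// ltW.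
exists (2 `^ p / M * C); first exact: mulr_ge0.
move=> v mv iv.
have mw x : measurable_fun Omega (fun y => `|v x - v y|).
  apply: measurable_funTS; apply: measurableT_comp => //.
  by apply: measurable_funB => //; exact: measurable_cst.
have ic x : mu.-integrable Omega (EFin \o cst (v x)).
  apply/integrableP; split; first by apply/measurable_EFinP; exact: measurable_cst.
  rewrite (_ : (fun _ => _) = cst `|v x|%:E)//.
  by rewrite (integral_cst mu mO `|v x|%:E) lte_mul_pinfty// lee_fin.
have id x : mu.-integrable Omega (EFin \o (fun y => v x - v y)).
  by have := integrableB mO (ic x) iv; exact.
have pt x : ((`|v x - average Omega v| `^ p)%:E <=
    (2 `^ p / M)%:E * \int[mu]_(y in Omega) (`|v x - v y| `^ p)%:E)%E.
  apply: le_trans (powR_mean_le mO M0 ME p1 (mw x) (fun y => normr_ge0 _) (integrable_norm (id x))).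
  rewrite lee_fin; apply: ge0_ler_powR; rewrite ?nnegrE ?(ltW p0)//.
    by apply: le_trans (_ : 0 <= M^-1 * `| \int[mu]_(y in Omega) (v x - v y)|) _; [rewrite mulr_ge0// invr_ge0 ltW|rewrite ler_pM2l ?invr_gt0//; exact: le_normr_Rintegral].
  have -> : v x - average Omega v = M^-1 * \int[mu]_(y in Omega) (v x - v y).
    rewrite (RintegralB mO (ic x) iv) (Rintegral_cst mu mO) /average -/M.
    by rewrite mulrBr mulrCA mulVf ?mulr1// gt_eqF.
  rewrite normrM (gtr0_norm (x := M^-1)) ?invr_gt0// ler_pM2l ?invr_gt0//.
  exact: le_normr_Rintegral.
apply: (@le_trans _ _ (\int[mu]_(x in Omega) ((2 `^ p / M)%:E *
    \int[mu]_(y in Omega) (`|v x - v y| `^ p)%:E))%E).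
  by apply: le_integral_ge0 => x _; [rewrite lee_fin powR_ge0|exact: pt].
have mosc : measurable_fun Omega (fun x => \int[mu]_(y in Omega) (`|v x - v y| `^ p)%:E)%E.
  by apply: measurable_funTS; exact: measurable_oscillation_fun.
have o0 x : Omega x -> (0 <= \int[mu]_(y in Omega) (`|v x - v y| `^ p)%:E)%E.
  by move=> _; apply: integral_ge0 => y _; rewrite lee_fin powR_ge0.
have k0' : (0 <= (2 `^ p / M)%:E)%E by rewrite lee_fin.
rewrite (ge0_integralZl mu mO mosc o0 k0') [in leRHS]EFinM -[leRHS]muleA.
by apply: lee_wpmul2l => //; exact: hC.
Qed.

End poincare.

(** * Reduction to Borel functions *)

Section energy.
Variables (R : realType) (n : nat) (Omega : set 'rV[R]_n) (p : R).
Local Notation mu := (lebesgue_rV R _).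
Hypothesis mO : measurable Omega.
Local Open Scope ereal_scope.

Definition energy_fun (J : 'rV[R]_n -> \bar R) (v : 'rV[R]_n -> R)
    (z : 'rV[R]_n * 'rV[R]_n) : \bar R :=
  (\1_Omega z.1)%:E * (\1_Omega z.2)%:E * (`|v z.1 - v z.2| `^ p)%:E * J (z.1 - z.2)%R.

Lemma measurable_energy_fun J v : measurable_fun setT J -> measurable_fun setT v ->
  measurable_fun setT (energy_fun J v).
Proof.
move=> mJ mv; apply: emeasurable_funM; last by apply: (measurable_compT mJ); measurability_rV.
apply: emeasurable_funM; last exact: measurable_powR_diff.
by apply: emeasurable_funM; apply: measurable_indic_comp.
Qed.

Lemma energy_fun_ge0 J v z : (forall x, 0 <= J x) -> 0 <= energy_fun J v z.
Proof. by move=> J0; apply: mule_ge0 => //; rewrite -!EFinM lee_fin !mulr_ge0 ?powR_ge0. Qed.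

Lemma measurable_energy_funr J v x : measurable_fun setT J -> measurable_fun setT v ->
  measurable_fun setT (fun y => energy_fun J v (x, y)).
Proof.
move=> mJ mv; apply: (measurable_compT (measurable_energy_fun mJ mv)).
by apply: measurable_fun_pair; [exact: measurable_cst|exact: measurable_id].
Qed.

Lemma measurable_energy_inner J v : measurable_fun setT J -> (forall x, 0 <= J x) ->
  measurable_fun setT v -> measurable_fun setT (fun x => \int[mu]_y energy_fun J v (x, y)).
Proof.
move=> mJ J0 mv; have F0 z : 0 <= energy_fun J v z by exact: energy_fun_ge0.
by have := @measurable_fun_fubini_tonelli_F _ _ _ _ R mu _ (measurable_energy_fun mJ mv) F0; exact.
Qed.

Lemma energyZ (c : R) J v : (0 <= c)%R -> measurable_fun setT J -> (forall x, 0 <= J x) ->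
  measurable_fun setT v ->
  energy Omega (fun z => c%:E * J z) p v = c%:E * energy Omega J p v.
Proof.
move=> c0 mJ J0 mv; have c0' : 0 <= c%:E by rewrite lee_fin.
have F0 z : 0 <= energy_fun J v z by exact: energy_fun_ge0.
rewrite /energy.
rewrite -(ge0_integralZl mu measurableT (measurable_energy_inner mJ J0 mv)
  (fun x _ => integral_ge0 _ (fun y _ => F0 (x, y))) c0').
apply: eq_integral => x _.
rewrite -(ge0_integralZl mu measurableT (measurable_energy_funr x mJ mv) (fun y _ => F0 (x, y)) c0').
by apply: eq_integral => y _; rewrite /energy_fun/= muleCA.
Qed.

Lemma le_energy J1 J2 v w : (forall x, 0 <= J1 x) -> (forall x, J1 x <= J2 x) -> (0 <= p)%R ->
  (forall x y, Omega x -> Omega y -> `|v x - v y| <= `|w x - w y|)%R ->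
  energy Omega J1 p v <= energy Omega J2 p w.
Proof.
move=> J10 J12 p0 vw; apply: le_integral_ge0 => x _.
  by apply: integral_ge0 => y _; exact: (energy_fun_ge0 v (x, y) J10).
apply: le_integral_ge0 => y _; first exact: (energy_fun_ge0 v (x, y) J10).
have c0 : 0 <= (\1_Omega x)%:E * (\1_Omega y)%:E * (`|v x - v y| `^ p)%:E :> \bar R.
  by rewrite -!EFinM lee_fin !mulr_ge0 ?powR_ge0.
apply: (lee_pmul c0 (J10 _) _ (J12 _)).
rewrite !indicE; case: (boolP (x \in Omega)) => [/set_mem Ox|_]; last by rewrite !mul0e.
case: (boolP (y \in Omega)) => [/set_mem Oy|_]; last by rewrite mule0 !mul0e.
by rewrite !mul1e lee_fin; apply: ge0_ler_powR; rewrite ?nnegrE//; exact: vw.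
Qed.

(** [u] need not be Borel, so the inner and the outer integrals are replaced in turn by
    [ge0_ae_eq_integral_left], where only the side of [v] is measurable. *)
Lemma energy_ae J u v : measurable_fun setT J -> (forall x, 0 <= J x) ->
  measurable_fun setT v -> {ae mu, forall x, Omega x -> u x = v x} ->
  energy Omega J p u = energy Omega J p v.
Proof.
move=> mJ J0 mv uv.
have F0 w x y : 0 <= energy_fun J w (x, y) by exact: energy_fun_ge0.
have I0 w x : 0 <= \int[mu]_y energy_fun J w (x, y) by apply: integral_ge0 => y _.
apply: (ge0_ae_eq_integral_left measurableT (measurable_energy_inner mJ J0 mv) (fun x _ => I0 u x)
  (fun x _ => I0 v x)).
apply: filterS (uv) => x uvx _.
apply: (ge0_ae_eq_integral_left measurableT (measurable_energy_funr x mJ mv) (fun y _ => F0 u x y)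
  (fun y _ => F0 v x y)).
apply: filterS (uv) => y uvy _; rewrite /energy_fun/= !indicE.
case: (boolP (x \in Omega)) => [/set_mem Ox|_]; last by rewrite !mul0e.
case: (boolP (y \in Omega)) => [/set_mem Oy|_]; last by rewrite mule0 !mul0e.
by rewrite (uvx Ox) (uvy Oy).
Qed.

Lemma energy_le_seminorm J K u : (forall x, 0 <= J x) -> (forall x, J (- x)%R = J x) ->
  (forall x, J x <= K x) ->
  energy Omega J p u <= \int[mu]_(y in Omega) \int[mu]_(x in Omega)
    (((`|u x - u y| `^ p)%R)%:E * K (x - y)%R).
Proof.
move=> J0 JN JK; rewrite integral_indic_mul; apply: le_integral_ge0 => x _.
  by apply: integral_ge0 => y _; exact: (energy_fun_ge0 u (x, y) J0).
have K0 z : 0 <= K z by exact: le_trans (JK z).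
have i0 : 0 <= \int[mu]_(y in Omega) (((`|u y - u x| `^ p)%R)%:E * K (y - x)%R).
  by apply: integral_ge0 => y _; apply: mule_ge0 => //; rewrite lee_fin powR_ge0.
rewrite {2}indicE; case: (boolP (x \in Omega)) => [/set_mem Ox|nx]; last first.
  rewrite mul0e integral0_eq// => y _.
  by rewrite indicE (negbTE nx) !mul0e.
rewrite [leRHS]mul1e [leRHS]integral_indic_mul; apply: le_integral_ge0 => y _.
  exact: (energy_fun_ge0 u (x, y) J0).
rewrite !indicE (mem_set Ox) mul1e -muleA; apply: lee_wpmul2l; first by rewrite lee_fin.
rewrite distrC; apply: lee_wpmul2l; first by rewrite lee_fin powR_ge0.
by rewrite -JN opprB; exact: JK.
Qed.

End energy.

Section borel_version.
Variables (R : realType) (n : nat) (Omega : set 'rV[R]_n) (J K : 'rV[R]_n -> \bar R) (r c0 : R).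
Local Notation mu := (lebesgue_rV R _).
Hypotheses (mO : measurable Omega) (Ofin : (mu Omega < +oo)%E) (r1 : 1 <= r) (c00 : 0 < c0).
Hypotheses (mJ : measurable_fun setT J) (J0 : forall x, (0 <= J x)%E).
Hypotheses (JN : forall x, J (- x) = J x) (JK : forall x, (c0%:E * J x <= K x)%E).

Lemma borel_version u : W_space K r Omega u -> exists v, [/\ measurable_fun setT v,
  mu.-integrable Omega (EFin \o v),
  forall q, Lp_norm q Omega (fun x => u x - average Omega u) =
            Lp_norm q Omega (fun x => v x - average Omega v) &
  ((c0%:E * energy Omega J r v) `^ r^-1 <= W_seminorm K r Omega u)%E].
Proof.
(* The version is the Borel function of the definition, extended by 0 off [Omega]. Equality almost
   everywhere preserves the integrals over [Omega] of nonnegative Borel functions of [u], hence the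
   average and every [Lp_norm]. *)
move=> [[[g [mg ug]] Lfin] _]; have r0 : 0 < r by exact: lt_le_trans r1.
pose v := g \_ Omega.
have mv : measurable_fun setT v by exact: (iffLR (measurable_restrictT _ mO) mg).
have uv : {ae mu, forall x, Omega x -> u x = v x}.
  by apply: filterS ug => x h Ox; rewrite (h Ox) /v patchE mem_set.
have int_eq (f : R -> \bar R) : measurable_fun setT f -> (forall a, (0 <= f a)%E) ->
    (\int[mu]_(x in Omega) f (u x) = \int[mu]_(x in Omega) f (v x))%E.
  move=> mf f0.
  have mfv : measurable_fun Omega (fun x => f (v x)).
    by apply: measurable_funTS; exact: measurable_compT mf mv.
  apply: (ge0_ae_eq_integral_left mO mfv (fun x _ => f0 (u x)) (fun x _ => f0 (v x))).
  by apply: filterS (uv) => x h Ox; rewrite (h Ox).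
have mE : measurable_fun setT (EFin : R -> \bar R) by exact/measurable_EFinP/measurable_id.
(* The average is an integral of a signed function, hence the separate treatment of positive and
   negative parts. *)
have avg : average Omega u = average Omega v.
  rewrite /average /Rintegral; congr (_ * fine _).
  rewrite integralE [RHS]integralE; congr (_ - _)%E.
    under eq_integral do rewrite funeposE; under [RHS]eq_integral do rewrite funeposE.
    apply: (int_eq (fun a => maxe a%:E 0%E)) => [|a]; last by rewrite le_max lexx orbT.
    by apply: measurable_maxe => //; exact: measurable_cst.
  under eq_integral do rewrite funenegE; under [RHS]eq_integral do rewrite funenegE.
  apply: (int_eq (fun a => maxe (- a%:E)%E 0%E)) => [|a]; last by rewrite le_max lexx orbT.
  by apply: measurable_maxe; [exact: measurableT_comp|exact: measurable_cst].
have mpow (a q : R) : measurable_fun setT (fun t : R => (`|t - a| `^ q)%:E : \bar R).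
  apply/measurable_EFinP; apply: (measurable_compT (measurable_powR q)).
  by apply: measurableT_comp => //; apply: measurable_funB => //; exact: measurable_cst.
exists v; split.
- exact: mv.
- have fin : (\int[mu]_(x in Omega) (`|v x| `^ r)%:E < +oo)%E.
    have <- : (\int[mu]_(x in Omega) (`|u x| `^ r)%:E = \int[mu]_(x in Omega) (`|v x| `^ r)%:E)%E.
      have h := int_eq (fun t => (`|t - 0| `^ r)%:E) (mpow 0 r) (fun t => _).
      under eq_integral do rewrite -[u _]subr0; under [RHS]eq_integral do rewrite -[v _]subr0.
      by apply: h => t; rewrite lee_fin powR_ge0.
    rewrite ltey; apply/eqP => oo; move: Lfin; rewrite /Lp_norm oo poweRyr ?ltxx//.
    by rewrite invr_eq0 gt_eqF.
  apply/integrableP; split; first by apply/measurable_EFinP; exact: measurable_funTS.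
  have m1 : measurable_fun Omega (fun x => (`|v x| `^ r)%:E : \bar R).
    apply/measurable_EFinP; apply: measurable_funTS.
    by apply: (measurable_compT (measurable_powR r)); exact: measurableT_comp.
  (* As [|v| <= 1 + |v|^r] and [Omega] has finite measure, [v] is integrable. *)
  apply: (@le_lt_trans _ _ (\int[mu]_(x in Omega) (cst 1 x + (`|v x| `^ r)%:E))%E).
    apply: le_integral_ge0 => x _; first exact: abse_ge0.
    rewrite /= -EFinD lee_fin; have [v1|v1] := leP `|v x| 1.
      by apply: (le_trans v1); rewrite lerDl powR_ge0.
    apply: (@le_trans _ _ (`|v x| `^ r)); last by rewrite lerDr.
    by rewrite -[leLHS]powRr1//; apply: ler_powR => //; exact: ltW.
  rewrite (ge0_integralD mu mO _ _ _ m1).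
  + by rewrite (integral_cst mu mO 1%E) mul1e lte_add_pinfty.
  + by move=> x _ /=; exact: lee01.
  + exact: measurable_cst.
  + by move=> x _; rewrite lee_fin powR_ge0.
- move=> q; rewrite /Lp_norm avg; congr (_ `^ _)%E.
  by apply: (int_eq (fun t => (`|t - average Omega v| `^ q)%:E)) => // t; rewrite lee_fin powR_ge0.
- have c0' : (0 <= c0%:E)%E by rewrite lee_fin ltW.
  have E0 w : (0 <= energy Omega J r w)%E.
    by apply: integral_ge0 => x _; apply: integral_ge0 => y _; exact: (energy_fun_ge0 Omega r w (x, y) J0).
  have cJ0 x : (0 <= c0%:E * J x)%E by exact: mule_ge0.
  have mcJ : measurable_fun setT (fun z => c0%:E * J z)%E.
    by apply: emeasurable_funM => //; exact: measurable_cst.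
  have key : (c0%:E * energy Omega J r v <= \int[mu]_(y in Omega) \int[mu]_(x in Omega)
      (((`|u x - u y| `^ r)%R)%:E * K (x - y)%R))%E.
    rewrite -(energyZ r mO (ltW c00) mJ J0 mv) -(energy_ae r mO mcJ cJ0 mv uv).
    by apply: energy_le_seminorm => // x; rewrite JN.
  have X0 : (0 <= c0%:E * energy Omega J r v)%E by exact: mule_ge0.
  apply: gt0_ler_poweR; rewrite ?in_itv/= ?leey ?andbT//; first by rewrite invr_ge0 ltW.
  exact: le_trans key.
Qed.

End borel_version.

(** * The two inequalities for Borel functions and radial kernels *)

Section kernel_lower_bound.
Variables (R : realType) (d : nat) (N : 'rV[R]_d.+1 -> R) (K : 'rV[R]_d.+1 -> \bar R).
Hypotheses (nN : is_norm N) (kK : is_kernel K).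
Local Notation mu := (lebesgue_rV R _).

Lemma lebesgue_rV_singleton0 : mu [set (0 : 'rV[R]_d.+1)] = 0%E.
Proof.
apply/eqP; rewrite eq_le measure_ge0 andbT; apply/lee_addgt0Pr => e e0; rewrite add0e.
have [s s0 sE] := root_exists d e0.
have s20 : 0 < s / 2 by rewrite divr_gt0.
have -> : e%:E = ((s / 2 *+ 2) ^+ d.+1)%:E.
  by rewrite -sE; congr ((_ ^+ _)%:E); rewrite -mulr_natr divfK.
rewrite -lebesgue_rV_cube//; apply: le_lebesgue_rV => _ ->/=; by rewrite normr0.
Qed.

(** [K] is positive at some [y] other than 0, as it would otherwise vanish off a null set. Then [J]
    is at least [K y] where [N z <= N y], a set that contains a cube. *)
Lemma radial_sup_ge_ball_kernel : exists k rho : R, [/\ 0 < k, 0 < rho &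
  forall z, (k%:E * ball_kernel rho z <= radial_sup N K z)%E].
Proof.
have [K0 _ nae] := kK.
have [y [y0 Ky]] : exists y, y != 0 /\ (0 < K y)%E.
  apply: contrapT => h; apply: nae; exists [set 0]; split.
  - rewrite (_ : [set 0] = ~` (~` [set (0 : 'rV[R]_d.+1)])); last by rewrite setCK.
    apply: measurableC; apply: measurable_open_rV; apply: closed_openC.
    exact: (@accessible_closed_set1 _ (@hausdorff_accessible _ (@norm_hausdorff _ _))).
  - exact: lebesgue_rV_singleton0.
  - move=> x /= Kx; apply: contrapT => x0; apply: h; exists x; split; first exact/eqP.
    by rewrite lt_neqAle K0 andbT eq_sym; exact/eqP.
have [k k0 kKy] : exists2 k : R, 0 < k & (k%:E <= K y)%E.
  move: Ky; case: (K y) => [k|_|]//; last by exists 1 => //; rewrite leey.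
  by rewrite lte_fin => k0; exists k.
have [b b0 Nb] := is_norm_lipschitz nN.
have Ny : 0 < N y.
  rewrite lt_neqAle is_norm_ge0// andbT; apply/eqP => Ny0.
  by have [_ _ N0] := nN; move/eqP: y0; apply; exact: N0.
exists k, (N y / b); split => //; first by rewrite divr_gt0.
move=> z; rewrite /ball_kernel indicE; case: (boolP (z \in _)) => [/set_mem/= zb|_]; last first.
  by rewrite mule0 radial_sup_ge0.
rewrite mule1; apply: (le_trans kKy); apply: (le_trans (le_radial_sup N K y)).
apply: radial_sup_antitone; apply: (le_trans (Nb z)).
by rewrite mulrC -ler_pdivlMr// ltW.
Qed.

End kernel_lower_bound.

Section superlevel_sobolev.
Variables (R : realType) (d : nat) (Omega : set 'rV[R]_d.+1) (J : 'rV[R]_d.+1 -> \bar R).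
Variables (q C : R).
Hypotheses (oO : open Omega) (bO : bounded_set Omega) (q1 : 1 <= q) (C0 : 0 < C).
Hypotheses (mJ : measurable_fun setT J) (J0 : forall x, (0 <= J x)%E).
Local Notation mu := (lebesgue_rV R _).
Local Notation leb := (@lebesgue_measure R).
Hypothesis iso : forall E m, measurable E -> E `<=` Omega -> mu E = m%:E ->
  ((m `^ q^-1)%:E <= C%:E * (crossing Omega E J + m%:E))%E.

Let mO : measurable Omega. Proof. exact: measurable_open_rV. Qed.

(** [iso] is applied to the superlevel sets of [w], equal to [|v - a|] on [Omega] and to 0
    elsewhere, and integrated in [t]. Crossings integrate to at most the energy of [w], which is at
    most that of [v]; the measures integrate to the integral of [w]. *)
Lemma sobolev_energy (v : 'rV[R]_d.+1 -> R) (a : R) : measurable_fun setT v ->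
  ((\int[mu]_(x in Omega) (`|v x - a| `^ q)%:E) `^ q^-1 <=
   (2 * C)%:E * (energy Omega J 1 v + \int[mu]_(x in Omega) (`|v x - a|)%:E))%E.
Proof.
move=> mv; have q0 : 0 < q by exact: lt_le_trans q1.
pose w x : R := \1_Omega x * `|v x - a|.
have w0 x : 0 <= w x by rewrite mulr_ge0.
have mva : measurable_fun setT (fun x => `|v x - a|).
  by apply: measurableT_comp => //; apply: measurable_funB => //; exact: measurable_cst.
have mw : measurable_fun setT w by apply: measurable_funM => //; exact: measurable_indic.
have wO x : ~ Omega x -> w x = 0 by move=> nO; rewrite /w indicE memNset// mul0r.
have wE x : Omega x -> w x = `|v x - a| by move=> Ox; rewrite /w indicE mem_set// mul1r.
have SO t : superlevel w t `<=` Omega.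
  move=> x /andP[t0 tw]; apply: contrapT => nO; move: tw.
  by rewrite (wO _ nO) ltNge (ltW t0).
have mS t : measurable (superlevel w t) by exact: measurable_superlevel.
have Sfin t : (mu (superlevel w t) < +oo)%E.
  by apply: le_lt_trans (lebesgue_rV_bounded bO); apply: le_lebesgue_rV; exact: SO.
have -> : (\int[mu]_(x in Omega) (`|v x - a| `^ q)%:E = \int[mu]_x (w x `^ q)%:E)%E.
  rewrite integral_indic_mul; apply: eq_integral => x _; rewrite /w indicE.
  by case: (x \in Omega); rewrite ?mul1e ?mul1r// mul0e mul0r powR0// gt_eqF.
have int_w : (\int[mu]_(x in Omega) (`|v x - a|)%:E = \int[mu]_x (w x)%:E)%E.
  by rewrite integral_indic_mul; apply: eq_integral => x _; rewrite /w EFinM.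
apply: (le_trans (superlevel_Lq (m := mu) mw w0 q1 Sfin)).
rewrite EFinM -muleA; apply: lee_wpmul2l; first by rewrite lee_fin.
have cr0 t : (0 <= crossing Omega (superlevel w t) J)%E by exact: crossing_ge0.
have mcr := measurable_crossing_superlevel mO mJ J0 mw.
have mms := measurable_measure_superlevel mu mw.
have CE0 : (0 <= C%:E)%E by rewrite lee_fin ltW.
apply: (@le_trans _ _ (\int[leb]_t (C%:E * (crossing Omega (superlevel w t) J + mu (superlevel w t))))%E).
  apply: le_integral_ge0 => t _; first by rewrite lee_fin powR_ge0.
  have mE : mu (superlevel w t) = (fine (mu (superlevel w t)))%:E.
    by rewrite fineK// ge0_fin_numE.
  by rewrite [X in (_ <= _ * (_ + X))%E]mE; exact: (iso (mS t) (SO t) mE).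
have s0 (t : measurableTypeR R) : setT t ->
    (0 <= crossing Omega (superlevel w t) J + mu (superlevel w t))%E.
  by move=> _; apply: adde_ge0.
have ms := emeasurable_funD mcr mms.
rewrite (ge0_integralZl leb measurableT ms s0 CE0).
rewrite (ge0_integralD leb measurableT (fun t _ => cr0 t) mcr (fun t _ => measure_ge0 _ _) mms).
apply: lee_wpmul2l => //; apply: leeD.
  apply: (le_trans (coarea_le mO mJ J0 mw wO)); apply: le_energy => // x y Ox Oy.
  rewrite (wE _ Ox) (wE _ Oy); apply: (le_trans (ler_dist_dist _ _)).
  by rewrite opprB addrA subrK.
by rewrite (integral_measure_superlevel mu mw w0) int_w.
Qed.

End superlevel_sobolev.

Section poincare_radial_sup.
Variables (R : realType) (d : nat) (Omega : set 'rV[R]_d.+1) (N : 'rV[R]_d.+1 -> R).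
Variables (K : 'rV[R]_d.+1 -> \bar R) (r : R).
Hypotheses (oO : open Omega) (cO : connected Omega) (bO : bounded_set Omega).
Hypotheses (nN : is_norm N) (kK : is_kernel K) (r1 : 1 <= r).
Local Notation mu := (lebesgue_rV R _).
Local Notation J := (radial_sup N K).

Lemma poincare_radial_sup : exists2 C : R, 0 < C &
  forall v, measurable_fun setT v -> mu.-integrable Omega (EFin \o v) ->
    (\int[mu]_(x in Omega) (`|v x - average Omega v| `^ r)%:E <= C%:E * energy Omega J r v)%E.
Proof.
have [K0 _ _] := kK; have r0 : 0 < r by exact: lt_le_trans r1.
have mO : measurable Omega by exact: measurable_open_rV.
have [k [rho [k0 rho0 kJ]]] := radial_sup_ge_ball_kernel nN kK.
have [C C0 hC] := poincare_average oO cO bO r1 rho0.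
(* [C] may be 0, and the constant has to be positive. *)
exists ((C + 1) / k); first by rewrite divr_gt0// ltr_wpDl.
move=> v mv iv; apply: (le_trans (hC v mv iv)).
have kE0 (x : 'rV[R]_d.+1) : (0 <= k%:E * ball_kernel rho x)%E.
  by apply: mule_ge0; [rewrite lee_fin ltW|exact: ball_kernel_ge0].
have En0 : (0 <= energy Omega (ball_kernel rho) r v)%E.
  by apply: energy_ge0 => x; exact: ball_kernel_ge0.
apply: (@le_trans _ _ ((C + 1)%:E * energy Omega (ball_kernel rho) r v)%E).
  by apply: lee_wpmul2r => //; rewrite lee_fin lerDl.
rewrite EFinM -muleA; apply: lee_wpmul2l; first by rewrite lee_fin addr_ge0.
rewrite lee_pdivlMl//.
rewrite -(energyZ r mO (ltW k0) (@measurable_ball_kernel R d.+1 rho) (@ball_kernel_ge0 R d.+1 rho) mv).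
by apply: (le_energy kE0 kJ (ltW r0)).
Qed.

End poincare_radial_sup.

Lemma le_poweR (R : realType) (r : R) (x y : \bar R) : 0 <= r -> (0 <= x)%E -> (x <= y)%E ->
  (x `^ r <= y `^ r)%E.
Proof.
move=> r0 x0 xy; apply: gt0_ler_poweR => //; rewrite in_itv/= leey andbT//.
exact: le_trans xy.
Qed.

Unset Implicit Arguments.

(* The ambient space is R^(d+1). *)
Theorem proposition5p6 (R : realType) (d : nat) (Omega : set 'rV[R]_d.+1)
    (p : R) (N : 'rV[R]_d.+1 -> R) (K : 'rV[R]_d.+1 -> \bar R)
    (Omega_bounded : bounded_set Omega)
    (Omega_connected : connected Omega)
    (Omega_open : open Omega)
    (Omega_lipschitz : lipschitz_boundary Omega)
    (p_ge1 : 1 <= p)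
    (N_norm : is_norm N)
    (K_kernel : is_kernel K)
    (K_not_L1 : ~ (\int[lebesgue_rV R d.+1]_z K z < +oo)%E)
    (K_almost_decreasing : exists c0 : R, 0 < c0 <= 1 /\
       forall x y, N x <= N y -> (c0%:E * K y <= K x)%E)
    (K_doubling : exists D CD : R, [/\ 0 < D, 0 < CD &
       forall x y, N y = 2 * N x -> N x <= D -> (K x <= CD%:E * K y)%E])
    (K_integrable : (\int[lebesgue_rV R d.+1]_z
       (K z * (Num.min 1 (enorm z `^ p))%:E) < +oo)%E) :
  (exists C : R, 0 < C /\
     forall u, W_space K p Omega u ->
       (Lp_norm p Omega (fun x => (u x - average Omega u)%R)
        <= C%:E * W_seminorm K p Omega u)%E)
  /\
  (forall q : R, 1 <= q ->
     (exists C1 : R, 0 < C1 /\ forall m : R, 0 < m ->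
        ((m `^ q^-1 / C1)%:E
         <= perimeter (rearrangement K) (@ball_of_measure R d.+1 m))%E) ->
     exists C : R, 0 < C /\
       forall u, W_space K 1 Omega u ->
         (Lp_norm q Omega (fun x => (u x - average Omega u)%R)
          <= C%:E * W_seminorm K 1 Omega u)%E).
Proof.
have [K0 _ _] := K_kernel.
have [c0 [/andP[c00 _] cK]] := K_almost_decreasing.
have p0 : 0 < p by exact: lt_le_trans p_ge1.
have mO := measurable_open_rV Omega_open.
have Ofin := lebesgue_rV_bounded Omega_bounded.
have J0 x : (0 <= radial_sup N K x)%E by exact: radial_sup_ge0.
have mJ := measurable_radial_sup K N_norm.
have JN x : radial_sup N K (- x) = radial_sup N K x by exact: radial_supN.
have JK x : (c0%:E * radial_sup N K x <= K x)%E by exact: radial_sup_le.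
split.
  have [C C0 hC] := poincare_radial_sup Omega_open Omega_connected Omega_bounded N_norm K_kernel p_ge1.
  (* The factor [1 / c0] pays for [c0 J <= K]. *)
  exists ((C / c0) `^ p^-1); split; first by rewrite powR_gt0// divr_gt0.
  move=> u Wu; have [v [mv iv -> hW]] := borel_version mO Ofin p_ge1 c00 mJ J0 JN JK Wu.
  have E0 : (0 <= c0%:E * energy Omega (radial_sup N K) p v)%E.
    by apply: mule_ge0; [rewrite lee_fin ltW|exact: energy_ge0].
  have Cc0 : (0 <= (C / c0)%:E)%E by rewrite lee_fin divr_ge0// ltW.
  apply: (@le_trans _ _ (((C / c0)%:E * (c0%:E * energy Omega (radial_sup N K) p v)) `^ p^-1)%E).
    apply: le_poweR; first by rewrite invr_ge0 ltW.
      by apply: integral_ge0 => x _; rewrite lee_fin powR_ge0.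
    by rewrite muleA -EFinM divfK ?gt_eqF//; exact: hC.
  rewrite (poweRM _ Cc0 E0) poweR_EFin; apply: lee_wpmul2l => //.
  by rewrite lee_fin powR_ge0.
move=> q q1 [C1 [C10 hper]].
have [C [C0 iso]] := isoperimetric N_norm K0 c00 (ltW p0) cK K_integrable Omega_open
  Omega_bounded Omega_lipschitz (lt_le_trans ltr01 q1) C10 hper.
have [C2 C20 hC2] := poincare_radial_sup Omega_open Omega_connected Omega_bounded N_norm K_kernel
  (lexx (1 : R)).
exists (2 * C * (1 + C2) / c0); split; first by rewrite divr_gt0// !mulr_gt0// addr_gt0.
move=> u Wu; have [v [mv iv -> hW]] := borel_version mO Ofin (lexx 1) c00 mJ J0 JN JK Wu.
have E0 : (0 <= energy Omega (radial_sup N K) 1 v)%E by exact: energy_ge0.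
apply: (le_trans (sobolev_energy Omega_open Omega_bounded q1 C0 mJ J0 iso _ mv)).
have cE0 : (0 <= c0%:E * energy Omega (radial_sup N K) 1 v)%E.
  by apply: mule_ge0 => //; rewrite lee_fin ltW.
have k0 : 0 <= 2 * C * (1 + C2) / c0 by rewrite divr_ge0 ?(ltW c00)// !mulr_ge0 ?addr_ge0// ltW.
apply: (@le_trans _ _ ((2 * C * (1 + C2) / c0)%:E * (c0%:E * energy Omega (radial_sup N K) 1 v))%E).
  rewrite muleA -EFinM divfK ?gt_eqF// [in leRHS]EFinM -[leRHS]muleA.
  apply: lee_wpmul2l; first by rewrite lee_fin mulr_ge0// ltW.
  have C2E0 : (0 <= C2%:E)%E by rewrite lee_fin ltW.
  rewrite EFinD (ge0_muleDl _ lee01 C2E0) mul1e; apply: leeD => //.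
  apply: le_trans (hC2 v mv iv); apply: le_integral_ge0 => x _; first by rewrite lee_fin.
  by rewrite powRr1.
apply: lee_wpmul2l; first by rewrite lee_fin.
by move: hW; rewrite invr1 poweRe1.
Qed.
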